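(* Let $n\ge2$, $1\le k\le n-1$, $\alpha_1,\alpha_2,\beta_1,\beta_2\in\mathbb{R}$, $p\ge\max\{1,1+\alpha_2\}$ with $p>1+\alpha_2$ when $\alpha_2>0$, and $p\le r<\infty$. Consider $$\|R_kf\|_{L^r_{\beta_1,\beta_2}(\Xi_k(\mathbb{S}^n))}\le C\|f\|_{L^p_{\alpha_1,\alpha_2}(\mathbb{S}^n)}\quad\text{for all even radial }f\in L^p_{\alpha_1,\alpha_2}(\mathbb{S}^n).\qquad( * )$$ Let (N) denote the conditions: $\beta_1>k-n$, $\frac{\alpha_1+n}{p}-\frac{\beta_1+n-k}{r}\le k$, and $\frac{\beta_2+k+1}{r}\ge\frac{\alpha_2+1}{p}$, the last inequality being strict if $p=1+\alpha_2$. (A) If $k\ge2$, $( * )$ holds if and only if (N) holds. (B) If $k=1$ and in addition $\frac1p-\frac1r\le\frac12$ when $p>1$, or $r<2$ when $p=1$, then $( * )$ holds if and only if (N) holds.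
   Context: $\mathbb{S}^n\subset\mathbb{R}^{n+1}$ unit sphere with origin $0:=e_{n+1}$, distance $d$, surface measure $dx$. $\Xi_k(\mathbb{S}^n)$: $k$-dimensional totally geodesic submanifolds (intersections with $(k+1)$-dimensional linear subspaces) with $d(0,\xi)<\pi/2$, with invariant measure such that for $\varphi(\xi)=\tilde\varphi(d(0,\xi))$, $\int\varphi\,d\xi=c_{n,k}\int_0^{\pi/2}\tilde\varphi(h)\sin^{n-k-1}h\cos^kh\,dh$. $R_kf(\xi)=\int_\xi f\,d_\xi x$. $\|f\|^p_{L^p_{\alpha_1,\alpha_2}(\mathbb{S}^n)}=\int|f(x)|^p\sin^{\alpha_1}d(0,x)|\cos d(0,x)|^{\alpha_2}dx$, $\|\varphi\|^r_{L^r_{\beta_1,\beta_2}(\Xi_k(\mathbb{S}^n))}=\int|\varphi(\xi)|^r\sin^{\beta_1}d(0,\xi)\cos^{\beta_2}d(0,\xi)d\xi$. Even radial: $f(x)=F(|x_{n+1}|)$. $C$ independent of $f$. *)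

(* Defs.v *)
From HB Require Import structures.
From mathcomp Require Import all_boot all_order all_algebra.
From mathcomp Require Import all_classical all_reals all_analysis.
Set Implicit Arguments. Unset Strict Implicit. Unset Printing Implicit Defensive.
Import Order.TTheory GRing.Theory Num.Theory.
Local Open Scope classical_set_scope.
Local Open Scope ring_scope.

Section RadonDefs.
Variable R : realType.

Definition vnorm m (x : 'rV[R]_m) : R := Num.sqrt (\sum_i x 0 i ^+ 2).
Definition vdot m (x y : 'rV[R]_m) : R := \sum_i x 0 i * y 0 i.

Definition sphdist m (x y : 'rV[R]_m) : R := acos (vdot x y).
Definition origin n : 'rV[R]_(n.+1) := \row_(i < n.+1) (i == ord_max)%:R.

(* Lebesgue integral over R^m of a nonnegative function, as the iterated
   (Tonelli) integral of one-dimensional Lebesgue integrals. *)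
Fixpoint iint m : ('rV[R]_m -> \bar R) -> \bar R :=
  match m return ('rV[R]_m -> \bar R) -> \bar R with
  | 0 => fun g => g 0
  | m'.+1 => fun g =>
      (\int[@lebesgue_measure R]_t
          iint (fun v : 'rV[R]_m' => g (row_mx (\row_(_ < 1) t) v)))%E
  end.

(* Integral of a nonnegative function over the unit sphere S^m of R^(m+1)
   with respect to the surface measure, defined by the cone (polar-coordinates)
   formula:  int_{S^m} g dsigma = (m+1) int_{0<|x|<=1} g(x/|x|) dx. *)
Definition sph_int m (g : 'rV[R]_(m.+1) -> \bar R) : \bar R :=
  ((m.+1)%:R%:E * iint (fun x : 'rV[R]_(m.+1) =>
      if ((0 < vnorm x) && (vnorm x <= 1))%R then g ((vnorm x)^-1 *: x) else 0%E))%E.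

(* A k-dimensional totally geodesic submanifold xi of S^n is the intersection
   of S^n with a (k+1)-dimensional subspace V; we describe V as the row space
   of a full rank matrix G : 'M_(k+1, n+1). *)
Definition gsphere k n (G : 'M[R]_(k.+1, n.+1)) : set 'rV[R]_(n.+1) :=
  [set x | vnorm x = 1 /\ exists t : 'rV[R]_(k.+1), x = t *m G].

Definition dist0 k n (G : 'M[R]_(k.+1, n.+1)) : R :=
  inf [set sphdist (origin n) x | x in gsphere G].

(* Integral of a nonnegative h over xi = gsphere G w.r.t. its own surface
   measure d_xi x: the cone formula on V, where Lebesgue measure on V is the
   image of Lebesgue measure on R^(k+1) under t |-> t G, rescaled by the Gram
   determinant sqrt(det(G G^T)). *)
Definition xi_int k n (G : 'M[R]_(k.+1, n.+1)) (h : 'rV[R]_(n.+1) -> \bar R)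
  : \bar R :=
  ((Num.sqrt (\det (G *m G^T)))%:E * ((k.+1)%:R%:E *
     iint (fun t : 'rV[R]_(k.+1) =>
        if ((0 < vnorm (t *m G)) && (vnorm (t *m G) <= 1))%R
        then h ((vnorm (t *m G))^-1 *: (t *m G)) else 0%E)))%E.

Definition radon k n (f : 'rV[R]_(n.+1) -> R) (G : 'M[R]_(k.+1, n.+1)) : \bar R :=
  (xi_int G (fun x => (Num.max (f x) 0)%:E)
   - xi_int G (fun x => (Num.max (- f x) 0)%:E))%E.

(* Integral over Xi_k(S^n) of a nonnegative phi w.r.t. an O(n+1)-invariant
   measure: the subspace V is the row space of a standard Gaussian random
   (k+1) x (n+1) matrix (whose law is invariant under rotations), restricted
   to d(0, xi) < pi/2.  phi is evaluated on a matrix G representing xi. *)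
Definition Xi_int k n (phi : 'M[R]_(k.+1, n.+1) -> \bar R) : \bar R :=
  iint (fun v : 'rV[R]_(k.+1 * n.+1) =>
    let G := vec_mx v in
    if (\rank G == k.+1)%N && (dist0 G < pi / 2)
    then ((expR (- (\sum_i \sum_j G i j ^+ 2) / 2))%:E * phi G)%E
    else 0%E).

Definition normS n (p a1 a2 : R) (f : 'rV[R]_(n.+1) -> R) : \bar R :=
  (sph_int (fun x : 'rV[R]_(n.+1) =>
     (powR `|f x| p * powR (sin (sphdist (origin n) x)) a1
       * powR `|cos (sphdist (origin n) x)| a2)%:E) `^ p^-1)%E.

Definition normXi k n (r b1 b2 : R) (phi : 'M[R]_(k.+1, n.+1) -> \bar R) : \bar R :=
  (Xi_int (fun G : 'M[R]_(k.+1, n.+1) =>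
     (`|phi G| `^ r * (powR (sin (dist0 G)) b1 * powR (cos (dist0 G)) b2)%:E))
   `^ r^-1)%E.

Definition radon_ineq (k n : nat) (p r a1 a2 b1 b2 : R) : Prop :=
  exists C : R, forall F : R -> R,
    measurable_fun (`[0%R, 1%R] : set R) F ->
    let f := fun x : 'rV[R]_(n.+1) => F `|x 0 ord_max| in
    (normS p a1 a2 f < +oo)%E ->
    (normXi r b1 b2 (radon (k := k) f) <= C%:E * normS p a1 a2 f)%E.

Definition condN (k n : nat) (p r a1 a2 b1 b2 : R) : Prop :=
  [/\ k%:R - n%:R < b1,
      (a1 + n%:R) / p - (b1 + n%:R - k%:R) / r <= k%:R,
      (a2 + 1) / p <= (b2 + k%:R + 1) / r
    & p = 1 + a2 -> (a2 + 1) / p < (b2 + k%:R + 1) / r].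

End RadonDefs.

(* Main.v *)
(* Write [d] for the distance to the origin and [z = ln (tan d ^+ 2)], so that the
   origin is [z = -oo] and the equator [z = +oo]. Polar coordinates turn the norm of
   a zonal function on the sphere into a weighted [L^p] norm in [z]; the row space of
   a Gaussian matrix is rotation invariant, so the norm over the Grassmannian is
   likewise a weighted [L^r] norm in [v = ln (tan d(0, xi) ^+ 2)]. The LQ decomposition
   of a matrix computes the Radon transform of a zonal function as a one-dimensional
   integral over [z > v], and moving the weights into the kernel leaves the
   boundedness from [L^p(dz)] to [L^r(dv)] of the explicit kernel [log_kernel]. It
   behaves like [(z - v)^(k/2 - 1)] near the diagonal, and (N) says that it decays
   exponentially in [z - v] and stays bounded along the diagonal in both directions;
   if [p = 1 + a2] the decay in [z - v] fails near the equator and must be replaced by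
   decay along the diagonal. For [p > 1] it is then dominated by a translation
   invariant kernel, to which Schur's test ([p = r]) or the Hardy-Littlewood-Sobolev
   inequality ([p < r]) applies; for [p = 1] its columns are bounded in [L^r]. The
   restrictions for [k = 1] come from the singularity [(z - v)^(-1/2)]. Conversely,
   indicator functions of unit intervals show that (N) is necessary. *)
Require Import Defs.
From HB Require Import structures.
From mathcomp Require Import all_boot all_order all_algebra.
From mathcomp Require Import all_classical all_reals all_analysis.
From mathcomp Require Import measurable_realfun.
From mathcomp Require Import polyrcf ring lra.
Set Implicit Arguments. Unset Strict Implicit. Unset Printing Implicit Defensive.
Import Order.TTheory GRing.Theory Num.Theory.
Import numFieldNormedType.Exports.
Local Open Scope classical_set_scope.
Local Open Scope ring_scope.
Local Opaque integral.

(** * Measurability of matrix-valued functions *)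

Lemma measurableT_comp2 d d1 d2 d3 (X : measurableType d)
    (T1 : measurableType d1) (T2 : measurableType d2) (T3 : measurableType d3)
    (g : T1 -> T2 -> T3) (f : X -> T1) (h : X -> T2) :
  measurable_fun setT (fun z : T1 * T2 => g z.1 z.2) ->
  measurable_fun setT f -> measurable_fun setT h ->
  measurable_fun setT (fun x => g (f x) (h x)).
Proof.
by move=> mg mf mh; exact: (measurableT_comp mg (measurable_fun_pair mf mh)).
Qed.

Definition matrix_display : measure_display -> measure_display.
Proof. exact. Qed.

Section MeasurableMatrix.
Context d (T : measurableType d) (m n : nat).

Definition matrix_cylinders : set_system 'M[T]_(m, n) :=
  \bigcup_(ij in [set: 'I_m * 'I_n])
    preimage_set_system setT (fun A : 'M[T]_(m, n) => A ij.1 ij.2) measurable.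

HB.instance Definition _ := @isMeasurable.Build (matrix_display d)
  'M[T]_(m, n) <<s matrix_cylinders >> (@sigma_algebra0 _ _ _)
  (@sigma_algebraC _ _) (@sigma_algebra_bigcup _ _ _).

End MeasurableMatrix.

Definition row_cons (T : Type) n (t : T) (v : 'rV[T]_n) : 'rV[T]_n.+1 :=
  row_mx (\row_(_ < 1) t) v.

Lemma row_consP (T : Type) n (v : 'rV[T]_n.+1) : exists t w, v = row_cons t w.
Proof.
exists (v 0 0), (@rsubmx _ 1 1 n v); rewrite /row_cons.
rewrite [X in row_mx X _](_ : _ = @lsubmx _ 1 1 n v) ?hsubmxK//.
by apply/rowP => i; rewrite !mxE (ord1 i); congr (v _ _); exact/val_inj.
Qed.

Lemma row_consD (V : nmodType) n (s t : V) (v w : 'rV[V]_n) :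
  row_cons (s + t) (v + w) = row_cons s v + row_cons t w.
Proof.
rewrite [RHS](@add_row_mx _ 1 1 n) /row_cons.
rewrite [X in row_mx X _](_ : _ = \row_(_ < 1) s + \row_(_ < 1) t)//.
by apply/rowP => i; rewrite !mxE.
Qed.

Section MeasurableMatrixTheory.
Context d d' (X : measurableType d) (T : measurableType d').

Lemma measurable_mx_coord m n (i : 'I_m) (j : 'I_n) :
  measurable_fun setT (fun A : 'M[T]_(m, n) => A i j).
Proof.
by move=> _ Y mY; apply: sub_sigma_algebra; exists (i, j) => //; exists Y.
Qed.

Lemma measurable_mxP m n (f : X -> 'M[T]_(m, n)) : measurable_fun setT f <->
  forall i j, measurable_fun setT (fun x => f x i j).
Proof.
split=> [mf i j|mf]; first exact: (measurableT_comp (measurable_mx_coord i j)).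
apply: (measurability (@matrix_cylinders _ T m n)) => //.
by move=> _ [_ [[i j] _ [Y mY <-]] <-]; rewrite setTI; exact: (mf i j).
Qed.

Lemma measurable_row_mx m a b (f : X -> 'M[T]_(m, a)) (g : X -> 'M[T]_(m, b)) :
  measurable_fun setT f -> measurable_fun setT g ->
  measurable_fun setT (fun x => row_mx (f x) (g x)).
Proof.
move=> /measurable_mxP mf /measurable_mxP mg; apply/measurable_mxP => i j.
have [k ->|k ->] := split_ordP j.
  by under eq_fun do rewrite row_mxEl; exact: mf.
by under eq_fun do rewrite row_mxEr; exact: mg.
Qed.

Lemma measurable_lsubmx m a b (f : X -> 'M[T]_(m, a + b)) :
  measurable_fun setT f -> measurable_fun setT (fun x => lsubmx (f x)).
Proof.
move=> /measurable_mxP mf; apply/measurable_mxP => i j.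
by under eq_fun do rewrite mxE; exact: mf.
Qed.

Lemma measurable_vec_mx m n (f : X -> 'rV[T]_(m * n)) :
  measurable_fun setT f ->
  measurable_fun setT (fun x => vec_mx (f x) : 'M[T]_(m, n)).
Proof.
move=> /measurable_mxP mf; apply/measurable_mxP => i j.
by under eq_fun do rewrite -mxvecE vec_mxK; exact: mf.
Qed.

Lemma measurable_trmx m n (f : X -> 'M[T]_(m, n)) :
  measurable_fun setT f -> measurable_fun setT (fun x => (f x)^T).
Proof.
move=> /measurable_mxP mf; apply/measurable_mxP => i j.
by under eq_fun do rewrite mxE; exact: mf.
Qed.

Lemma measurable_row_cons n (f : X -> T) (g : X -> 'rV[T]_n) :
  measurable_fun setT f -> measurable_fun setT g ->
  measurable_fun setT (fun x => row_cons (f x) (g x)).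
Proof.
move=> mf mg; apply: (@measurable_row_mx 1 1 n) => //.
by apply/measurable_mxP => i j; under eq_fun do rewrite mxE.
Qed.

End MeasurableMatrixTheory.

Section MeasurableRealFunctions.
Context (R : realType).

Lemma measurable_invr : measurable_fun [set: R] (fun x : R => x^-1).
Proof.
have -> : (fun x : R => x^-1) = fun x =>
    if 0 < x then powR x (-1) else if x < 0 then - powR (- x) (-1) else 0.
  apply/funext => x; case: ltgtP => x0.
  - by rewrite powR_inv1 ?ltW.
  - by rewrite powR_inv1 ?invrN ?opprK// oppr_ge0 ltW.
  - by rewrite -x0 invr0.
apply: measurable_fun_ifT; first exact: measurable_fun_ltr.
  exact: measurable_powR.
apply: measurable_fun_ifT => //; first exact: measurable_fun_ltr.
apply: measurable_funN; apply: (measurableT_comp (@measurable_powR _ _)).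
exact: oppr_measurable.
Qed.

Lemma measurable_sqrtr : measurable_fun [set: R] Num.sqrt.
Proof. by apply: continuous_measurable_fun; exact: sqrt_continuous. Qed.

End MeasurableRealFunctions.

Section MeasurableMatrixAlgebra.
Context d (X : measurableType d) (R : realType).

Lemma measurable_addmx m n (f g : X -> 'M[R]_(m, n)) :
  measurable_fun setT f -> measurable_fun setT g ->
  measurable_fun setT (fun x => f x + g x).
Proof.
move=> /measurable_mxP mf /measurable_mxP mg; apply/measurable_mxP => i j.
by under eq_fun do rewrite mxE; exact: measurable_funD.
Qed.

Lemma measurable_scalemx m n (f : X -> R) (g : X -> 'M[R]_(m, n)) :
  measurable_fun setT f -> measurable_fun setT g ->
  measurable_fun setT (fun x => f x *: g x).
Proof.
move=> mf /measurable_mxP mg; apply/measurable_mxP => i j.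
by under eq_fun do rewrite mxE; exact: measurable_funM.
Qed.

Lemma measurable_mulmx a b c (f : X -> 'M[R]_(a, b)) (g : X -> 'M[R]_(b, c)) :
  measurable_fun setT f -> measurable_fun setT g ->
  measurable_fun setT (fun x => f x *m g x).
Proof.
move=> /measurable_mxP mf /measurable_mxP mg; apply/measurable_mxP => i j.
under eq_fun do rewrite mxE.
by apply: measurable_sum => k; exact: measurable_funM.
Qed.

Lemma measurable_det m (f : X -> 'M[R]_m) :
  measurable_fun setT f -> measurable_fun setT (fun x => \det (f x)).
Proof.
move=> /measurable_mxP mf; apply: measurable_sum => s.
apply: measurable_funM => //.
by apply: measurable_prod => i _; exact: mf.
Qed.

Lemma measurable_invmx m (f : X -> 'M[R]_m) :
  measurable_fun setT f -> measurable_fun setT (fun x => invmx (f x)).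
Proof.
move=> mf; apply/measurable_mxP => i j; have mdet := measurable_det mf.
rewrite (_ : (fun x => _) = fun x => if \det (f x) == 0 then f x i j
    else (\det (f x))^-1 * cofactor (f x) j i); last first.
  apply/funext => x; rewrite /invmx unitmxE unitfE.
  by case: eqP => // _; rewrite !mxE.
move/measurable_mxP: mf => mf; apply: measurable_fun_ifT => //.
  exact: measurable_fun_eqr.
apply: measurable_funM; first exact: (measurableT_comp (@measurable_invr R)).
apply: measurable_funM => //; apply: measurable_det; apply/measurable_mxP => a b.
by under eq_fun do rewrite !mxE; exact: mf.
Qed.

End MeasurableMatrixAlgebra.

Ltac measurable_step := match goal with
  | H : ?G |- ?G => exact H
  | |- measurable_fun _ (fun _ => ?c) => exact: measurable_cst
  | |- measurable_fun _ (fun x => x) => exact: measurable_id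
  | |- measurable_fun _ (fun x => fst (@?b x)) =>
      apply: (measurableT_comp measurable_fst)
  | |- measurable_fun _ (fun x => snd (@?b x)) =>
      apply: (measurableT_comp measurable_snd)
  | |- measurable_fun _ (fun x => @?b x && @?c x) => apply: measurable_and
  | |- measurable_fun _ (fun x => (@?b x < @?c x)%R) => apply: measurable_fun_ltr
  | |- measurable_fun _ (fun x => (@?b x <= @?c x)%R) => apply: measurable_fun_ler
  | |- measurable_fun _ (fun x => EFin (@?b x)) => apply/measurable_EFinP
  | |- measurable_fun _ (fun x => (@?b x * @?c x)%E) => apply: emeasurable_funM
  | |- measurable_fun _ (fun x => (@?b x * @?c x)%R) => apply: measurable_funM
  | |- measurable_fun _ (fun x => @GRing.add _ (@?b x) (@?c x)) => first
      [ apply: measurable_funB | apply: measurable_funD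
      | apply: emeasurable_funB | apply: emeasurable_funD ]
  | |- measurable_fun _ (fun x => (- @?c x)%R) => apply: measurable_funN
  | |- measurable_fun _ (fun x => (@?c x ^+ _)%R) => apply: measurable_funX
  | |- measurable_fun _ (fun x => `|@?c x|%R) =>
      apply: (measurableT_comp (@normr_measurable _ setT))
  | |- measurable_fun _ (fun x => abse (@?c x)) =>
      apply: (measurableT_comp (@abse_measurable _ setT))
  | |- measurable_fun _ (fun x => Num.sqrt (@?c x)) =>
      apply: (measurableT_comp (@measurable_sqrtr _))
  | |- measurable_fun _ (fun x => Num.max (@?b x) (@?c x)) =>
      apply: measurable_maxr
  | |- measurable_fun _ (fun x => Num.min (@?b x) (@?c x)) =>
      apply: measurable_minr
  | |- measurable_fun _ (fun x => expR (@?b x)) =>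
      apply: (measurableT_comp (@measurable_expR _))
  | |- measurable_fun _ (fun x => ln (@?b x)) =>
      apply: (measurableT_comp (@measurable_ln _))
  | |- measurable_fun _ (fun x => powR (@?b x) _) =>
      apply: (measurableT_comp (@measurable_powR _ _))
  | |- measurable_fun _ (fun x => poweR (@?b x) _) =>
      apply: (measurableT_comp (@measurable_poweR _ _))
  | |- measurable_fun _ (fun x => (@?b x)^-1%R) =>
      apply: (measurableT_comp (@measurable_invr _))
  | H : measurable_fun setT ?h |- measurable_fun _ (fun x => ?h (@?g x)) =>
      apply: (measurableT_comp H)
  | |- measurable_fun _ fst => exact: measurable_fst
  | |- measurable_fun _ snd => exact: measurable_snd
  | |- measurable_fun _ expR => exact: measurable_expR
  | |- measurable_fun _ (@GRing.opp _) => exact: oppr_measurable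
  | |- measurable_fun _ id => exact: measurable_id
  | |- measurable_fun _ (@GRing.inv _) => exact: measurable_invr
  | |- measurable_fun _ (@ln _) => exact: measurable_ln
  | |- measurable_fun _ (@Num.sqrt _) => exact: measurable_sqrtr
  | |- measurable_fun _ (Order.lt _) => apply: measurable_fun_ltr
  | |- measurable_fun _ (Order.le _) => apply: measurable_fun_ler
  | |- measurable_fun _ (GRing.add _) => apply: measurable_funD
  | |- measurable_fun _ (GRing.mul _) => apply: measurable_funM
  | |- measurable_fun _ (mule _) => apply: emeasurable_funM
  | |- _ => assumption
  | |- _ => apply: measurable_fun_ifT
  end.

Ltac solve_measurable := repeat measurable_step.

(** * One-dimensional substitutions *)

Lemma ge0_le_integralT d (T : measurableType d) (R : realType)
    (mu : {measure set T -> \bar R}) (f g : T -> \bar R) :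
  (forall x, 0 <= f x)%E -> (forall x, f x <= g x)%E ->
  (\int[mu]_x f x <= \int[mu]_x g x)%E.
Proof.
move=> f0 fg; have g0 x : (0 <= g x)%E by exact: le_trans (fg x).
rewrite !ge0_integralE//; apply: ereal_sup_le => _ [h hf <-]; exists h => // x.
by apply: (le_trans (hf x)); rewrite !patch_setT.
Qed.

Section CurriedTonelli.
Context d1 d2 (T1 : measurableType d1) (T2 : measurableType d2) (R : realType).
Variables (m1 : {sigma_finite_measure set T1 -> \bar R})
          (m2 : {sigma_finite_measure set T2 -> \bar R}).
Variable f : T1 -> T2 -> \bar R.
Hypotheses (mf : measurable_fun setT (fun z : T1 * T2 => f z.1 z.2))
           (f0 : forall x y, (0 <= f x y)%E).

Lemma fubini_tonelli_curry :
  (\int[m1]_x \int[m2]_y f x y = \int[m2]_y \int[m1]_x f x y)%E.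
Proof. exact: (@fubini_tonelli _ _ _ _ _ m1 m2 (fun z => f z.1 z.2)). Qed.

Lemma measurable_fun_integral_curry :
  measurable_fun setT (fun x => \int[m2]_y f x y)%E.
Proof.
exact: (@measurable_fun_fubini_tonelli_F _ _ _ _ _ m2 (fun z => f z.1 z.2)).
Qed.

End CurriedTonelli.

Section AffineSubstitution.
Context (R : realType).
Local Open Scope ereal_scope.
Notation mu := (@lebesgue_measure R).
Implicit Types (a c x : R) (A : set R) (f : R -> \bar R).

Let measurable_affine a c : measurable_fun setT
  (fun x : measurableTypeR R => (a * x + c)%R : measurableTypeR R).
Proof. by apply: measurable_funD => //; exact: measurable_funM. Qed.

Let lebesgue_measure_affine_gt0 a c A : (0 < a)%R -> measurable A ->
  mu A = a%:E * mu ((fun x => a * x + c)%R @^-1` A).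
Proof.
move=> a0 mA.
pose nu : {measure set (measurableTypeR R) -> \bar R} :=
  mscale (NngNum (ltW a0))
  (measure_function_pushforward__canonical__measure_function_Measure mu
     (measurable_affine a c)).
rewrite (@lebesgue_measure_unique R nu _ A mA)// => X [[l r] _ <-] /=.
rewrite /nu /mscale /= /pushforward.
have -> : (fun x => a * x + c)%R @^-1` `]l, r] =
    `]((l - c) / a)%R, ((r - c) / a)%R]%classic.
  apply/seteqP; split=> x /=;
    by rewrite !in_itv /= ltr_pdivrMr// ler_pdivlMr// ltrBlDr lerBrDr mulrC.
rewrite !lebesgue_measure_itv/= !lte_fin ltr_pM2r ?invr_gt0// ltrD2r.
case: ifPn => lr; last by rewrite mule0.
by rewrite -!EFinB -EFinM; congr (_%:E); field; rewrite gt_eqF.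
Qed.

Lemma lebesgue_measure_affine a c A : (a != 0)%R -> measurable A ->
  mu A = `|a|%R%:E * mu ((fun x => a * x + c)%R @^-1` A).
Proof.
move=> a0 mA; case: (ltgtP a 0%R) a0 => // [an|ap] _; last first.
  by rewrite gtr0_norm//; exact: lebesgue_measure_affine_gt0.
have an' : (0 < - a)%R by rewrite oppr_gt0.
rewrite ltr0_norm// (lebesgue_measure_affine_gt0 c an' mA); congr (_ * _).
rewrite -lebesgue_measureN.
  by rewrite /pushforward; congr (mu _); apply/seteqP; split=> x /=; rewrite mulrNN.
by rewrite -[X in measurable X]setTI; exact: (measurable_affine (- a) c).
Qed.

Lemma ge0_integral_affine f a c : measurable_fun setT f ->
  (forall x, 0 <= f x) -> (a != 0)%R ->
  \int[mu]_x f (a * x + c)%R = (`|a|^-1)%:E * \int[mu]_x f x.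
Proof.
move=> mf f0 a0.
have a1 : (0 <= `|a|^-1)%R by rewrite invr_ge0.
have := ge0_integral_pushforward (measurable_affine a c) mu measurableT mf.
rewrite preimage_setT => /(_ (fun y _ => f0 y)) <-.
rewrite -[RHS](@ge0_integral_mscale _ (measurableTypeR R) _ mu setT measurableT
  (NngNum a1) f) //.
apply: eq_measure_integral => A mA _.
transitivity (mu ((fun x : R => (a * x + c)%R) @^-1` A)) => //.
transitivity (`|a|^-1%:E * mu A) => //; rewrite (lebesgue_measure_affine c a0 mA).
by rewrite muleA -EFinM mulVf ?mul1e// normr_eq0.
Qed.

Lemma ge0_integral_dilate f a : measurable_fun setT f ->
  (forall x, 0 <= f x) -> (a != 0)%R ->
  \int[mu]_x f (a * x)%R = (`|a|^-1)%:E * \int[mu]_x f x.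
Proof.
move=> mf f0 a0; rewrite -(@ge0_integral_affine f a 0 mf f0 a0).
by apply: eq_integral => x _; rewrite addr0.
Qed.

Lemma ge0_integral_shift f c : measurable_fun setT f -> (forall x, 0 <= f x) ->
  \int[mu]_x f (x + c)%R = \int[mu]_x f x.
Proof.
move=> mf f0; have := @ge0_integral_affine f 1 c mf f0 (oner_neq0 R).
rewrite normr1 invr1 mul1e => <-.
by apply: eq_integral => x _; rewrite mul1r.
Qed.

Lemma ge0_integral_reflect f c : measurable_fun setT f -> (forall x, 0 <= f x) ->
  \int[mu]_x f (c - x)%R = \int[mu]_x f x.
Proof.
have N1 : (-1 != 0 :> R)%R by rewrite oppr_eq0 oner_eq0.
move=> mf f0; have := @ge0_integral_affine f (-1) c mf f0 N1.
rewrite normrN1 invr1 mul1e => <-.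
by apply: eq_integral => x _; rewrite mulN1r addrC.
Qed.

Lemma ge0_integral_opp f : measurable_fun setT f -> (forall x, 0 <= f x) ->
  \int[mu]_x f (- x)%R = \int[mu]_x f x.
Proof.
move=> mf f0; rewrite -[RHS](ge0_integral_reflect 0 mf f0).
by apply: eq_integral => x _; rewrite sub0r.
Qed.

Lemma integral_patch_itv (i : interval R) f :
  \int[mu]_(x in [set` i]) f x = \int[mu]_x (if x \in i then f x else 0).
Proof.
by rewrite integral_mkcond; apply: eq_integral => x _; rewrite patchE mem_setE.
Qed.

End AffineSubstitution.

Section ExpSubstitution.
Context (R : realType).
Local Open Scope ereal_scope.
Notation mu := (@lebesgue_measure R).
Implicit Types w g : R -> \bar R.

(* Both lemmas compute the double integral of [g u * w (u / e^x)] over [u > 0]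
   and [x : R]; it factors in either order because [dx] is translation invariant
   and [du / u] is dilation invariant. *)
Let dilated_product w g (x u : R) :=
  (if (0 < u)%R then g u else 0) * w (u * expR (- x))%R.

Section DilatedProduct.
Variables w g : R -> \bar R.
Hypotheses (mw : measurable_fun setT w) (w0 : forall x, 0 <= w x).
Hypotheses (mg : measurable_fun setT g) (g0 : forall x, 0 <= g x).

Let dilated_product_ge0 x u : 0 <= dilated_product w g x u.
Proof. by rewrite mule_ge0//; case: ifP. Qed.

Let measurable_dilated_product :
  measurable_fun setT (fun z : R * R => dilated_product w g z.1 z.2).
Proof. by rewrite /dilated_product; solve_measurable. Qed.

Lemma integral_dilated_product_log :
  \int[mu]_x \int[mu]_u dilated_product w g x u =
  (\int[mu]_x w (expR x)) * \int[mu]_u (if (0 < u)%R then g u else 0).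
Proof.
rewrite fubini_tonelli_curry// -ge0_integralZl//; first last.
- exact: integral_ge0.
- by move=> u _; case: ifP.
- by solve_measurable.
apply: eq_integral => u _; rewrite /dilated_product; case: ifPn => u0; last first.
  by under eq_integral do rewrite mul0e; rewrite integral0 mule0.
rewrite ge0_integralZl//; last by solve_measurable.
rewrite muleC; congr (_ * _).
rewrite -[RHS](ge0_integral_reflect (ln u))//; last by solve_measurable.
by apply: eq_integral => x _; rewrite expRB lnK// expRN.
Qed.

Lemma integral_dilated_product_scale :
  \int[mu]_x \int[mu]_u dilated_product w g x u =
  (\int[mu]_s (if (0 < s)%R then (s^-1)%:E * w s else 0)) *
  (\int[mu]_x ((expR x)%:E * g (expR x))).
Proof.
pose p s x := (if (0 < s)%R then g (s * expR x)%R else 0) * w s.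
have p0 s x : 0 <= p s x by rewrite mule_ge0//; case: ifP.
have mp : measurable_fun setT (fun z : R * R => p z.1 z.2).
  by rewrite /p; solve_measurable.
have mpx x : measurable_fun setT (p^~ x) by rewrite /p; solve_measurable.
transitivity (\int[mu]_x \int[mu]_s ((expR x)%:E * p s x)).
  apply: eq_integral => x _.
  have e0 : (expR x != 0)%R by rewrite gt_eqF// expR_gt0.
  have mdx : measurable_fun setT (dilated_product w g x).
    by rewrite /dilated_product; solve_measurable.
  have := ge0_integral_dilate mdx (dilated_product_ge0 x) e0.
  rewrite gtr0_norm ?expR_gt0// => /(congr1 (fun z => (expR x)%:E * z)).
  rewrite muleA -EFinM divff// mul1e => <-.
  rewrite [RHS]ge0_integralZl_EFin ?expR_ge0//; last exact: mpx.
  congr (_ * _).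
  apply: eq_integral => s _; rewrite /dilated_product /p.
  by rewrite pmulr_rgt0 ?expR_gt0// mulrAC expRxMexpNx_1 mul1r (mulrC s).
rewrite -fubini_tonelli_curry//; first last.
- by move=> s x; rewrite mule_ge0// lee_fin expR_ge0.
- by solve_measurable.
have mh : measurable_fun setT (fun x => (expR x)%:E * g (expR x)).
  by solve_measurable.
have h0 x : 0 <= (expR x)%:E * g (expR x) by rewrite mule_ge0// lee_fin expR_ge0.
rewrite -ge0_integralZr//; first last.
- exact: integral_ge0.
- by move=> s _; case: ifPn => // s0; rewrite mule_ge0// lee_fin invr_ge0 ltW.
- by solve_measurable.
apply: eq_integral => s _; rewrite /p; case: ifPn => s0; last first.
  by under eq_integral do rewrite mul0e mule0; rewrite integral0 mul0e.
rewrite -[X in _ * X](ge0_integral_shift (ln s) mh h0).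
rewrite -ge0_integralZl//; last 2 first.
- by apply: (measurableT_comp mh); solve_measurable.
- by rewrite mule_ge0// lee_fin invr_ge0 ltW.
apply: eq_integral => x _; rewrite expRD lnK// muleACA -EFinM.
rewrite mulrCA mulVf ?gt_eqF// mulr1 (mulrC (expR x) s).
by rewrite (muleC (w s)).
Qed.

End DilatedProduct.

Lemma integral_inv_itv (a b : R) : (0 < a)%R -> (a < b)%R ->
  \int[mu]_(x in `]a, b]) (x^-1)%:E = (ln b - ln a)%:E.
Proof.
move=> a0 ab; have pos x : (a <= x)%R -> (0 < x)%R by exact: lt_le_trans.
rewrite integral_itv_obnd_cbnd; last first.
  by apply/measurable_EFinP/measurable_funTS; exact: measurable_invr.
rewrite (@continuous_FTC2 _ _ (@ln R))//.
- apply/continuous_in_subspaceT => x; rewrite inE /= in_itv /= => /andP[ax _].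
  by apply: cvgV; [rewrite gt_eqF// pos|exact: cvg_id].
- split.
  + move=> x; rewrite in_itv /= => /andP[/ltW ax _].
    by apply: ex_derive; apply: is_derive1_ln; exact: pos.
  + by apply: cvg_at_right_filter; exact: continuous_ln.
  + by apply: cvg_at_left_filter; apply: continuous_ln; exact: pos (ltW ab).
- move=> x; rewrite in_itv /= => /andP[/ltW ax _].
  have := is_derive1_ln (pos _ ax) => ?.
  by rewrite derive1E derive_val.
Qed.

Lemma ge0_integral_exp g : measurable_fun setT g -> (forall x, 0 <= g x) ->
  \int[mu]_x ((expR x)%:E * g (expR x)) =
  \int[mu]_u (if (0 < u)%R then g u else 0).
Proof.
have e1 : (1 < expR 1 :> R)%R by rewrite expR_gt1.
pose w (u : R) : \bar R := if u \in `]1%R, expR 1] then 1 else 0.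
have mw : measurable_fun setT w.
  rewrite /w (_ : (fun u : R => _) = fun u : R =>
      if ((1 < u) && (u <= expR 1))%R then 1 else 0); first by solve_measurable.
  by apply/funext => u; rewrite in_itv.
have w0 u : 0 <= w u by rewrite /w; case: ifP.
have w_log : \int[mu]_x w (expR x) = 1.
  transitivity (\int[mu]_(x in `]0%R, 1%R]) (cst 1) x).
    rewrite integral_patch_itv; apply: eq_integral => x _.
    by rewrite /w !in_itv /= expR_gt1 ler_expR.
  by rewrite integral_cst//= lebesgue_measure_itv/= lte_fin ltr01 sube0 mule1.
have w_scale : \int[mu]_s (if (0 < s)%R then (s^-1)%:E * w s else 0) = 1.
  transitivity (\int[mu]_(s in `]1%R, expR 1]) (s^-1)%:E); last first.
    by rewrite integral_inv_itv// expRK ln1 subr0.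
  rewrite integral_patch_itv; apply: eq_integral => s _; rewrite /w in_itv /=.
  case: ifPn => [_|s0]; first by case: ifP; rewrite ?mule1 ?mule0.
  by rewrite ifF//; apply: contraNF s0 => /andP[s1 _]; exact: lt_trans s1.
move=> mg g0; have := integral_dilated_product_scale mw w0 mg g0.
by rewrite integral_dilated_product_log// w_log w_scale !mul1e => ->.
Qed.

End ExpSubstitution.

(** * Iterated integrals over row vectors *)

Section IteratedIntegral.
Context (R : realType).
Local Open Scope ereal_scope.
Notation mu := (@lebesgue_measure R).

Lemma iintS m (g : 'rV[R]_m.+1 -> \bar R) :
  iint g = \int[mu]_s iint (fun v : 'rV[R]_m => g (row_cons s v)).
Proof. by []. Qed.

Lemma iint0 m : iint (fun _ : 'rV[R]_m => 0) = 0.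
Proof. by elim: m => [|m IH] //=; rewrite IH integral0. Qed.

Lemma iint_ge0 m (g : 'rV[R]_m -> \bar R) : (forall x, 0 <= g x) -> 0 <= iint g.
Proof.
elim: m g => [|m IH] g g0 //=.
by apply: integral_ge0 => t _; apply: IH => v.
Qed.

Lemma ge0_le_iint m (g h : 'rV[R]_m -> \bar R) :
  (forall x, 0 <= g x) -> (forall x, g x <= h x) -> iint g <= iint h.
Proof.
elim: m g h => [|m IH] g h g0 gh //=.
by apply: ge0_le_integralT => t; [apply: iint_ge0 => v|apply: IH => v].
Qed.

Lemma measurable_slice d (T : measurableType d) m (g : T -> 'rV[R]_m.+1 -> \bar R) :
  measurable_fun setT (fun z : T * 'rV[R]_m.+1 => g z.1 z.2) ->
  measurable_fun setT (fun z : (T * R) * 'rV[R]_m => g z.1.1 (row_cons z.1.2 z.2)).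
Proof.
move=> mg; apply: (measurableT_comp2 mg).
  exact: (measurableT_comp measurable_fst measurable_fst).
apply: measurable_row_cons => //.
exact: (measurableT_comp measurable_snd measurable_fst).
Qed.

Lemma measurable_iint d (T : measurableType d) m (g : T -> 'rV[R]_m -> \bar R) :
  measurable_fun setT (fun z : T * 'rV[R]_m => g z.1 z.2) ->
  (forall t x, 0 <= g t x) -> measurable_fun setT (fun t => iint (g t)).
Proof.
elim: m d T g => [|m IH] d T g mg g0 /=.
  exact: (measurableT_comp2 mg (@measurable_id _ _ _) (measurable_cst _)).
apply: measurable_fun_integral_curry; last by move=> *; exact: iint_ge0.
apply: (IH _ _ (fun (z : T * R) v => g z.1 (row_cons z.2 v))) => //.
exact: measurable_slice.
Qed.

Lemma measurable_iint_slice m (g : 'rV[R]_m.+1 -> \bar R) :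
  measurable_fun setT g -> (forall x, 0 <= g x) ->
  measurable_fun setT (fun s => iint (fun v : 'rV[R]_m => g (row_cons s v))).
Proof.
move=> mg g0; apply: measurable_iint => //.
by apply: (measurableT_comp mg); exact: measurable_row_cons.
Qed.

Lemma measurable_row_cons_comp m (g : 'rV[R]_m.+1 -> \bar R) s :
  measurable_fun setT g -> measurable_fun setT (fun v => g (row_cons s v)).
Proof.
by move=> mg; apply: (measurableT_comp mg); exact: measurable_row_cons.
Qed.

Lemma fubini_tonelli_iint d (T : measurableType d)
    (m1 : {sigma_finite_measure set T -> \bar R}) m (g : T -> 'rV[R]_m -> \bar R) :
  measurable_fun setT (fun z : T * 'rV[R]_m => g z.1 z.2) ->
  (forall t x, 0 <= g t x) ->
  \int[m1]_t iint (g t) = iint (fun v => \int[m1]_t g t v).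
Proof.
elim: m g => [|m IH] g mg g0 //=.
rewrite fubini_tonelli_curry; first last.
- by move=> *; exact: iint_ge0.
- apply: (measurable_iint (g := fun (z : T * R) v => g z.1 (row_cons z.2 v))) => //.
  exact: measurable_slice.
apply: eq_integral => s _; apply: IH => //.
apply: (measurableT_comp2 mg) => //.
exact: measurable_row_cons.
Qed.

Lemma iint_exchange a b (g : 'rV[R]_a -> 'rV[R]_b -> \bar R) :
  measurable_fun setT (fun z : 'rV[R]_a * 'rV[R]_b => g z.1 z.2) ->
  (forall u v, 0 <= g u v) ->
  iint (fun u => iint (g u)) = iint (fun v => iint (fun u => g u v)).
Proof.
elim: a g => [|a IH] g mg g0 //=.
transitivity (\int[mu]_s iint (fun v => iint (fun u => g (row_cons s u) v))).
  apply: eq_integral => s _; apply: IH => //.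
  apply: (measurableT_comp2 mg) => //.
  exact: measurable_row_cons.
rewrite fubini_tonelli_iint//; last by move=> *; exact: iint_ge0.
apply: (measurable_iint (g := fun (z : R * 'rV[R]_b) u => g (row_cons z.1 u) z.2)) => //.
apply: (measurableT_comp2 mg).
  by apply: measurable_row_cons => //; exact: measurableT_comp.
exact: measurableT_comp.
Qed.

Lemma iintZl m (g : 'rV[R]_m -> \bar R) (k : \bar R) : measurable_fun setT g ->
  (forall x, 0 <= g x) -> 0 <= k -> iint (fun x => k * g x) = k * iint g.
Proof.
elim: m g => [|m IH] g mg g0 k0 //=.
rewrite -ge0_integralZl//; last 2 first.
- exact: measurable_iint_slice.
- by move=> t _; exact: iint_ge0.
by apply: eq_integral => t _; apply: IH => //; exact: measurable_row_cons_comp.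
Qed.

Lemma iintD m (g h : 'rV[R]_m -> \bar R) :
  measurable_fun setT g -> measurable_fun setT h ->
  (forall x, 0 <= g x) -> (forall x, 0 <= h x) ->
  iint (fun x => g x + h x) = iint g + iint h.
Proof.
elim: m g h => [|m IH] g h mg mh g0 h0 //=.
rewrite -ge0_integralD//; first last.
- exact: measurable_iint_slice.
- by move=> t _; exact: iint_ge0.
- exact: measurable_iint_slice.
- by move=> t _; exact: iint_ge0.
by apply: eq_integral => t _; apply: IH => //; exact: measurable_row_cons_comp.
Qed.

Lemma iint_shift m (g : 'rV[R]_m -> \bar R) (w : 'rV[R]_m) :
  measurable_fun setT g -> (forall x, 0 <= g x) ->
  iint (fun x => g (x + w)%R) = iint g.
Proof.
elim: m g w => [|m IH] g w mg g0 /=.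
  by congr (g _); rewrite [w]thinmx0 addr0.
pose h s := iint (fun v : 'rV[R]_m => g (row_cons s v)).
have [t [u ->]] := row_consP w.
transitivity (\int[mu]_s h (s + t)%R); last first.
  rewrite ge0_integral_shift//; first exact: measurable_iint_slice.
  by move=> s; exact: iint_ge0.
apply: eq_integral => s _; rewrite /h -(IH (fun v => g (row_cons (s + t)%R v)) u)//.
  by congr iint; apply/funext => v; rewrite -row_consD.
exact: measurable_row_cons_comp.
Qed.

Lemma iint_row_mx a b (g : 'rV[R]_(a + b) -> \bar R) :
  iint g = iint (fun u : 'rV[R]_a => iint (fun v : 'rV[R]_b => g (row_mx u v))).
Proof.
elim: a g => [|a IH] g /=.
  congr iint; apply/funext => v; congr g; apply/rowP => i; rewrite mxE.
  by case: splitP => [[]//|j ij]; congr (v 0%R _); exact/val_inj.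
apply: eq_integral => s _; rewrite IH; congr iint; apply/funext => u.
congr iint; apply/funext => v; congr g.
by rewrite row_mxA (_ : esym (addnA 1%N a b) = erefl) ?castmx_id.
Qed.

End IteratedIntegral.

(** * Linear changes of variables *)

Section BlockFactorization.
Context (F : fieldType) (m : nat).
Implicit Types A : 'M[F]_(1 + m).

Lemma unitmx_pivot A : A \in unitmx ->
  exists u : 'rV_m, (ulsubmx A + u *m dlsubmx A) 0 0 != 0.
Proof.
move=> uA; have [ul0|] := eqVneq (ulsubmx A 0 0) 0; last first.
  by exists 0; rewrite mul0mx addr0.
have /matrix0Pn[i [j dlij]] : dlsubmx A != 0.
  apply: contraTneq uA => dl0; rewrite unitmxE -[A]submxK dl0.
  by rewrite (@det_ublock F 1 m) [ulsubmx A]mx11_scalar ul0 det_scalar1 mul0r unitr0.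
by exists (delta_mx 0 i); rewrite mxE ul0 add0r -rowE mxE -(ord1 j).
Qed.

Lemma block_mx_schur (d : F) (u : 'rV_m) (l : 'cV_m) (S : 'M[F]_m) : d != 0 ->
  block_mx d%:M u l S =
  block_mx 1%:M 0 (d^-1 *: l) 1%:M *m
  block_mx d%:M u 0 (S - d^-1 *: (l *m u)).
Proof.
move=> d0; rewrite mulmx_block !mul1mx !mul0mx !addr0.
by rewrite mul_mx_scalar scalerA divff// scale1r -scalemxAl addrC subrK.
Qed.

Lemma unitmx_block_factorization A : A \in unitmx ->
  exists (u w : 'rV_m) (l : 'cV_m) (d : F) (S : 'M[F]_m),
  [/\ d != 0, S \in unitmx &
      A = block_mx 1%:M u 0 1%:M *m
          (block_mx 1%:M 0 l 1%:M *m block_mx d%:M w 0 S) ].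
Proof.
move=> uA; have [u du] := unitmx_pivot uA.
pose d := (ulsubmx A + u *m dlsubmx A) 0 0.
pose w := ursubmx A + u *m drsubmx A.
pose S := drsubmx A - d^-1 *: (dlsubmx A *m w).
have AE : A = block_mx 1%:M (- u) 0 1%:M *m
    (block_mx 1%:M 0 (d^-1 *: dlsubmx A) 1%:M *m block_mx d%:M w 0 S).
  rewrite -block_mx_schur// mulmx_block !mul1mx !mul0mx !add0r /d -mx11_scalar.
  by rewrite !mulNmx !addrK submxK.
exists (- u), w, (d^-1 *: dlsubmx A), d, S; split => //.
move: uA; rewrite {1}AE !unitmxE !det_mulmx !(@det_ublock F 1 m) (@det_lblock F 1 m).
by rewrite !det1 !mul1r unitrM => /andP[].
Qed.

End BlockFactorization.

Section LinearChange.
Context (R : realType).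
Local Open Scope ereal_scope.
Notation mu := (@lebesgue_measure R).

Definition scales_iint m (A : 'M[R]_m) := forall g : 'rV[R]_m -> \bar R,
  measurable_fun setT g -> (forall x, 0 <= g x) ->
  iint (fun x => g (x *m A)%R) = (`|(\det A)%R|^-1)%R%:E * iint g.

Lemma measurable_comp_mulmx a b (g : 'rV[R]_b -> \bar R) (A : 'M[R]_(a, b)) :
  measurable_fun setT g ->
  measurable_fun setT (fun x : 'rV[R]_a => g (x *m A)%R).
Proof. by move=> mg; apply: (measurableT_comp mg); exact: measurable_mulmx. Qed.

Lemma scales_iint1 m : scales_iint (1%:M : 'M[R]_m)%R.
Proof.
move=> g mg g0; rewrite det1 normr1 invr1 mul1e.
by congr iint; apply/funext => x; rewrite mulmx1.
Qed.

Lemma scales_iintM m (A B : 'M[R]_m) :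
  scales_iint A -> scales_iint B -> scales_iint (A *m B)%R.
Proof.
move=> hA hB g mg g0.
transitivity (iint (fun x => (fun y => g (y *m B)%R) (x *m A)%R)).
  by congr iint; apply/funext => x; rewrite mulmxA.
rewrite (hA (fun y => g (y *m B)%R))//; last exact: measurable_comp_mulmx.
by rewrite hB// muleA -EFinM det_mulmx normrM invfM.
Qed.

Lemma scales_iint_ublock m (d : R) (u : 'rV[R]_m) (A : 'M[R]_m) :
  (d != 0)%R -> A \in unitmx -> scales_iint A ->
  scales_iint (block_mx (d%:M : 'M[R]_1)%R u 0%R A : 'M[R]_m.+1).
Proof.
move=> d0 uA hA g mg g0.
pose h s := iint (fun v : 'rV[R]_m => g (row_cons s v)).
have row_mulE (s : R) (v : 'rV[R]_m) :
    (row_cons s v *m block_mx (d%:M : 'M[R]_1) u 0 A =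
     row_cons (d * s) ((v + (s *: u) *m invmx A) *m A))%R.
  rewrite [LHS](@mul_row_block R 1 1 m 1 m) /row_cons mulmx0 addr0 mulmxDl.
  rewrite -mulmxA mulVmx// mulmx1.
  congr row_mx; first by apply/rowP => i; rewrite mul_mx_scalar !mxE.
  rewrite addrC; congr (_ + _)%R.
  by apply/rowP => i; rewrite !mxE big_ord1 !mxE.
have slice s : iint (fun v : 'rV[R]_m =>
     g (row_cons s v *m block_mx (d%:M : 'M[R]_1) u 0 A)%R) =
    (`|(\det A)%R|^-1)%R%:E * h (d * s)%R.
  have ms : measurable_fun setT (fun v : 'rV[R]_m => g (row_cons (d * s)%R v)).
    exact: measurable_row_cons_comp.
  rewrite /h -(hA _ ms)//.
  rewrite -[RHS](iint_shift (g := fun v => g (row_cons (d * s)%R (v *m A)%R))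
    ((s *: u) *m invmx A)%R)//; last exact: measurable_comp_mulmx ms.
  by congr iint; apply/funext => v; rewrite row_mulE.
have mh : measurable_fun setT h by exact: measurable_iint_slice.
have h0 s : 0 <= h s by exact: iint_ge0.
rewrite iintS; under eq_integral do rewrite slice.
rewrite ge0_integralZl_EFin//; last first.
  by apply: (measurableT_comp mh); exact: measurable_funM.
rewrite (ge0_integral_dilate mh h0 d0) muleA -EFinM; congr (_%:E * _).
by rewrite (@det_ublock R 1 m) det_scalar1 normrM invfM mulrC.
Qed.

Lemma scales_iint_lshear m (l : 'cV[R]_m) :
  scales_iint (block_mx (1%:M : 'M[R]_1)%R 0%R l 1%:M%R : 'M[R]_m.+1).
Proof.
move=> g mg g0.
rewrite (@det_lblock R 1 m) !det1 mulr1 normr1 invr1 mul1e /=.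
have row_mulE (s : R) (v : 'rV[R]_m) :
    (row_cons s v *m block_mx (1%:M : 'M[R]_1) 0 l 1%:M =
     row_cons (s + (v *m l) 0 0) v)%R.
  rewrite [LHS](@mul_row_block R 1 1 m 1 m) /row_cons !mulmx1 mulmx0 add0r; congr row_mx.
  by apply/rowP => i; rewrite !mxE (ord1 i).
transitivity (\int[mu]_s iint (fun v : 'rV[R]_m =>
    g (row_cons (s + (v *m l) 0 0)%R v))).
  by apply: eq_integral => s _; congr iint; apply/funext => v; rewrite -row_mulE.
have mvl : measurable_fun setT (fun v : 'rV[R]_m => (v *m l)%R 0%R 0%R).
  by apply: (measurableT_comp (measurable_mx_coord 0%R 0%R)); exact: measurable_mulmx.
rewrite fubini_tonelli_iint//; last first.
  apply: (measurableT_comp mg); apply: measurable_row_cons => //.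
  by apply: measurable_funD => //; exact: (measurableT_comp mvl).
rewrite fubini_tonelli_iint//; last first.
  by apply: (measurableT_comp mg); exact: measurable_row_cons.
congr iint; apply/funext => v.
apply: (@ge0_integral_shift R (fun s => g (row_cons s v))) => //.
by apply: (measurableT_comp mg); exact: measurable_row_cons.
Qed.

Lemma scales_iint_unitmx m (A : 'M[R]_m) : A \in unitmx -> scales_iint A.
Proof.
elim: m A => [|m IH] A uA.
  by rewrite [A]flatmx0 -[0%R](flatmx0 1%:M%R); exact: scales_iint1.
have [u [w [l [d [S [d0 uS ->]]]]]] :=
  @unitmx_block_factorization R m (A : 'M[R]_(1 + m)) uA.
apply: scales_iintM.
  apply: scales_iint_ublock; [exact: oner_neq0|exact: unitmx1|exact: scales_iint1].
apply: scales_iintM; first exact: scales_iint_lshear.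
by apply: scales_iint_ublock => //; exact: IH.
Qed.

Lemma iint_mulmx m (A : 'M[R]_m) (g : 'rV[R]_m -> \bar R) : A \in unitmx ->
  measurable_fun setT g -> (forall x, 0 <= g x) ->
  iint (fun x => g (x *m A)%R) = (`|(\det A)%R|^-1)%R%:E * iint g.
Proof. by move=> uA; exact: scales_iint_unitmx. Qed.

End LinearChange.

(** * Orthogonal reduction of matrices *)

Section EuclideanRows.
Context (R : realType).
Implicit Types (m : nat) (a : R).

Definition sqnorm m (x : 'rV[R]_m) : R := \sum_i x 0 i ^+ 2.

Lemma vnormE m (x : 'rV[R]_m) : vnorm x = Num.sqrt (sqnorm x).
Proof. by []. Qed.

Lemma sqnorm_ge0 m (x : 'rV[R]_m) : 0 <= sqnorm x.
Proof. by apply: sumr_ge0 => i _; exact: sqr_ge0. Qed.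

Lemma sqr_vnorm m (x : 'rV[R]_m) : vnorm x ^+ 2 = sqnorm x.
Proof. by rewrite vnormE sqr_sqrtr// sqnorm_ge0. Qed.

Lemma sqnorm_eq0 m (x : 'rV[R]_m) : (sqnorm x == 0) = (x == 0).
Proof.
rewrite psumr_eq0; last by move=> i _; exact: sqr_ge0.
apply/allP/eqP => [x0|->]; last by move=> i _; rewrite /= mxE expr0n eqxx.
apply/rowP => i; rewrite mxE.
by have := x0 i (mem_index_enum i); rewrite /= sqrf_eq0 => /eqP.
Qed.

Lemma sqnorm0 m : sqnorm (0 : 'rV[R]_m) = 0.
Proof. by apply/eqP; rewrite sqnorm_eq0. Qed.

Lemma sqnorm_rV0 (x : 'rV[R]_0) : sqnorm x = 0.
Proof. exact: big_ord0. Qed.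

Lemma sqnormZ m a (x : 'rV[R]_m) : sqnorm (a *: x) = a ^+ 2 * sqnorm x.
Proof.
by rewrite /sqnorm mulr_sumr; apply: eq_bigr => i _; rewrite mxE exprMn.
Qed.

Lemma sqnorm_rV1 (x : 'rV[R]_1) : sqnorm x = x 0 0 ^+ 2.
Proof. exact: big_ord1. Qed.

Lemma sqnorm_row_mx m l (u : 'rV[R]_m) (v : 'rV[R]_l) :
  sqnorm (row_mx u v) = sqnorm u + sqnorm v.
Proof.
rewrite /sqnorm big_split_ord /=; congr (_ + _); apply: eq_bigr => i _.
  by rewrite row_mxEl.
by rewrite row_mxEr.
Qed.

Lemma sqnorm_row_cons m a (v : 'rV[R]_m) :
  sqnorm (row_cons a v) = a ^+ 2 + sqnorm v.
Proof. by rewrite [LHS](@sqnorm_row_mx 1 m) sqnorm_rV1 mxE. Qed.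

Lemma vdotC m (x y : 'rV[R]_m) : vdot x y = vdot y x.
Proof. by apply: eq_bigr => i _; rewrite mulrC. Qed.

Lemma vdotE m (x y : 'rV[R]_m) : vdot x y = (x *m y^T) 0 0.
Proof. by rewrite mxE; apply: eq_bigr => i _; rewrite mxE. Qed.

Lemma sqnorm_vdot m (x : 'rV[R]_m) : sqnorm x = vdot x x.
Proof. by apply: eq_bigr => i _; rewrite expr2. Qed.

Lemma vdotZl m a (x y : 'rV[R]_m) : vdot (a *: x) y = a * vdot x y.
Proof. by rewrite !vdotE -scalemxAl mxE. Qed.

Lemma vdotZr m a (x y : 'rV[R]_m) : vdot x (a *: y) = a * vdot x y.
Proof. by rewrite vdotC vdotZl vdotC. Qed.

Lemma vdot0r m (x : 'rV[R]_m) : vdot x 0 = 0.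
Proof. by rewrite vdotE trmx0 mulmx0 mxE. Qed.

Lemma sqnormD m (x y : 'rV[R]_m) :
  sqnorm (x + y) = sqnorm x + 2 * vdot x y + sqnorm y.
Proof.
rewrite /sqnorm /vdot mulr_sumr -!big_split /=; apply: eq_bigr => i _.
by rewrite mxE; ring.
Qed.

Lemma sqnormB m (x y : 'rV[R]_m) :
  sqnorm (x - y) = sqnorm x - 2 * vdot x y + sqnorm y.
Proof. by rewrite sqnormD -scaleN1r vdotZr sqnormZ; ring. Qed.

Lemma cauchy_schwarz m (x y : 'rV[R]_m) : vdot x y ^+ 2 <= sqnorm x * sqnorm y.
Proof.
have [->|y0] := eqVneq y 0; first by rewrite vdot0r sqnorm0 mulr0 expr0n.
have sy : 0 < sqnorm y by rewrite lt_neqAle eq_sym sqnorm_eq0 y0 sqnorm_ge0.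
have := sqnorm_ge0 (x - (vdot x y / sqnorm y) *: y).
rewrite sqnormB vdotZr sqnormZ.
rewrite (_ : _ + _ = sqnorm x - vdot x y ^+ 2 / sqnorm y); last first.
  by field; rewrite gt_eqF.
by rewrite subr_ge0 ler_pdivrMr.
Qed.

Lemma norm_vdot_le m (x y : 'rV[R]_m) : `|vdot x y| <= vnorm x * vnorm y.
Proof.
rewrite -(@ler_pXn2r _ 2)// ?nnegrE ?mulr_ge0 ?sqrtr_ge0//.
by rewrite real_normK ?num_real// exprMn !sqr_vnorm cauchy_schwarz.
Qed.

Lemma vnorm_normalize m (x : 'rV[R]_m) : 0 < vnorm x ->
  vnorm ((vnorm x)^-1 *: x) = 1.
Proof.
move=> x0; rewrite [LHS]vnormE sqnormZ -sqr_vnorm -exprMn mulVf ?gt_eqF//.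
by rewrite expr1n sqrtr1.
Qed.

Lemma vdot_origin n (x : 'rV[R]_n.+1) : vdot x (origin R n) = x 0 ord_max.
Proof.
rewrite /vdot (bigD1 ord_max)//= big1 ?addr0; first by rewrite mxE eqxx mulr1.
by move=> i /negPf io; rewrite mxE io mulr0.
Qed.

Lemma sqnorm_origin n : sqnorm (origin R n) = 1.
Proof. by rewrite sqnorm_vdot vdot_origin mxE eqxx. Qed.

Lemma norm_height_le1 n (x : 'rV[R]_n.+1) : vnorm x = 1 -> `|x 0 ord_max| <= 1.
Proof.
move=> x1; rewrite -vdot_origin (le_trans (norm_vdot_le _ _))//.
by rewrite x1 vnormE sqnorm_origin sqrtr1 mulr1.
Qed.

End EuclideanRows.

Section OrthogonalMatrices.
Context (R : realType).
Implicit Types m : nat.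

Definition orthogonal_mx m (Q : 'M[R]_m) := Q *m Q^T = 1%:M.

Lemma orthogonal_mx_tr m (Q : 'M[R]_m) : orthogonal_mx Q -> orthogonal_mx Q^T.
Proof. by move=> /mulmx1C; rewrite /orthogonal_mx trmxK. Qed.

Lemma orthogonal_mx1 m : orthogonal_mx (1%:M : 'M[R]_m).
Proof. by rewrite /orthogonal_mx trmx1 mulmx1. Qed.

Lemma orthogonal_mxM m (P Q : 'M[R]_m) :
  orthogonal_mx P -> orthogonal_mx Q -> orthogonal_mx (P *m Q).
Proof.
move=> oP oQ; rewrite /orthogonal_mx trmx_mul mulmxA -(mulmxA P) oQ mulmx1.
exact: oP.
Qed.

Lemma orthogonal_mx_unit m (Q : 'M[R]_m) : orthogonal_mx Q -> Q \in unitmx.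
Proof. by case/mulmx1_unit. Qed.

Lemma norm_det_orthogonal m (Q : 'M[R]_m) : orthogonal_mx Q -> `|\det Q| = 1.
Proof.
move=> oQ; have dQ : \det Q ^+ 2 = 1 by rewrite expr2 -{2}det_tr -det_mulmx oQ det1.
by apply/eqP; rewrite -(@eqrXn2 _ 2)// expr1n real_normK ?num_real// dQ.
Qed.

Lemma orthogonal_mulmxtr m a b (Q : 'M[R]_m) (x : 'M[R]_(a, m)) (y : 'M[R]_(b, m)) :
  orthogonal_mx Q -> (x *m Q) *m (y *m Q)^T = x *m y^T.
Proof. by move=> oQ; rewrite trmx_mul mulmxA -(mulmxA x) oQ mulmx1. Qed.

Lemma vdot_orthogonal m (Q : 'M[R]_m) x y : orthogonal_mx Q ->
  vdot (x *m Q) (y *m Q) = vdot x y.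
Proof. by move=> oQ; rewrite !vdotE orthogonal_mulmxtr. Qed.

Lemma sqnorm_orthogonal m (Q : 'M[R]_m) x : orthogonal_mx Q ->
  sqnorm (x *m Q) = sqnorm x.
Proof. by move=> oQ; rewrite !sqnorm_vdot vdot_orthogonal. Qed.

Lemma isometry_orthogonal m (M : 'M[R]_m) :
  (forall v, sqnorm (v *m M) = sqnorm v) -> orthogonal_mx M.
Proof.
move=> iM; have vM x y : vdot (x *m M) (y *m M) = vdot x y.
  have := iM (x + y); rewrite mulmxDl !sqnormD !iM => eM.
  by apply: (@mulfI _ 2) => //; lra.
apply/matrixP => i j; have := vM (delta_mx 0 i) (delta_mx 0 j).
rewrite !vdotE trmx_mul mulmxA -(mulmxA _ M) trmx_delta.
rewrite -!rowE -colE [X in X = _ -> _]mxE [X in X = _ -> _]mxE => ->.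
by rewrite !mxE eqxx andbT.
Qed.

Lemma householder m (u w : 'rV[R]_m) : sqnorm u = sqnorm w ->
  exists2 Q : 'M[R]_m, orthogonal_mx Q & u *m Q = w.
Proof.
move=> uw; have [->|uNw] := eqVneq u w.
  by exists 1%:M; [exact: orthogonal_mx1|rewrite mulmx1].
pose d := u - w; pose s := sqnorm d.
have s0 : s != 0 by rewrite sqnorm_eq0 subr_eq0.
have mul_dd (x : 'rV[R]_m) : x *m d^T *m d = vdot x d *: d.
  by rewrite [x *m d^T]mx11_scalar -vdotE mul_scalar_mx.
exists (1%:M - (2 / s) *: (d^T *m d)).
  apply: isometry_orthogonal => v.
  rewrite mulmxBr mulmx1 -scalemxAr mulmxA mul_dd scalerA sqnormB vdotZr sqnormZ.
  by rewrite -/s; field.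
rewrite mulmxBr mulmx1 -scalemxAr mulmxA mul_dd scalerA.
have sE : s = 2 * vdot u d.
  have := sqnormB u d; rewrite subKr -uw -/s; lra.
have -> : 2 / s * vdot u d = 1 by rewrite mulrAC -sE divff.
by rewrite scale1r subKr.
Qed.

Lemma block_orthogonal m l (P : 'M[R]_m) (Q : 'M[R]_l) :
  orthogonal_mx P -> orthogonal_mx Q -> orthogonal_mx (block_mx P 0 0 Q).
Proof.
move=> oP oQ; rewrite /orthogonal_mx tr_block_mx mulmx_block !trmx0 !mulmx0 !mul0mx.
by rewrite oP oQ !addr0 add0r -scalar_mx_block.
Qed.

Lemma lq_decomposition m l (G : 'M[R]_(m, m + l)) :
  exists2 Q : 'M[R]_(m + l), orthogonal_mx Q &
  exists B : 'M[R]_m, G *m Q = row_mx B 0.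
Proof.
elim: m G => [|m IH] G.
  exists 1%:M; first exact: orthogonal_mx1.
  by exists 0; rewrite [LHS]flatmx0 [RHS]flatmx0.
pose G1 : 'M[R]_(1 + m, 1 + (m + l)) := G.
pose g := usubmx G1; pose c := vnorm g.
have [Q1 oQ1 gQ1] : exists2 Q : 'M[R]_(1 + (m + l)), orthogonal_mx Q &
    g *m Q = row_mx (c%:M : 'M[R]_1) 0.
  by apply: householder; rewrite sqnorm_row_mx sqnorm0 addr0 sqnorm_rV1 mxE sqr_vnorm.
pose D := dsubmx G1 *m Q1.
have [Q2 oQ2 [B' B'E]] := IH (rsubmx D).
pose Q2' : 'M[R]_(1 + (m + l)) := block_mx (1%:M : 'M[R]_1) 0 0 Q2.
exists (Q1 *m Q2' : 'M[R]_(1 + (m + l))).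
  by apply: orthogonal_mxM => //; apply: (@block_orthogonal 1) => //; exact: orthogonal_mx1.
exists (block_mx (c%:M : 'M[R]_1) 0 (lsubmx D) B').
transitivity (col_mx (row_mx (c%:M : 'M[R]_1) (0 : 'M[R]_(1, m + l)))
    (row_mx (lsubmx D) (row_mx B' 0))).
  transitivity (G1 *m (Q1 *m Q2')) => //.
  rewrite -[G1]vsubmxK mulmxA mul_col_mx -/g gQ1 -/D -[D]hsubmxK /Q2'.
  rewrite -[X in X *m _]/(block_mx _ _ _ _) mulmx_block.
  by rewrite !mulmx1 !mulmx0 !mul0mx !addr0 !add0r hsubmxK B'E.
rewrite -[0 in LHS](@row_mx0 _ 1 m l) !row_mxA.
rewrite (_ : esym (addnA 1 m l) = erefl) ?castmx_id//.
transitivity (block_mx (row_mx (c%:M : 'M[R]_1) (0 : 'M[R]_(1, m)))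
  (0 : 'M[R]_(1, l)) (row_mx (lsubmx D) B') (0 : 'M[R]_(m, l))).
  by rewrite block_mxEv.
by rewrite block_mxEh col_mx0 -block_mxEv.
Qed.

End OrthogonalMatrices.

Section RowSpaceProjection.
Context (R : realType).

Definition sqnorm_proj m l (G : 'M[R]_(m, l)) (u : 'rV[R]_l) : R :=
  (u *m G^T *m invmx (G *m G^T) *m G *m u^T) 0 0.

Lemma sqnorm_proj_orthogonal m l (G : 'M[R]_(m, l)) (Q : 'M[R]_l) u :
  orthogonal_mx Q -> sqnorm_proj G (u *m Q) = sqnorm_proj (G *m Q^T) u.
Proof.
move=> oQ; rewrite /sqnorm_proj orthogonal_mulmxtr; last exact: orthogonal_mx_tr.
by rewrite !trmx_mul !trmxK !mulmxA.
Qed.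

Lemma sqnorm_projZ m l (G : 'M[R]_(m, l)) a u :
  sqnorm_proj G (a *: u) = a ^+ 2 * sqnorm_proj G u.
Proof.
rewrite /sqnorm_proj linearZ /= -scalemxAr -!scalemxAl !mxE mulrA.
by congr (_ * _).
Qed.

Section LQ.
Context m l (G : 'M[R]_(m, m + l)) (Q : 'M[R]_(m + l)) (B : 'M[R]_m).
Hypotheses (oQ : orthogonal_mx Q) (GQ : G *m Q = row_mx B 0).

Lemma lq_gram : G *m G^T = B *m B^T.
Proof.
by rewrite -(orthogonal_mulmxtr _ _ oQ) GQ tr_row_mx mul_row_col trmx0 mulmx0 addr0.
Qed.

Lemma lq_rank : \rank G = \rank B.
Proof.
rewrite -(@mxrankMfree _ _ _ _ G Q) ?row_free_unit ?orthogonal_mx_unit// GQ.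
by rewrite -mxrank_tr tr_row_mx trmx0 -addsmxE addsmx0 mxrank_tr.
Qed.

Lemma lq_unitmx : (B \in unitmx) = (\rank G == m).
Proof. by rewrite lq_rank -row_free_unit. Qed.

Lemma lq_mulmx_tr (u : 'rV[R]_(m + l)) : u *m G^T = lsubmx (u *m Q) *m B^T.
Proof.
rewrite -(orthogonal_mulmxtr _ _ oQ) GQ tr_row_mx trmx0.
by rewrite -{1}[u *m Q]hsubmxK mul_row_col mulmx0 addr0.
Qed.

Lemma lq_sqnorm_proj (u : 'rV[R]_(m + l)) : B \in unitmx ->
  sqnorm_proj G u = sqnorm (lsubmx (u *m Q)).
Proof.
move=> uB; set w := lsubmx _.
have BB1 : B^T *m invmx (B *m B^T) *m B = 1%:M.
  by apply: mulmx1C; rewrite mulmxA mulmxV// unitmx_mul unitmx_tr uB.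
have GuE : G *m u^T = B *m w^T.
  by rewrite -[G *m _]trmxK trmx_mul trmxK lq_mulmx_tr trmx_mul trmxK.
rewrite /sqnorm_proj lq_gram lq_mulmx_tr -(mulmxA _ G) GuE.
rewrite mulmxA -2!(mulmxA w) BB1 mulmx1.
by rewrite sqnorm_vdot vdotE.
Qed.

Lemma lq_sqnorm (t : 'rV[R]_m) : sqnorm (t *m G) = sqnorm (t *m B).
Proof.
rewrite -(sqnorm_orthogonal _ oQ) -mulmxA GQ mul_mx_row mulmx0.
by rewrite sqnorm_row_mx sqnorm0 addr0.
Qed.

Lemma lq_vdot (t : 'rV[R]_m) (u : 'rV[R]_(m + l)) :
  vdot (t *m G) u = vdot (t *m B) (lsubmx (u *m Q)).
Proof.
by rewrite vdotC !vdotE trmx_mul mulmxA lq_mulmx_tr -mulmxA -trmx_mul -!vdotE vdotC.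
Qed.

End LQ.

Lemma rank_gram m l (G : 'M[R]_(m, m + l)) :
  (\rank G == m) = (\det (G *m G^T) != 0).
Proof.
have [Q oQ [B GQ]] := lq_decomposition G.
by rewrite -(lq_unitmx oQ GQ) (lq_gram oQ GQ) det_mulmx det_tr mulf_eq0 orbb unitmxE unitfE.
Qed.

End RowSpaceProjection.

Section OrthogonalInvariance.
Context (R : realType).

Lemma iint_orthogonal m (Q : 'M[R]_m) (g : 'rV[R]_m -> \bar R) :
  orthogonal_mx Q -> measurable_fun setT g -> (forall x, 0 <= g x)%E ->
  iint (fun x => g (x *m Q)) = iint g.
Proof.
move=> oQ mg g0; rewrite iint_mulmx ?orthogonal_mx_unit//.
by rewrite norm_det_orthogonal// invr1 mul1e.
Qed.

Context d (T : measurableType d).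

Lemma measurable_sqnorm m (x : T -> 'rV[R]_m) :
  measurable_fun setT x -> measurable_fun setT (fun t => sqnorm (x t)).
Proof.
by move=> /measurable_mxP mx; apply: measurable_sum => i; exact: measurable_funX.
Qed.

Lemma measurable_vnorm m (x : T -> 'rV[R]_m) :
  measurable_fun setT x -> measurable_fun setT (fun t => vnorm (x t)).
Proof.
by move=> mx; exact: (measurableT_comp (@measurable_sqrtr R) (measurable_sqnorm mx)).
Qed.

Lemma measurable_vdot m (x y : T -> 'rV[R]_m) :
  measurable_fun setT x -> measurable_fun setT y ->
  measurable_fun setT (fun t => vdot (x t) (y t)).
Proof.
move=> /measurable_mxP mx /measurable_mxP my.
by apply: measurable_sum => i; exact: measurable_funM.
Qed.

Lemma measurable_sqnorm_proj m l (G : T -> 'M[R]_(m, l)) (u : T -> 'rV[R]_l) :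
  measurable_fun setT G -> measurable_fun setT u ->
  measurable_fun setT (fun t => sqnorm_proj (G t) (u t)).
Proof.
move=> mG mu'; have mGt := measurable_trmx mG.
apply: (measurableT_comp (measurable_mx_coord 0 0)).
apply: measurable_mulmx; last exact: measurable_trmx.
apply: measurable_mulmx => //; apply: measurable_mulmx.
  exact: measurable_mulmx.
by apply: measurable_invmx; exact: measurable_mulmx.
Qed.

End OrthogonalInvariance.

(** * Polar coordinates in logarithmic variables *)

Section Softplus.
Context (R : realType).
Implicit Types (a s v x z : R).

Definition softplus x : R := ln (1 + expR x).

Lemma expR_softplus x : expR (softplus x) = 1 + expR x.
Proof. by rewrite lnK// posrE addr_gt0// expR_gt0. Qed.

Lemma softplus_gt0 x : 0 < softplus x.
Proof. by rewrite ln_gt0// ltrDl expR_gt0. Qed.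

Lemma softplus_gt x : x < softplus x.
Proof. by rewrite -ltr_expR expR_softplus ltrDr. Qed.

Lemma ler_softplus v z : v <= z -> softplus v <= softplus z.
Proof. by move=> vz; rewrite -ler_expR !expR_softplus lerD2l ler_expR. Qed.

Lemma softplusB_le v z : v <= z -> softplus z - softplus v <= z - v.
Proof.
move=> vz; rewrite lerBlDr -ler_expR expRD !expR_softplus mulrDr mulr1.
by rewrite -expRD subrK lerD2r -expR0 ler_expR subr_ge0.
Qed.

Lemma softplus_le0 z : z <= 0 -> softplus z <= ln 2.
Proof.
move=> z0; rewrite -ler_expR expR_softplus lnK ?posrE//.
by rewrite -[leRHS](_ : 1 + 1 = 2)// lerD2l expR_le1.
Qed.

Lemma softplus_ge0 z : 0 <= z -> softplus z <= z + ln 2.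
Proof.
move=> z0; rewrite -ler_expR expR_softplus expRD lnK ?posrE//.
by have : 1 <= expR z by [rewrite -expR0 ler_expR]; lra.
Qed.

Lemma measurable_softplus : measurable_fun setT softplus.
Proof. by rewrite /softplus; solve_measurable. Qed.

Definition softplus_weight a s x : R := expR (a * x - s * softplus x).

Lemma softplus_weight_ge0 a s x : 0 <= softplus_weight a s x.
Proof. exact: expR_ge0. Qed.

Lemma measurable_softplus_weight a s : measurable_fun setT (softplus_weight a s).
Proof.
by have ms := measurable_softplus; rewrite /softplus_weight; solve_measurable.
Qed.

Lemma expRD_softplus y z : expR y + expR z = expR (y + softplus (z - y)).
Proof. by rewrite expRD expR_softplus mulrDr mulr1 -expRD [y + _]addrC subrK. Qed.

End Softplus.

Section ExponentialIntegrals.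
Context (R : realType).
Local Open Scope ereal_scope.
Notation mu := (@lebesgue_measure R).
Implicit Types (a b c L : R) (h psi : R -> \bar R).

Let expR_EFin_ge0 (x : R) : 0 <= (expR x)%:E.
Proof. by rewrite lee_fin expR_ge0. Qed.

Lemma integral_expR_le c L : (0 < c)%R ->
  \int[mu]_x (if (x <= L)%R then expR (c * x) else 0%R)%:E = (expR (c * L) / c)%:E.
Proof.
move=> c0; pose chi (u : R) : \bar R := if (u <= expR (c * L))%R then 1 else 0.
have mchi : measurable_fun setT chi by rewrite /chi; solve_measurable.
have chi0 u : 0 <= chi u by rewrite /chi; case: ifP.
pose g (y : R) := (expR y)%:E * chi (expR y).
transitivity (\int[mu]_x g (c * x)%R).
  apply: eq_integral => x _; rewrite /g /chi ler_expR ler_pM2l//.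
  by case: ifP; rewrite ?mule1 ?mule0.
rewrite ge0_integral_dilate ?gt_eqF//; last 2 first.
- by rewrite /g; solve_measurable.
- by move=> y; rewrite mule_ge0.
rewrite gtr0_norm// mulrC EFinM ge0_integral_exp//; congr (_ * _).
transitivity (\int[mu]_(x in `]0%R, expR (c * L)]) (cst 1) x).
  rewrite integral_patch_itv; apply: eq_integral => x _.
  by rewrite in_itv /= /chi; case: (0 < x)%R.
by rewrite integral_cst//= lebesgue_measure_itv/= lte_fin expR_gt0 mul1e sube0.
Qed.

Lemma integral_expR_ge c L : (0 < c)%R ->
  \int[mu]_x (if (L <= x)%R then expR (- c * x) else 0%R)%:E =
  (expR (- c * L) / c)%:E.
Proof.
move=> c0; have := @integral_expR_le c (- L) c0; rewrite mulrN -mulNr => <-.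
pose g (x : R) := (if (x <= - L)%R then expR (c * x) else 0%R)%:E.
rewrite -[RHS](ge0_integral_opp (f := g)).
- by apply: eq_integral => x _; rewrite /g lerN2 mulrN mulNr.
- by rewrite /g; solve_measurable.
- by move=> x; rewrite /g; case: ifP.
Qed.

Lemma integral_square h : measurable_fun setT h -> (forall x, 0 <= h x) ->
  \int[mu]_t h (t ^+ 2)%R = \int[mu]_y ((expR (2^-1 * y))%:E * h (expR y)).
Proof.
move=> mh h0; pose g (t : R) := if (0 < t)%R then h (t ^+ 2)%R else 0.
have mg : measurable_fun setT g by rewrite /g; solve_measurable.
have g0 t : 0 <= g t by rewrite /g; case: ifP.
pose k (y : R) := (expR (2^-1 * y))%:E * h (expR y).
have half : \int[mu]_t g t = (2^-1)%:E * \int[mu]_y k y.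
  rewrite -(ge0_integral_exp (g := fun t => h (t ^+ 2)%R))//; last first.
    by solve_measurable.
  have mk : measurable_fun setT k by rewrite /k; solve_measurable.
  have k0 y : 0 <= k y by rewrite mule_ge0.
  have two0 : (2 != 0 :> R)%R by rewrite pnatr_eq0.
  transitivity (\int[mu]_y k (2 * y)%R); last first.
    by rewrite (ge0_integral_dilate mk k0 two0) ger0_norm.
  apply: eq_integral => y _; rewrite /k mulrA mulVf// mul1r.
  by rewrite -expRM_natl mulr_natl.
transitivity (\int[mu]_t (g t + g (- t)%R)); last first.
  rewrite ge0_integralD//; last first.
    by apply: (measurableT_comp mg); exact: oppr_measurable.
  rewrite ge0_integral_opp// half -ge0_muleDl ?lee_fin//.
  by rewrite -EFinD (_ : 2^-1 + 2^-1 = 1)%R ?mul1e//; field.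
apply: ge0_ae_eq_integral => //.
- by solve_measurable.
- apply: emeasurable_funD => //; apply: (measurableT_comp mg).
  exact: oppr_measurable.
- by move=> t _; rewrite adde_ge0.
exists [set 0%R]; split; [exact: measurable_set1|exact: lebesgue_measure_set1|].
move=> t /= hgN; apply: contrapT => /eqP t0; apply: hgN => _.
by rewrite /g oppr_gt0 sqrrN; case: ltgtP t0 => //= t0 _; rewrite ?adde0 ?add0e.
Qed.

(* Substitute [z = x + y] and use [e^y + e^(x + y) = e^(y + softplus x)]. *)
Lemma integral_sum_ratio a b h psi :
  measurable_fun setT h -> (forall x, 0 <= h x) ->
  measurable_fun setT psi -> (forall x, 0 <= psi x) ->
  \int[mu]_y \int[mu]_z ((expR (a * y + b * z))%:E *
      (h (expR y + expR z)%R * psi (z - y)%R)) =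
  (\int[mu]_x ((softplus_weight b (a + b) x)%:E * psi x)) *
  (\int[mu]_y ((expR ((a + b) * y))%:E * h (expR y))).
Proof.
move=> mh h0 mpsi psi0; have msp := @measurable_softplus R.
pose k y := (expR ((a + b) * y))%:E * h (expR y).
have mk : measurable_fun setT k by rewrite /k; solve_measurable.
have k0 y : 0 <= k y by rewrite mule_ge0.
have wpsi0 x : 0 <= (softplus_weight b (a + b) x)%:E * psi x.
  by rewrite mule_ge0// lee_fin softplus_weight_ge0.
pose f y x := (softplus_weight b (a + b) x)%:E * psi x * k (y + softplus x)%R.
transitivity (\int[mu]_y \int[mu]_x f y x).
  apply: eq_integral => y _; rewrite -[LHS](ge0_integral_shift y); first last.
  - by move=> z; rewrite !mule_ge0.
  - by solve_measurable.
  apply: eq_integral => x _; rewrite /f /k expRD_softplus addrK.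
  rewrite -muleA (muleCA (psi x)) [h _ * _]muleC !muleA; congr (_ * _ * _).
  by rewrite -EFinM -expRD; congr ((expR _)%:E); ring.
have mwpsi : measurable_fun setT (fun x => (softplus_weight b (a + b) x)%:E * psi x).
  by have mw := measurable_softplus_weight b (a + b); solve_measurable.
rewrite fubini_tonelli_curry//; first last.
- by move=> y x; rewrite mule_ge0.
- rewrite /f; apply: emeasurable_funM; first exact: (measurableT_comp mwpsi).
  by apply: (measurableT_comp mk); solve_measurable.
rewrite -ge0_integralZr//; last by apply: integral_ge0 => y _; exact: k0.
apply: eq_integral => x _.
rewrite -(ge0_integral_shift (softplus x) mk k0) -ge0_integralZl//.
- by apply: (measurableT_comp mk); solve_measurable.
Qed.

Lemma integral_softplus_weight a b : (0 < a)%R -> (0 < b)%R ->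
  exists2 B : R, (0 < B)%R &
    \int[mu]_x (softplus_weight b (a + b) x)%:E = B%:E.
Proof.
move=> a0 b0; set I := \int[mu]_x _.
have Ilty : I < +oo.
  apply: (@le_lt_trans _ _ ((expR (b * 1) / b)%:E + (expR (- a * 0) / a)%:E)).
    rewrite -(@integral_expR_le b 1)// -(@integral_expR_ge a 0)//.
    rewrite -ge0_integralD//; last 4 first.
    - by move=> x _; case: ifP.
    - by solve_measurable.
    - by move=> x _; case: ifP.
    - by solve_measurable.
    apply: ge0_le_integralT => x; first by rewrite lee_fin softplus_weight_ge0.
    have s0 := softplus_gt0 x; have sx := softplus_gt x; rewrite -EFinD lee_fin.
    have [x1|x1] := leP x 1%R.
      rewrite -[leLHS]addr0 lerD//; last by case: ifP => // _; exact: expR_ge0.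
      by rewrite ler_expR lerBlDr lerDl mulr_ge0// ltW// addr_gt0.
    by rewrite ifT ?add0r ?ler_expR; nra.
  by rewrite -EFinD ltry.
have Igt : 0 < I.
  apply: (@lt_le_trans _ _ (expR (- (a + b) * softplus 1))%:E).
    by rewrite lte_fin expR_gt0.
  rewrite -[leLHS]mule1 -[X in _ * X](_ : mu `[0%R, 1%R] = 1); last first.
    by rewrite lebesgue_measure_itv/= lte_fin ltr01 oppr0 adde0.
  rewrite -integral_cst// integral_patch_itv.
  apply: ge0_le_integralT => x; case: ifPn => //.
  - by rewrite lee_fin expR_ge0.
  - rewrite in_itv/= => /andP[x0 x1]; rewrite lee_fin ler_expR.
    by have := ler_softplus x1; nra.
  - by rewrite lee_fin softplus_weight_ge0.
exists (fine I); first by rewrite fine_gt0// Igt.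
by rewrite fineK// ge0_fin_numE// ltW.
Qed.

End ExponentialIntegrals.

Section Polar.
Context (R : realType).
Local Open Scope ereal_scope.
Notation mu := (@lebesgue_measure R).

Let expR_EFin_ge0 (x : R) : 0 <= (expR x)%:E.
Proof. by rewrite lee_fin expR_ge0. Qed.

Definition polar_constant m (C : R) := forall h : R -> \bar R,
  measurable_fun setT h -> (forall x, 0 <= h x) ->
  iint (fun x : 'rV[R]_m => h (sqnorm x)) =
  C%:E * \int[mu]_y ((expR (m%:R / 2 * y))%:E * h (expR y)).

Section Biradial.
Variables (a b : nat) (A B : R).
Hypotheses (polarA : polar_constant a A) (B0 : (0 <= B)%R) (polarB : polar_constant b B).

Lemma iint_biradial (Phi : R -> R -> \bar R) :
  measurable_fun setT (fun z : R * R => Phi z.1 z.2) ->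
  (forall x y, 0 <= Phi x y) ->
  iint (fun u : 'rV[R]_a => iint (fun v : 'rV[R]_b => Phi (sqnorm u) (sqnorm v))) =
  (A * B)%:E * \int[mu]_y \int[mu]_z
    ((expR (a%:R / 2 * y + b%:R / 2 * z))%:E * Phi (expR y) (expR z)).
Proof.
move=> mPhi Phi0.
pose G q := B%:E * \int[mu]_z ((expR (b%:R / 2 * z))%:E * Phi q (expR z)).
have mPhi2 d (T : measurableType d) (f g : T -> R) : measurable_fun setT f ->
    measurable_fun setT g -> measurable_fun setT (fun t => Phi (f t) (g t)).
  exact: measurableT_comp2.
have mG : measurable_fun setT G.
  apply: emeasurable_funM; first exact: measurable_cst.
  apply: measurable_fun_integral_curry; last by move=> *; rewrite mule_ge0.
  apply: emeasurable_funM; first by solve_measurable.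
  by apply: mPhi2; solve_measurable.
have G0 q : 0 <= G q.
  apply: mule_ge0; first by rewrite lee_fin.
  by apply: integral_ge0 => z _; rewrite mule_ge0.
transitivity (iint (fun u : 'rV[R]_a => G (sqnorm u))).
  congr iint; apply/funext => u; apply: polarB => //.
  by apply: mPhi2; solve_measurable.
rewrite polarA// EFinM -muleA; congr (_ * _).
pose H y z := (expR (a%:R / 2 * y + b%:R / 2 * z))%:E * Phi (expR y) (expR z).
have H0 y z : 0 <= H y z by rewrite mule_ge0.
have mH : measurable_fun setT (fun w : R * R => H w.1 w.2).
  apply: emeasurable_funM; first by solve_measurable.
  by apply: mPhi2; solve_measurable.
transitivity (\int[mu]_y (B%:E * \int[mu]_z H y z)).
  apply: eq_integral => y _; rewrite /G muleCA; congr (_ * _).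
  rewrite -ge0_integralZl_EFin//; last 2 first.
  - by move=> z _; rewrite mule_ge0.
  - apply: emeasurable_funM; first by solve_measurable.
    by apply: mPhi2; solve_measurable.
  by apply: eq_integral => z _; rewrite /H muleA -EFinM -expRD.
rewrite ge0_integralZl_EFin//; first by move=> y _; exact: integral_ge0.
exact: measurable_fun_integral_curry.
Qed.

Lemma iint_polar (Phi : R -> R -> \bar R) (h psi : R -> \bar R) :
  measurable_fun setT (fun z : R * R => Phi z.1 z.2) ->
  (forall x y, 0 <= Phi x y) ->
  measurable_fun setT h -> (forall x, 0 <= h x) ->
  measurable_fun setT psi -> (forall x, 0 <= psi x) ->
  (forall y z, Phi (expR y) (expR z) = h (expR y + expR z)%R * psi (z - y)%R) ->
  iint (fun u : 'rV[R]_a => iint (fun v : 'rV[R]_b => Phi (sqnorm u) (sqnorm v))) =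
  (A * B)%:E *
    ((\int[mu]_x ((softplus_weight (b%:R / 2) ((a + b)%:R / 2) x)%:E * psi x)) *
     (\int[mu]_y ((expR ((a + b)%:R / 2 * y))%:E * h (expR y)))).
Proof.
move=> mPhi Phi0 mh h0 mpsi psi0 PhiE; rewrite iint_biradial//; congr (_ * _).
rewrite natrD mulrDl -(integral_sum_ratio _ _ mh h0 mpsi psi0).
by apply: eq_integral => y _; apply: eq_integral => z _; rewrite PhiE.
Qed.

End Biradial.

Lemma polar_constant1 : polar_constant 1 1.
Proof.
move=> h mh h0; rewrite mul1e div1r -integral_square// iintS.
by apply: eq_integral => t _; rewrite /= sqnorm_row_cons sqnorm_rV0 addr0.
Qed.

Lemma polar_constantD a b (A B : R) : (0 < A)%R -> polar_constant a.+1 A ->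
  (0 < B)%R -> polar_constant b.+1 B ->
  exists2 C : R, (0 < C)%R & polar_constant (a.+1 + b.+1) C.
Proof.
move=> A0 polarA B0 polarB.
have [I I0 IE] := @integral_softplus_weight R (a.+1%:R / 2) (b.+1%:R / 2)%R
  (divr_gt0 (ltr0Sn _ _) (ltr0Sn _ _)) (divr_gt0 (ltr0Sn _ _) (ltr0Sn _ _)).
exists (A * B * I)%R; first by rewrite !mulr_gt0.
move=> h mh h0; rewrite iint_row_mx.
transitivity (iint (fun u : 'rV[R]_a.+1 => iint (fun v : 'rV[R]_b.+1 =>
    h (sqnorm u + sqnorm v)%R))).
  congr iint; apply/funext => u; congr iint; apply/funext => v.
  by rewrite sqnorm_row_mx.
rewrite (iint_polar polarA (ltW B0) polarB (Phi := fun s t => h (s + t)%R)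
  (psi := cst 1) _ _ mh h0)//; last 2 first.
- by solve_measurable.
- by move=> y z; rewrite mule1.
under eq_integral do rewrite mule1.
by rewrite natrD mulrDl IE muleA -EFinM -mulrDl -natrD.
Qed.

Lemma exists_polar_constant m : exists2 C : R, (0 < C)%R & polar_constant m.+1 C.
Proof.
elim: m => [|m [C C0 polarC]]; first by exists 1%R => //; exact: polar_constant1.
exact: polar_constantD ltr01 polar_constant1 C0 polarC.
Qed.

End Polar.

(** * Zonal integrals on spheres *)

Section LogAngle.
Context (R : realType).
Notation mu := (@lebesgue_measure R).
Implicit Types (c v x y z : R).

Lemma sqrt_expR x : Num.sqrt (expR x) = expR (x / 2).
Proof.
have -> : expR x = expR (x / 2) ^+ 2 by rewrite -expRM_natl; congr expR; field.
by rewrite sqrtr_sqr ger0_norm ?expR_ge0.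
Qed.

(* The cosine of the angle [d] for which [z = ln (tan d ^+ 2)]. *)
Definition cos_log z : R := expR (- (softplus z / 2)).

Lemma cos_log_gt0 z : 0 < cos_log z. Proof. exact: expR_gt0. Qed.

Lemma cos_log_le1 z : cos_log z <= 1.
Proof. by rewrite /cos_log expR_le1 oppr_le0 divr_ge0// ltW// softplus_gt0. Qed.

Lemma measurable_cos_log : measurable_fun setT cos_log.
Proof. by have ms := @measurable_softplus R; rewrite /cos_log; solve_measurable. Qed.

Lemma sqr_cos_log z : cos_log z ^+ 2 = expR (- softplus z).
Proof. by rewrite /cos_log -expRM_natl; congr expR; field. Qed.

Lemma sqrt_expRN_softplus z : Num.sqrt (expR (- softplus z)) = cos_log z.
Proof. by rewrite sqrt_expR /cos_log mulNr. Qed.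

Lemma sin_cos_log z : Num.sqrt (1 - cos_log z ^+ 2) = expR ((z - softplus z) / 2).
Proof.
rewrite sqr_cos_log -sqrt_expR; congr Num.sqrt.
by rewrite expRB expRN expR_softplus; field; rewrite gt_eqF// addr_gt0// expR_gt0.
Qed.

Lemma cos_logM v x :
  cos_log v * cos_log x = cos_log (ln (expR v + expR x * (1 + expR v))).
Proof.
have pos : 0 < expR v + expR x * (1 + expR v).
  by rewrite addr_gt0 ?mulr_gt0 ?addr_gt0 ?expR_gt0.
rewrite /cos_log -expRD /softplus lnK ?posrE//.
have -> : 1 + (expR v + expR x * (1 + expR v)) = (1 + expR v) * (1 + expR x) by ring.
by rewrite lnM ?posrE ?addr_gt0 ?expR_gt0//; congr expR; field.
Qed.

Lemma integral_expR_unit c : 0 < c ->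
  (\int[mu]_y ((expR (c * y))%:E * (if (expR y <= 1)%R then 1 else 0)) = (c^-1)%:E)%E.
Proof.
move=> c0; rewrite -[c^-1]div1r -[1 in RHS]expR0 -(mulr0 c) -integral_expR_le//.
apply: eq_integral => y _; rewrite expR_le1.
by case: ifP; rewrite ?mule1 ?mule0.
Qed.

End LogAngle.

Section ConeExtension.
Context (R : realType).
Implicit Types m : nat.

Definition cone_extension m (g : 'rV[R]_m -> \bar R) (x : 'rV[R]_m) : \bar R :=
  if (0 < vnorm x) && (vnorm x <= 1) then g ((vnorm x)^-1 *: x) else 0%E.

Lemma sph_intE m (g : 'rV[R]_m.+1 -> \bar R) :
  sph_int g = (m.+1%:R%:E * iint (cone_extension g))%E.
Proof. by []. Qed.

Lemma xi_intE k n (G : 'M[R]_(k.+1, n.+1)) (h : 'rV[R]_n.+1 -> \bar R) :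
  xi_int G h = ((Num.sqrt (\det (G *m G^T)))%:E *
    (k.+1%:R%:E * iint (fun t => cone_extension h (t *m G))))%E.
Proof. by []. Qed.

Lemma eq_cone_extension m (g h : 'rV[R]_m -> \bar R) :
  (forall x, vnorm x = 1 -> g x = h x) -> cone_extension g =1 cone_extension h.
Proof.
move=> gh x; rewrite /cone_extension; case: ifP => // /andP[x0 _].
by rewrite gh// vnorm_normalize.
Qed.

Lemma eq_sph_int m (g h : 'rV[R]_m.+1 -> \bar R) :
  (forall x, vnorm x = 1 -> g x = h x) -> sph_int g = sph_int h.
Proof. by move=> gh; rewrite !sph_intE (funext (eq_cone_extension gh)). Qed.

Lemma eq_xi_int k n (G : 'M[R]_(k.+1, n.+1)) (g h : 'rV[R]_n.+1 -> \bar R) :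
  (forall x, vnorm x = 1 -> g x = h x) -> xi_int G g = xi_int G h.
Proof. by move=> gh; rewrite !xi_intE (funext (eq_cone_extension gh)). Qed.

Lemma cone_extension_ge0 m (g : 'rV[R]_m -> \bar R) x :
  (forall x, 0 <= g x)%E -> (0 <= cone_extension g x)%E.
Proof. by rewrite /cone_extension; case: ifP. Qed.

Lemma measurable_cone_extension m (g : 'rV[R]_m -> \bar R) :
  measurable_fun setT g -> measurable_fun setT (cone_extension g).
Proof.
move=> mg; have mn := measurable_vnorm (@measurable_id _ 'rV[R]_m setT).
apply: measurable_fun_ifT; [by solve_measurable| |by solve_measurable].
by apply: (measurableT_comp mg); apply: measurable_scalemx; solve_measurable.
Qed.

Lemma sph_int_orthogonal m (Q : 'M[R]_m.+1) (g : 'rV[R]_m.+1 -> \bar R) :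
  orthogonal_mx Q -> measurable_fun setT g -> (forall x, 0 <= g x)%E ->
  sph_int (fun x => g (x *m Q)) = sph_int g.
Proof.
move=> oQ mg g0; rewrite !sph_intE; congr (_ * _)%E.
rewrite -[RHS](iint_orthogonal oQ)//; last 2 first.
- exact: measurable_cone_extension.
- by move=> x; exact: cone_extension_ge0.
congr iint; apply/funext => x.
by rewrite /cone_extension !vnormE sqnorm_orthogonal// scalemxAl.
Qed.

Lemma sph_int_first_coordinate m : exists2 C : R, 0 < C &
  forall phi : R -> \bar R, measurable_fun setT phi -> (forall t, 0 <= phi t)%E ->
  sph_int (fun x : 'rV[R]_m.+2 => phi `|x 0 0|) =
  (C%:E * \int[lebesgue_measure]_x
    ((softplus_weight (m.+1%:R / 2) (m.+2%:R / 2) x)%:E * phi (cos_log x)))%E.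
Proof.
have [A A0 polarA] := exists_polar_constant R m.
have half0 : 0 < (m.+2%:R / 2 : R) by rewrite divr_gt0.
exists (m.+2%:R * (A * (m.+2%:R / 2)^-1)); first by rewrite !mulr_gt0// invr_gt0.
move=> phi mphi phi0; have mc := @measurable_cos_log R.
pose Phi s t : \bar R := if (0 < Num.sqrt (s + t)) && (Num.sqrt (s + t) <= 1)
  then phi (Num.sqrt s / Num.sqrt (s + t)) else 0%E.
pose ball (q : R) : \bar R := if q <= 1 then 1%E else 0%E.
transitivity (m.+2%:R%:E * iint (fun u : 'rV[R]_1 => iint (fun v : 'rV[R]_m.+1 =>
    Phi (sqnorm u) (sqnorm v))))%E.
  rewrite sph_intE (@iint_row_mx R 1 m.+1); congr (_ * iint _)%E.
  apply/funext => u; congr iint; apply/funext => v.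
  rewrite /cone_extension !vnormE [sqnorm (row_mx u v)](@sqnorm_row_mx R 1 m.+1) /Phi.
  case: ifP => // /andP[p0 _]; congr phi.
  rewrite mxE normrM gtr0_norm ?invr_gt0// mulrC sqnorm_rV1 sqrtr_sqr.
  congr (`|_| / _); rewrite -(row_mxEl u v 0 0); congr (row_mx u v _ _).
  exact/val_inj.
rewrite (iint_polar (@polar_constant1 R) (ltW A0) polarA (h := ball)
  (psi := fun x => phi (cos_log x)))//; first last.
- move=> y z; rewrite /Phi /ball expRD_softplus !sqrt_expR expR_gt0 /=.
  rewrite !expR_le1 pmulr_lle0 ?invr_gt0//; case: ifP => _; last by rewrite mul0e.
  by rewrite mul1e /cos_log -expRB; congr (phi (expR _)); field.
- by solve_measurable.
- by move=> q; rewrite /ball; case: ifP.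
- by rewrite /ball; solve_measurable.
- by move=> s t; rewrite /Phi; case: ifP.
- by rewrite /Phi; solve_measurable.
rewrite add1n mul1r (integral_expR_unit half0) EFinM -muleA; congr (_ * _)%E.
by rewrite [X in (_ * X)%E]muleC muleA -EFinM.
Qed.

Lemma sph_int_zonal m : exists2 C : R, 0 < C &
  forall (w : 'rV[R]_m.+2) (phi : R -> \bar R),
  measurable_fun setT phi -> (forall t, 0 <= phi t)%E ->
  sph_int (fun x => phi `|vdot x w|) =
  (C%:E * \int[lebesgue_measure]_x
    ((softplus_weight (m.+1%:R / 2) (m.+2%:R / 2) x)%:E *
     phi (vnorm w * cos_log x)%R))%E.
Proof.
have [C C0 HC] := sph_int_first_coordinate m; exists C => // w phi mphi phi0.
pose axis : 'rV[R]_(1 + m.+1) := row_mx (vnorm w)%:M 0.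
have [Q oQ wQ] : exists2 Q : 'M[R]_m.+2, orthogonal_mx Q & axis *m Q = w.
  apply: householder; rewrite [LHS](@sqnorm_row_mx R 1 m.+1) sqnorm0 addr0.
  by rewrite sqnorm_rV1 mxE sqr_vnorm.
have mvdot : measurable_fun setT (fun x : 'rV[R]_m.+2 => vdot x w).
  exact: measurable_vdot.
rewrite -(sph_int_orthogonal oQ)//; last by solve_measurable.
apply: etrans (HC (fun t => phi (vnorm w * t)) _ _); [|by solve_measurable|by []].
congr sph_int; apply/funext => x; congr phi.
rewrite -[in vdot _ _]wQ vdot_orthogonal// vdotC /vdot (@big_split_ord _ _ _ 1 m.+1).
rewrite /= big_ord1 big1 => [|i _]; last first.
  by rewrite [axis 0 _](row_mxEr _ _ 0 i) mxE mul0r.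
rewrite addr0 [axis 0 _](row_mxEl _ _ 0 0) mxE normrM ger0_norm ?sqrtr_ge0//.
by congr (_ * `|x _ _|); exact/val_inj.
Qed.

Section LQ.
Context k l (G : 'M[R]_(k.+1, k.+1 + l)) (Q : 'M[R]_(k.+1 + l)) (B : 'M[R]_k.+1).
Hypotheses (oQ : orthogonal_mx Q) (GQ : G *m Q = row_mx B 0) (uB : B \in unitmx).

Let lq_vnorm t : vnorm (t *m G) = vnorm (t *m B).
Proof. by rewrite !vnormE (lq_sqnorm oQ GQ). Qed.

(* [y |-> y *m B^-1 *m G] is an isometry from the unit sphere of [R^(k+1)] onto
   [gsphere G]. *)
Lemma xi_int_lq (h : 'rV[R]_(k.+1 + l) -> \bar R) :
  measurable_fun setT h -> (forall x, 0 <= h x)%E ->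
  xi_int (n := k + l) G h = sph_int (fun y => h (y *m invmx B *m G)).
Proof.
move=> mh h0; pose g (y : 'rV[R]_k.+1) := h (y *m invmx B *m G).
have mg : measurable_fun setT g.
  apply: (measurableT_comp mh); apply: measurable_mulmx => //.
  exact: measurable_mulmx.
have dB : \det B != 0 by move: uB; rewrite unitmxE unitfE.
rewrite xi_intE (lq_gram oQ GQ) det_mulmx det_tr -expr2 sqrtr_sqr sph_intE.
rewrite (_ : (fun t => _) = fun t => cone_extension g (t *m B)); last first.
  apply/funext => t; rewrite /cone_extension lq_vnorm /g.
  by rewrite -!scalemxAl -(mulmxA _ B) mulmxV// mulmx1.
rewrite iint_mulmx//; last 2 first.
- exact: measurable_cone_extension.
- by move=> y; apply: cone_extension_ge0 => x; exact: h0.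
rewrite muleCA; congr (_ * _)%E.
by rewrite muleA -EFinM divff ?normr_eq0// mul1e.
Qed.

Lemma gsphere_lq x : gsphere (n := k + l) G x <->
  exists2 y, vnorm y = 1 & x = y *m invmx B *m G.
Proof.
split=> [[x1 [t xE]]|[y y1 ->]]; last first.
  by split; [rewrite lq_vnorm -mulmxA mulVmx// mulmx1|exists (y *m invmx B)].
exists (t *m B); first by rewrite -lq_vnorm -xE.
by rewrite -(mulmxA t) mulmxV// mulmx1.
Qed.

Lemma vdot_lq y (u : 'rV[R]_(k.+1 + l)) :
  vdot (y *m invmx B *m G) u = vdot y (lsubmx (u *m Q)).
Proof. by rewrite (lq_vdot oQ GQ) -mulmxA mulVmx// mulmx1. Qed.

End LQ.

Lemma xi_int_zonal k : exists2 C : R, 0 < C &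
  forall l (G : 'M[R]_(k.+2, k.+2 + l)) (phi : R -> \bar R), \rank G = k.+2 ->
  measurable_fun setT phi -> (forall t, 0 <= phi t)%E ->
  xi_int (n := k.+1 + l) G (fun x => phi `|x 0 ord_max|) =
  (C%:E * \int[lebesgue_measure]_x
    ((softplus_weight (k.+1%:R / 2) (k.+2%:R / 2) x)%:E *
     phi (Num.sqrt (sqnorm_proj G (origin R (k.+1 + l))) * cos_log x)%R))%E.
Proof.
have [C C0 HC] := sph_int_zonal k; exists C => // l G phi rG mphi phi0.
have [Q oQ [B GQ]] := lq_decomposition G.
have uB : B \in unitmx by rewrite (lq_unitmx oQ GQ) rG.
rewrite (xi_int_lq oQ GQ uB)//; last first.
  have mheight := @measurable_mx_coord _ R 1 (k.+2 + l) 0 ord_max.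
  by solve_measurable.
rewrite (lq_sqnorm_proj oQ GQ _ uB) -vnormE; apply: etrans (HC _ phi mphi phi0).
by congr sph_int; apply/funext => y; rewrite -vdot_origin (vdot_lq oQ GQ uB).
Qed.

End ConeExtension.

Section DistanceToOrigin.
Context (R : realType).

Lemma ler_acos : {in `[-1, 1] &, {mono (@acos R) : x y /~ x <= y}}.
Proof.
move=> x y x1 y1; rewrite leNgt [RHS]leNgt; congr (~~ _).
have acos_itv z : z \in `[-1, 1] -> acos z \in `[0, pi].
  by rewrite !in_itv /= => z1; rewrite acos_ge0 ?acos_lepi.
by rewrite -ltr_cos ?acos_itv// !acosK.
Qed.

Lemma sqrt_itv (y : R) : y <= 1 -> Num.sqrt y \in `[-1, 1].
Proof.
move=> y1; rewrite in_itv /= (le_trans (lerN10 R)) ?sqrtr_ge0//=.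
by rewrite -[leRHS](@sqrtr1 R) ler_sqrt.
Qed.

Lemma vdot_unit_max k (w : 'rV[R]_k.+1) :
  exists2 y, vnorm y = 1 & vdot y w = vnorm w.
Proof.
have [w0|wN0] := eqVneq (sqnorm w) 0.
  exists (delta_mx 0 0).
    rewrite vnormE sqnorm_vdot vdotE trmx_delta mul_delta_mx mxE !eqxx sqrtr1 //.
  by move/eqP: w0; rewrite sqnorm_eq0 => /eqP ->; rewrite vdot0r vnormE sqnorm0 sqrtr0.
have w0 : 0 < vnorm w by rewrite sqrtr_gt0 lt_neqAle eq_sym wN0 sqnorm_ge0.
exists ((vnorm w)^-1 *: w); first exact: vnorm_normalize.
by rewrite vdotZl -sqnorm_vdot -sqr_vnorm expr2 mulKf// gt_eqF.
Qed.

Lemma dist0E k l (G : 'M[R]_(k.+1, k.+1 + l)) : \rank G = k.+1 ->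
  0 <= sqnorm_proj G (origin R (k + l)) <= 1 /\
  dist0 (n := k + l) G = acos (Num.sqrt (sqnorm_proj G (origin R (k + l)))).
Proof.
move=> rG; have [Q oQ [B GQ]] := lq_decomposition G.
have uB : B \in unitmx by rewrite (lq_unitmx oQ GQ) rG.
set e := origin R _; set w := lsubmx (e *m Q).
rewrite (lq_sqnorm_proj oQ GQ e uB) -/w -vnormE.
have w1 : sqnorm w <= 1.
  have := sqnorm_origin R (k + l); rewrite -/e -(sqnorm_orthogonal e oQ).
  rewrite -[e *m Q]hsubmxK [X in X = _ -> _](@sqnorm_row_mx R k.+1 l) -/w => <-.
  by rewrite lerDl sqnorm_ge0.
split; first by rewrite sqnorm_ge0.
have dot_e y : vdot e (y *m invmx B *m G) = vdot y w by rewrite vdotC (vdot_lq oQ GQ uB).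
have lower x : gsphere (n := k + l) G x -> acos (vnorm w) <= sphdist e x.
  move=> /(gsphere_lq oQ GQ uB)[y y1 ->]; rewrite /sphdist dot_e.
  have := norm_vdot_le y w; rewrite y1 mul1r => yw.
  rewrite ler_acos ?sqrt_itv//; first exact: le_trans (ler_norm _) yw.
  by have /itvP w1' := sqrt_itv w1; rewrite in_itv /= -ler_norml (le_trans yw) ?w1'.
have [y y1 yw] := vdot_unit_max w.
have yG : gsphere (n := k + l) G (y *m invmx B *m G).
  by apply/(gsphere_lq oQ GQ uB); exists y.
apply/eqP; rewrite eq_le; apply/andP; split.
  rewrite -yw -dot_e; apply: ge_inf; last by exists (y *m invmx B *m G).
  by exists (acos (vnorm w)) => _ [x xG <-]; exact: lower.
apply: lb_le_inf; last by move=> _ [x xG <-]; exact: lower.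
by exists (sphdist e (y *m invmx B *m G)), (y *m invmx B *m G).
Qed.

End DistanceToOrigin.

(** * Gaussian matrices and zonal integrals on the Grassmannian *)

Section GaussianIntegral.
Context (R : realType).
Notation mu := (@lebesgue_measure R).

Definition gauss_density m (v : 'rV[R]_m) : R := expR (- sqnorm v / 2).

Lemma gauss_density_ge0 m (v : 'rV[R]_m) : 0 <= gauss_density v.
Proof. exact: expR_ge0. Qed.

Lemma gauss_density_le1 m (v : 'rV[R]_m) : gauss_density v <= 1.
Proof. by rewrite expR_le1; have := sqnorm_ge0 v; lra. Qed.

Lemma measurable_gauss_density m : measurable_fun setT (@gauss_density m).
Proof.
have ms := measurable_sqnorm (@measurable_id _ 'rV[R]_m setT).
by rewrite /gauss_density; solve_measurable.
Qed.

Lemma integral_gauss_density1 :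
  (\int[mu]_t (expR (- t ^+ 2 / 2))%:E = (Num.sqrt 2 * Num.sqrt pi)%:E)%E.
Proof.
have s2 : 0 < Num.sqrt 2 :> R by rewrite sqrtr_gt0.
have mg : measurable_fun setT (fun x : R => (gauss_fun x)%:E).
  by apply/measurable_EFinP; exact: measurable_gauss_fun.
have g0 (x : R) : (0 <= (gauss_fun x)%:E)%E by rewrite lee_fin gauss_fun_ge0.
rewrite EFinM -integralT_gauss -[Num.sqrt 2]invrK -(gtr0_norm s2) -normfV.
rewrite -(ge0_integral_dilate mg g0) ?invr_eq0 ?gt_eqF//.
apply: eq_integral => t _; rewrite /gauss_fun; congr (expR _)%:E.
by rewrite exprMn exprVn sqr_sqrtr// mulrC mulrN.
Qed.

Lemma iint_gauss_density m :
  iint (fun v : 'rV[R]_m => (gauss_density v)%:E) =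
  ((Num.sqrt 2 * Num.sqrt pi) ^+ m)%:E.
Proof.
elim: m => [|m IH]; first by rewrite /= /gauss_density sqnorm_rV0 oppr0 mul0r expR0.
rewrite iintS exprSr EFinM -integral_gauss_density1.
rewrite -ge0_integralZl//; last by solve_measurable.
apply: eq_integral => s _; rewrite muleC -IH -iintZl; last 3 first.
- by apply/measurable_EFinP; exact: measurable_gauss_density.
- by move=> v; rewrite lee_fin gauss_density_ge0.
- by rewrite lee_fin expR_ge0.
congr iint; apply/funext => v; rewrite -EFinM -expRD /gauss_density sqnorm_row_cons.
by congr (expR _)%:E; lra.
Qed.

End GaussianIntegral.

Section SingularMatrices.
Context (R : realType).

Lemma finite_root (p : {poly R}) : p != 0 -> finite_set [set x | root p x].
Proof.
move=> p0; rewrite (_ : [set x | _] = [set` rootsR p]); first exact: finite_seq.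
apply/seteqP; split=> x /=; have := roots_on_rootsR p0 x; rewrite in_itv /=.
  by move=> ->.
by move=> ->.
Qed.

Lemma finite_singular_shift m (A : 'M[R]_m) :
  finite_set [set s | \det (A + s%:M) = 0].
Proof.
apply: (@sub_finite_set _ _ [set s | root (char_poly (- A)) s]); last first.
  by apply: finite_root; rewrite monic_neq0// char_poly_monic.
move=> s /= d0; rewrite -eigenvalue_root_char; apply/eigenvalueP.
have : ~~ row_free (A + s%:M) by rewrite row_free_unit unitmxE unitfE d0 eqxx.
rewrite -kermx_eq0 => /rowV0Pn[v /sub_kermxP vA v0]; exists v => //.
by apply/eqP; rewrite mulmxN -mul_mx_scalar eq_sym -subr_eq0 opprK addrC -mulmxDr vA.
Qed.

Lemma uniform_prob_singular_shift m (A : 'M[R]_m) :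
  (\int[uniform_prob (@ltr01 R)]_s (if (\det (A + s%:M) == 0)%R then 1 else 0))%E = 0%E.
Proof.
set D := [set s : R | \det (A + s%:M) = 0].
have cD : countable D by apply: finite_set_countable; exact: finite_singular_shift.
have mD : measurable D by exact: countable_measurable.
transitivity (\int[uniform_prob (@ltr01 R)]_s (\1_D s)%:E)%E.
  apply: eq_integral => s _; rewrite indicE; case: eqP => [Ds|nDs].
    by rewrite mem_set.
  by rewrite memNset.
rewrite integral_indic// setIT.
apply/measure0_null_setP => //; apply: dominates_uniform_prob.
by apply/measure0_null_setP => //; exact: countable_lebesgue_measure0.
Qed.

Section FullRank.
Variables m l : nat.
Notation N := (m + l)%N.

Let singular (v : 'rV[R]_(m * N)) : \bar R :=
  if \det (lsubmx (vec_mx v : 'M[R]_(m, N))) == 0 then 1%E else 0%E.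

Let singular_ge0 v : (0 <= singular v)%E. Proof. by rewrite /singular; case: ifP. Qed.

Let measurable_singular : measurable_fun setT singular.
Proof.
apply: measurable_fun_ifT => //; apply: measurable_fun_eqr => //.
by apply: measurable_det; apply: measurable_lsubmx; exact: measurable_vec_mx.
Qed.

(* Average over the translations [G + s [1 0]], singular for finitely many [s]. *)
Lemma iint_singular : iint singular = 0%E.
Proof.
pose j : 'rV[R]_(m * N) := mxvec (row_mx 1%:M 0).
pose P : probability _ R := uniform_prob (@ltr01 R).
have -> : iint singular = (\int[P]_s iint (fun v => singular (v + s *: j)))%E.
  under eq_integral do rewrite iint_shift//.
  rewrite integral_cst// [X in (_ * X)%E](_ : _ = 1%E) ?mule1//.
  exact: (probability_setT P).
rewrite fubini_tonelli_iint//; last first.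
  apply: (measurableT_comp measurable_singular); apply: measurable_addmx => //.
  exact: measurable_scalemx.
rewrite -[RHS](@iint0 R (m * N)); congr iint; apply/funext => v.
rewrite -(uniform_prob_singular_shift (lsubmx (vec_mx v : 'M[R]_(m, N)))).
apply: eq_integral => s _; rewrite /singular linearD /= linearZ /= mxvecK.
by rewrite linearD /= linearZ /= row_mxKl scale_scalar_mx mulr1.
Qed.

Definition full_rank_gauss (v : 'rV[R]_(m * N)) : R :=
  if \rank (vec_mx v : 'M[R]_(m, N)) == m then gauss_density v else 0.

Lemma full_rank_gauss_ge0 v : 0 <= full_rank_gauss v.
Proof. by rewrite /full_rank_gauss; case: ifP => // _; exact: gauss_density_ge0. Qed.

Lemma measurable_full_rank_gauss : measurable_fun setT full_rank_gauss.
Proof.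
apply: measurable_fun_ifT => //; last exact: measurable_gauss_density.
under eq_fun do rewrite rank_gram.
apply: measurable_neg; apply: measurable_fun_eqr => //; apply: measurable_det.
by apply: measurable_mulmx; [|apply: measurable_trmx]; exact: measurable_vec_mx.
Qed.

Lemma iint_full_rank_gauss :
  iint (fun v => (full_rank_gauss v)%:E) =
  ((Num.sqrt 2 * Num.sqrt pi) ^+ (m * N))%:E.
Proof.
rewrite -iint_gauss_density; apply/eqP; rewrite eq_le; apply/andP; split.
  apply: ge0_le_iint => v; rewrite lee_fin ?full_rank_gauss_ge0//.
  by rewrite /full_rank_gauss; case: ifP => // _; exact: gauss_density_ge0.
rewrite -[leRHS]adde0 -iint_singular -iintD//; last 2 first.
- by apply/measurable_EFinP; exact: measurable_full_rank_gauss.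
- by move=> v; rewrite lee_fin full_rank_gauss_ge0.
apply: ge0_le_iint => v; first by rewrite lee_fin gauss_density_ge0.
rewrite /full_rank_gauss; case: ifPn => [_|rv]; first by rewrite leeDl.
rewrite add0e /singular ifT ?lee_fin ?gauss_density_le1//.
apply: contraNT rv => dN0; rewrite eqn_leq rank_leq_row /=.
have : row_free (lsubmx (vec_mx v : 'M[R]_(m, N))).
  by rewrite row_free_unit unitmxE unitfE.
rewrite -row_leq_rank => /leq_trans; apply.
have -> : lsubmx (vec_mx v : 'M[R]_(m, N)) = vec_mx v *m (col_mx 1%:M 0 : 'M[R]_(N, m)).
  by rewrite -{2}[vec_mx v]hsubmxK mul_row_col mulmx1 mulmx0 addr0.
exact: mxrankM_maxl.
Qed.

Lemma sqnorm_mxvec (A : 'M[R]_(m, N)) : sqnorm (mxvec A) = \sum_i \sum_j A i j ^+ 2.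
Proof.
rewrite /sqnorm (reindex _ (curry_mxvec_bij m N)) /= pair_bigA /=.
by apply: eq_bigr => -[i j] _ /=; rewrite mxvecE.
Qed.

Lemma full_rank_gauss_orthogonal (Q : 'M[R]_N) : orthogonal_mx Q ->
  exists2 M : 'M[R]_(m * N), orthogonal_mx M &
  forall v, vec_mx (v *m M) = vec_mx v *m Q :> 'M[R]_(m, N) /\
            full_rank_gauss (v *m M) = full_rank_gauss v.
Proof.
move=> oQ; pose M : 'M[R]_(m * N) := lin_mx (mulmxr Q).
have ME (v : 'rV[R]_(m * N)) : vec_mx (v *m M) = vec_mx v *m Q :> 'M[R]_(m, N).
  by rewrite -{1}[v]vec_mxK /M mul_vec_lin mxvecK.
have row_sqnorm (A : 'M[R]_(m, N)) : sqnorm (mxvec A) = \sum_i sqnorm (row i A).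
  rewrite sqnorm_mxvec; apply: eq_bigr => i _.
  by apply: eq_bigr => j _; rewrite mxE.
have sM (v : 'rV[R]_(m * N)) : sqnorm (v *m M) = sqnorm v.
  rewrite -[v *m M]vec_mxK ME -[in RHS](vec_mxK v) !row_sqnorm.
  by apply: eq_bigr => i _; rewrite row_mul sqnorm_orthogonal.
exists M; first exact: isometry_orthogonal.
move=> v; split => //; rewrite /full_rank_gauss ME /gauss_density sM.
by rewrite mxrankMfree// row_free_unit orthogonal_mx_unit.
Qed.

End FullRank.
End SingularMatrices.

Section Grassmannian.
Context (R : realType) (k l : nat).
Notation mu := (@lebesgue_measure R).
Notation m := k.+1.
Notation N := (k.+1 + l.+1)%N.
Notation e := (origin R (k + l.+1)).

Let ball (q : R) : \bar R := if (0 < q) && (q <= 1) then 1%E else 0%E.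

Let ball_ge0 q : (0 <= ball q)%E. Proof. by rewrite /ball; case: ifP. Qed.

Let measurable_ball : measurable_fun setT ball.
Proof. by rewrite /ball; solve_measurable. Qed.

Let integral_ball : (\int[mu]_y ((expR (N%:R / 2 * y))%:E * ball (expR y)) =
  ((N%:R / 2)^-1)%:E)%E.
Proof.
rewrite -integral_expR_unit ?divr_gt0//; apply: eq_integral => y _.
by rewrite /ball expR_gt0.
Qed.

Section DoubleIntegral.
Variable Psi : R -> \bar R.
Hypotheses (mPsi : measurable_fun setT Psi) (Psi0 : forall t, (0 <= Psi t)%E).

(* Integrating [rotated_pair] first over the matrix [v] or first over the vector [u]
   gives the two sides of [grassmannian_zonal]: a rotation takes [u] to the direction
   of the origin, or the row space of [v] to a coordinate subspace. *)
Let rotated_pair (v : 'rV[R]_(m * N)) (u : 'rV[R]_N) : \bar R :=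
  ((full_rank_gauss v)%:E *
   (ball (sqnorm u) * Psi (sqnorm_proj (vec_mx v) u / sqnorm u)%R))%E.

Let rotated_pair_ge0 v u : (0 <= rotated_pair v u)%E.
Proof. by rewrite !mule_ge0// lee_fin full_rank_gauss_ge0. Qed.

Let measurable_rotated_pair : measurable_fun setT
  (fun z : 'rV[R]_(m * N) * 'rV[R]_N => rotated_pair z.1 z.2).
Proof.
have mr := @measurable_full_rank_gauss R m l.+1.
have ms := @measurable_sqnorm R _ _ _ _ (@measurable_snd _ _ 'rV[R]_(m * N) 'rV[R]_N).
have mp : measurable_fun setT (fun z : 'rV[R]_(m * N) * 'rV[R]_N =>
    sqnorm_proj (vec_mx z.1 : 'M[R]_(m, N)) z.2).
  by apply: measurable_sqnorm_proj => //; exact: measurable_vec_mx.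
by rewrite /rotated_pair; solve_measurable.
Qed.

Let measurable_proj_origin : measurable_fun setT (fun v : 'rV[R]_(m * N) =>
  (full_rank_gauss v)%:E * Psi (sqnorm_proj (vec_mx v) e))%E.
Proof.
have mr := @measurable_full_rank_gauss R m l.+1.
have mp : measurable_fun setT (fun v : 'rV[R]_(m * N) =>
    sqnorm_proj (vec_mx v : 'M[R]_(m, N)) e).
  by apply: measurable_sqnorm_proj => //; exact: measurable_vec_mx.
by solve_measurable.
Qed.

Lemma iint_rotate_matrix u : iint (rotated_pair^~ u) = (ball (sqnorm u) *
  iint (fun v : 'rV[R]_(m * N) =>
    (full_rank_gauss v)%:E * Psi (sqnorm_proj (vec_mx v) e)))%E.
Proof.
have [u01|u01] := boolP ((0 < sqnorm u) && (sqnorm u <= 1)); last first.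
  rewrite /rotated_pair /ball (negPf u01) mul0e -[RHS](@iint0 R (m * N)).
  by congr iint; apply/funext => v; rewrite mul0e mule0.
have u0 : sqnorm u != 0 by case/andP: u01 => /gt_eqF ->.
have [Q oQ uQ] : exists2 Q : 'M[R]_N, orthogonal_mx Q & e *m Q = (vnorm u)^-1 *: u.
  by apply: householder; rewrite [LHS]sqnorm_origin sqnormZ exprVn sqr_vnorm mulVf.
have projE (G : 'M[R]_(m, N)) : sqnorm_proj G u / sqnorm u = sqnorm_proj (G *m Q^T) e.
  by rewrite -sqnorm_proj_orthogonal// uQ sqnorm_projZ exprVn sqr_vnorm mulrC.
have [M oM HM] := @full_rank_gauss_orthogonal R m l.+1 Q^T (orthogonal_mx_tr oQ).
rewrite /ball u01 mul1e -[RHS](iint_orthogonal oM)//; last first.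
  by move=> v; rewrite mule_ge0 ?lee_fin ?full_rank_gauss_ge0.
congr iint; apply/funext => v; have [-> ->] := HM v.
by rewrite /rotated_pair /ball u01 mul1e projE.
Qed.

Variables (A B : R).
Hypotheses (polarA : polar_constant m A) (A0 : 0 <= A).
Hypotheses (polarB : polar_constant l.+1 B) (B0 : 0 <= B).

Lemma iint_rotate_vector v : iint (rotated_pair v) = ((full_rank_gauss v)%:E *
  ((A * B / (N%:R / 2))%:E * \int[mu]_x
    ((softplus_weight (l.+1%:R / 2) (N%:R / 2) x)%:E * Psi (expR (- softplus x)))))%E.
Proof.
have msp := @measurable_softplus R.
rewrite iintZl; last 3 first.
- have ms := measurable_sqnorm (@measurable_id _ 'rV[R]_N setT).
  have mp : measurable_fun setT (fun u => sqnorm_proj (vec_mx v : 'M[R]_(m, N)) u).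
    exact: measurable_sqnorm_proj.
  by solve_measurable.
- by move=> u; rewrite mule_ge0.
- by rewrite lee_fin full_rank_gauss_ge0.
rewrite /full_rank_gauss; case: ifPn => [rv|_]; last by rewrite !mul0e.
congr (_ * _)%E.
have [Q oQ [L GQ]] := lq_decomposition (vec_mx v : 'M[R]_(m, N)).
have uL : L \in unitmx by rewrite (lq_unitmx oQ GQ).
pose f (u : 'rV[R]_N) := (ball (sqnorm u) * Psi (sqnorm (lsubmx u) / sqnorm u)%R)%E.
transitivity (iint (fun u => f (u *m Q))).
  congr iint; apply/funext => u.
  by rewrite /f sqnorm_orthogonal// (lq_sqnorm_proj oQ GQ u uL).
rewrite iint_orthogonal//; last 2 first.
- have ms := measurable_sqnorm (@measurable_id _ 'rV[R]_N setT).
  have ml := measurable_sqnorm (measurable_lsubmx (@measurable_id _ 'rV[R]_N setT)).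
  by rewrite /f; solve_measurable.
- by move=> u; rewrite mule_ge0.
pose Phi s t := (ball (s + t)%R * Psi (s / (s + t))%R)%E.
transitivity (iint (fun u1 : 'rV[R]_m => iint (fun u2 : 'rV[R]_l.+1 =>
    Phi (sqnorm u1) (sqnorm u2)))).
  rewrite iint_row_mx; congr iint; apply/funext => u1; congr iint; apply/funext => u2.
  by rewrite /f sqnorm_row_mx row_mxKl.
rewrite (iint_polar polarA B0 polarB (h := ball)
  (psi := fun x => Psi (expR (- softplus x))))//; first last.
- move=> y z; rewrite /Phi expRD_softplus -expRB.
  by congr (_ * Psi (expR _))%E; ring.
- by solve_measurable.
- by move=> s t; rewrite mule_ge0.
- by rewrite /Phi; solve_measurable.
by rewrite integral_ball [X in (_ * X)%E]muleC muleA -EFinM.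
Qed.

Lemma grassmannian_double_integral : (iint (fun u : 'rV[R]_N => ball (sqnorm u)) *
  iint (fun v : 'rV[R]_(m * N) =>
    (full_rank_gauss v)%:E * Psi (sqnorm_proj (vec_mx v) e)) =
  iint (fun v : 'rV[R]_(m * N) => (full_rank_gauss v)%:E) *
  ((A * B / (N%:R / 2))%:E * \int[mu]_x
    ((softplus_weight (l.+1%:R / 2) (N%:R / 2) x)%:E * Psi (expR (- softplus x)))))%E.
Proof.
transitivity (iint (fun u => iint (rotated_pair^~ u))).
  rewrite muleC -iintZl//; last 2 first.
  - have ms := measurable_sqnorm (@measurable_id _ 'rV[R]_N setT).
    by solve_measurable.
  - by apply: iint_ge0 => v; rewrite mule_ge0// lee_fin full_rank_gauss_ge0.
  by congr iint; apply/funext => u; rewrite iint_rotate_matrix muleC.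
rewrite -iint_exchange// [RHS]muleC -iintZl; last 3 first.
- by apply/measurable_EFinP; exact: measurable_full_rank_gauss.
- by move=> v; rewrite lee_fin full_rank_gauss_ge0.
- rewrite mule_ge0 ?lee_fin ?divr_ge0 ?mulr_ge0//.
  by apply: integral_ge0 => x _; rewrite mule_ge0// lee_fin softplus_weight_ge0.
by congr iint; apply/funext => v; rewrite iint_rotate_vector muleC.
Qed.

End DoubleIntegral.

Lemma grassmannian_zonal : exists2 C : R, 0 < C &
  forall Psi : R -> \bar R, measurable_fun setT Psi -> (forall t, 0 <= Psi t)%E ->
  iint (fun v : 'rV[R]_(m * N) =>
    (full_rank_gauss v)%:E * Psi (sqnorm_proj (vec_mx v) e))%E =
  (C%:E * \int[mu]_x ((softplus_weight (l.+1%:R / 2) (N%:R / 2) x)%:E *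
    Psi (expR (- softplus x))))%E.
Proof.
have [A A0 polarA] := exists_polar_constant R k.
have [B B0 polarB] := exists_polar_constant R l.
have [D D0 polarD] := exists_polar_constant R (k + l.+1).
pose W : R := N%:R / 2; have W0 : 0 < W by rewrite divr_gt0.
pose c : R := (Num.sqrt 2 * Num.sqrt pi) ^+ (m * N).
have c0 : 0 < c by rewrite exprn_gt0// mulr_gt0 ?sqrtr_gt0// pi_gt0.
have ball_mass : iint (fun u : 'rV[R]_N => ball (sqnorm u)) = (D / W)%:E.
  by rewrite [LHS](polarD ball measurable_ball ball_ge0) integral_ball.
exists (c * (A * B / W) / (D / W)); first by rewrite !(mulr_gt0, invr_gt0).
move=> Psi mPsi Psi0.
have DWN0 : D / W != 0 by rewrite gt_eqF// divr_gt0.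
have := grassmannian_double_integral mPsi Psi0 polarA (ltW A0) polarB (ltW B0).
rewrite ball_mass iint_full_rank_gauss => /(congr1 (fun z => (((D / W)^-1)%:E * z)%E)).
rewrite muleA -EFinM mulVf// mul1e => ->.
by rewrite !muleA -!EFinM; congr (_%:E * _)%E; rewrite /c /W; ring.
Qed.

End Grassmannian.

(** * Reduction to an integral operator on the line *)

Lemma ge0_lee_poweR (R : realType) (r : R) (x y : \bar R) :
  0 <= r -> (0 <= x)%E -> (x <= y)%E -> (x `^ r <= y `^ r)%E.
Proof.
move=> r0 x0 xy; apply: gt0_ler_poweR => //; rewrite in_itv /= leey andbT//.
exact: le_trans xy.
Qed.

Section KernelOperators.
Context (R : realType).
Notation mu := (@lebesgue_measure R).
Implicit Types (K : R -> R -> R) (f g : R -> R) (p r : R).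

Definition kernel_op K f (v : R) : \bar R := (\int[mu]_z (K v z * f z)%:E)%E.

Definition lp_bounded K p r : Prop := exists C : R, forall f,
  measurable_fun setT f -> (forall z, 0 <= f z) ->
  (\int[mu]_z (powR (f z) p)%:E < +oo)%E ->
  ((\int[mu]_v (kernel_op K f v `^ r)) `^ r^-1 <=
   C%:E * (\int[mu]_z (powR (f z) p)%:E) `^ p^-1)%E.

Section Theory.
Variable K : R -> R -> R.
Hypotheses (K0 : forall v z, 0 <= K v z)
           (mK : measurable_fun setT (fun w : R * R => K w.1 w.2)).

Lemma measurable_kernel_section v : measurable_fun setT (K v).
Proof. exact: (measurableT_comp2 mK (measurable_cst v) (@measurable_id _ _ _)). Qed.

Lemma kernel_op_ge0 f v : (forall z, 0 <= f z) -> (0 <= kernel_op K f v)%E.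
Proof. by move=> f0; apply: integral_ge0 => z _; rewrite lee_fin mulr_ge0. Qed.

Lemma measurable_kernel_op f : measurable_fun setT f -> (forall z, 0 <= f z) ->
  measurable_fun setT (kernel_op K f).
Proof.
move=> mf f0; apply: measurable_fun_integral_curry.
  apply/measurable_EFinP; apply: measurable_funM => //.
  exact: (measurableT_comp mf).
by move=> v z; rewrite lee_fin mulr_ge0.
Qed.

Lemma kernel_opD f g v : measurable_fun setT f -> measurable_fun setT g ->
  (forall z, 0 <= f z) -> (forall z, 0 <= g z) ->
  kernel_op K (fun z => f z + g z) v = (kernel_op K f v + kernel_op K g v)%E.
Proof.
move=> mf mg f0 g0; have mKv := measurable_kernel_section v.
rewrite /kernel_op -ge0_integralD//.
- by apply: eq_integral => z _; rewrite mulrDr.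
- by move=> z _; rewrite lee_fin mulr_ge0.
- by solve_measurable.
- by move=> z _; rewrite lee_fin mulr_ge0.
- by solve_measurable.
Qed.

Lemma kernel_opZ c f v : 0 <= c -> measurable_fun setT f -> (forall z, 0 <= f z) ->
  kernel_op K (fun z => c * f z) v = (c%:E * kernel_op K f v)%E.
Proof.
move=> c0 mf f0; have mKv := measurable_kernel_section v.
rewrite /kernel_op -ge0_integralZl_EFin//.
- by apply: eq_integral => z _; rewrite mulrCA.
- by move=> z _; rewrite lee_fin mulr_ge0.
- by solve_measurable.
Qed.

Lemma ge0_abse_kernel_op C f v : 0 <= C -> (forall z, 0 <= f z) ->
  (`|C%:E * kernel_op K (fun z => Num.max (f z) 0)%R v
     - C%:E * kernel_op K (fun z => Num.max (- f z) 0)%R v| =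
   C%:E * kernel_op K (fun z => `|f z|)%R v)%E.
Proof.
move=> C0 f0; rewrite [X in (_ - _ * X)%E]integral0_eq; last first.
  by move=> z _; rewrite max_r ?mulr0// oppr_le0.
rewrite mule0 sube0 gee0_abs ?mule_ge0 ?lee_fin//; last first.
  by apply: kernel_op_ge0 => z; rewrite max_l.
by congr (_ * _)%E; apply: eq_integral => z _; rewrite max_l ?ger0_norm.
Qed.

Lemma le_abse_kernel_op C f v : 0 <= C -> measurable_fun setT f ->
  (`|C%:E * kernel_op K (fun z => Num.max (f z) 0)%R v
     - C%:E * kernel_op K (fun z => Num.max (- f z) 0)%R v| <=
   C%:E * kernel_op K (fun z => `|f z|)%R v)%E.
Proof.
move=> C0 mf; have max_ge0 (x : R) : 0 <= Num.max x 0 by rewrite le_max lexx orbT.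
rewrite (_ : (fun z => `|f z|) = (fun z => Num.max (f z) 0 + Num.max (- f z) 0)).
  rewrite kernel_opD//; [|by solve_measurable..].
  rewrite [leRHS]ge0_muleDr; [|exact: kernel_op_ge0..].
  apply: (le_trans (lee_abs_sub _ _)).
  by rewrite !gee0_abs// mule_ge0 ?lee_fin ?kernel_op_ge0.
apply/funext => z; have [f0|f0] := leP 0 (f z).
  by rewrite ger0_norm// (max_r (x := - f z)) ?oppr_le0// addr0.
by rewrite ltr0_norm// max_l ?add0r// oppr_ge0 ltW.
Qed.

End Theory.
End KernelOperators.

Section LogKernel.
Context (R : realType).
Notation mu := (@lebesgue_measure R).
Implicit Types (ka a b D E v z : R).

(* The kernel decays in [z - v] at the rate [b] for [v, z -> -oo] (towards the
   origin) and [a] for [v, z -> +oo] (towards the equator); [D] and [E] are its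
   rates of decay along the diagonal in these two directions. *)
Definition log_kernel ka b a D E v z : R :=
  if v < z then expR ((ka - 1) * ln (1 - expR (v - z)) - b * (z - v)
    + D * (z - softplus z) + (b - a) * (softplus z - softplus v) - E * softplus v)
  else 0.

Definition radon_kernel ka : R -> R -> R := log_kernel ka 0 2^-1 ka 0.

Lemma log_kernel_ge0 ka b a D E v z : 0 <= log_kernel ka b a D E v z.
Proof. by rewrite /log_kernel; case: ifP => // _; exact: expR_ge0. Qed.

Lemma measurable_log_kernel ka b a D E :
  measurable_fun setT (fun w : R * R => log_kernel ka b a D E w.1 w.2).
Proof.
by have ms := @measurable_softplus R; rewrite /log_kernel; solve_measurable.
Qed.

Lemma log_kernel_weight ka b a D E be s al t v z :
  softplus_weight be s v * log_kernel ka b a D E v z / softplus_weight al t z =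
  log_kernel ka (b + be) (a - (t - al)) (D + be - al) (E + (s - be) - (t - al)) v z.
Proof.
rewrite /log_kernel /softplus_weight; case: ifP => _; last by rewrite mulr0 mul0r.
by rewrite -expRN -!expRD; congr expR; ring.
Qed.

Lemma integral_exp_affine b c (g : R -> \bar R) : 0 < b -> 0 <= c ->
  measurable_fun setT g -> (forall t, 0 <= g t)%E ->
  (\int[mu]_x ((expR x)%:E * g (expR x)) =
   \int[mu]_z (if (c < expR z)%R
               then (expR z / b)%:E * g ((expR z - c) / b)%R else 0))%E.
Proof.
move=> b0 c0 mg g0; pose G t := if 0 < t then g t else 0%E.
have mG : measurable_fun setT G by rewrite /G; solve_measurable.
have G0 t : (0 <= G t)%E by rewrite /G; case: ifP.
pose H u := ((b^-1)%:E * G (b^-1 * u + - (c / b))%R)%E.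
have mH : measurable_fun setT H by rewrite /H; solve_measurable.
have H0 u : (0 <= H u)%E by rewrite mule_ge0// lee_fin invr_ge0 ltW.
have HE u : (if 0 < u then H u else 0%E) = H u.
  case: ifPn => //; rewrite -leNgt => u0; rewrite /H /G ifF ?mule0//.
  apply/negbTE; rewrite -leNgt subr_le0 (@le_trans _ _ 0)//.
    by rewrite pmulr_rle0// invr_gt0.
  by rewrite divr_ge0// ltW.
rewrite ge0_integral_exp//.
transitivity (\int[mu]_u H u)%E.
  rewrite ge0_integralZl_EFin ?invr_ge0 ?(ltW b0)//; last by solve_measurable.
  have bV0 : b^-1 != 0 by rewrite invr_eq0 gt_eqF.
  rewrite (ge0_integral_affine (- (c / b)) mG G0 bV0) muleA -EFinM normfV invrK.
  by rewrite gtr0_norm// mulVf ?mul1e// gt_eqF.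
transitivity (\int[mu]_u (if (0 < u)%R then H u else 0))%E.
  by apply: eq_integral => u _; rewrite HE.
rewrite -(ge0_integral_exp mH H0); apply: eq_integral => z _; rewrite /H /G.
rewrite (_ : b^-1 * expR z + - (c / b) = (expR z - c) / b); last by ring.
rewrite pmulr_lgt0 ?invr_gt0// subr_gt0.
by case: ifP => _; rewrite ?mule0// muleA.
Qed.

Lemma integral_radon_kernel ka v (Phi : R -> \bar R) :
  measurable_fun setT Phi -> (forall z, 0 <= Phi z)%E ->
  (\int[mu]_x ((softplus_weight ka (ka + 2^-1) x)%:E *
      Phi (ln (expR v + expR x * (1 + expR v)))) =
   \int[mu]_z ((radon_kernel ka v z)%:E * Phi z))%E.
Proof.
move=> mPhi Phi0; set b := 1 + expR v; have ev0 := expR_gt0 v.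
have b0 : 0 < b by rewrite addr_gt0.
pose g t : \bar R := ((expR ((ka - 1) * ln t - (ka + 2^-1) * ln (1 + t)))%:E *
   Phi (ln (expR v + t * b)))%E.
have mg : measurable_fun setT g by rewrite /g; solve_measurable.
have g0 t : (0 <= g t)%E by rewrite mule_ge0// lee_fin expR_ge0.
transitivity (\int[mu]_x ((expR x)%:E * g (expR x)))%E.
  apply: eq_integral => x _; rewrite /g muleA -EFinM -expRD expRK.
  by congr ((expR _)%:E * _)%E; rewrite /softplus; ring.
rewrite (integral_exp_affine b0 (ltW ev0) mg g0); apply: eq_integral => z _.
rewrite /radon_kernel /log_kernel ltr_expR; case: ifPn => vz; last by rewrite mul0e.
have q0 : 0 < 1 - expR (v - z) by rewrite subr_gt0 expR_lt1 subr_lt0.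
rewrite /g divfK ?gt_eqF// [expR v + _]addrC subrK expRK muleA -EFinM.
congr (_%:E * _)%E.
have -> : 1 + (expR z - expR v) / b = (1 + expR z) / b.
  by rewrite /b; field; rewrite -/b gt_eqF.
have -> : expR z - expR v = expR z * (1 - expR (v - z)).
  by rewrite mulrBr mulr1 -expRD (addrC z) subrK.
rewrite !ln_div ?posrE ?mulr_gt0 ?expR_gt0// lnM ?posrE ?expR_gt0// expRK.
rewrite -[b]expR_softplus expRK -expRN -!expRD.
by congr expR; rewrite /softplus; field.
Qed.

End LogKernel.

Section XiIntegral.
Context (R : realType) (k l : nat).
Notation mu := (@lebesgue_measure R).
Notation e := (origin R (k + l.+1)).

Lemma acos_sqrt_lt_pihalf (y : R) : 0 <= y <= 1 ->
  (acos (Num.sqrt y) < pi / 2) = (0 < y).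
Proof.
move=> /andP[y0 y1]; have sy := sqrt_itv y1.
rewrite -ltr_cos ?in_itv/= ?acos_ge0 ?acos_lepi//; last first.
  by rewrite divr_ge0 ?pi_ge0//= ler_pdivrMr// ler_peMr ?pi_ge0// ler1n.
by rewrite cos_pihalf acosK// sqrtr_gt0.
Qed.

Lemma Xi_int_zonal : exists2 C : R, 0 < C &
  forall (phi : 'M[R]_(k.+1, (k + l.+1).+1) -> \bar R) (Psi : R -> \bar R),
  measurable_fun setT Psi -> (forall y, 0 <= Psi y)%E ->
  (forall G, \rank G = k.+1 -> 0 < sqnorm_proj G e ->
    phi G = Psi (sqnorm_proj G e)) ->
  Xi_int phi = (C%:E * \int[mu]_x
    ((softplus_weight (l.+1%:R / 2) ((k.+1 + l.+1)%:R / 2) x)%:E *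
     Psi (expR (- softplus x))))%E.
Proof.
have [C C0 HC] := grassmannian_zonal R k l; exists C => // phi Psi mPsi Psi0 phiE.
pose Psi' y := if 0 < y then Psi y else 0%E.
have mPsi' : measurable_fun setT Psi' by rewrite /Psi'; solve_measurable.
have Psi'0 y : (0 <= Psi' y)%E by rewrite /Psi'; case: ifP.
transitivity (iint (fun v : 'rV[R]_(k.+1 * (k.+1 + l.+1)) =>
    (full_rank_gauss v)%:E * Psi' (sqnorm_proj (vec_mx v) e)))%E; last first.
  rewrite HC//; congr (_ * _)%E.
  by apply: eq_integral => x _; rewrite /Psi' expR_gt0.
rewrite /Xi_int; congr iint; apply/funext => v /=; rewrite /full_rank_gauss.
have [rv|_] := eqVneq; last by rewrite mul0e.
have [proj01 ->] := @dist0E R k l.+1 (vec_mx v) rv.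
rewrite acos_sqrt_lt_pihalf// /Psi' /=; case: ifPn => [proj0|_]; last by rewrite mule0.
by rewrite -sqnorm_mxvec vec_mxK /gauss_density phiE.
Qed.

End XiIntegral.

Section RadialProfiles.
Context (R : realType).
Implicit Types (F : R -> R) (z : R).

Lemma patch_cos_log F z : (F \_ `[0, 1]) (cos_log z) = F (cos_log z).
Proof. by rewrite patchE mem_setE in_itv /= ltW ?cos_log_gt0// cos_log_le1. Qed.

Lemma patch_height n F (x : 'rV[R]_n.+1) : vnorm x = 1 ->
  (F \_ `[0, 1]) `|x 0 ord_max| = F `|x 0 ord_max|.
Proof. by move=> x1; rewrite patchE mem_setE in_itv /= normr_ge0 norm_height_le1. Qed.

Lemma measurable_patch_unit F : measurable_fun (`[0, 1] : set R) F ->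
  measurable_fun setT (F \_ `[0, 1]).
Proof. by move=> mF; apply: (measurable_restrictT _ _).1 mF; exact: measurable_itv. Qed.

Lemma measurable_comp_cos_log F : measurable_fun (`[0, 1] : set R) F ->
  measurable_fun setT (fun z => F (cos_log z)).
Proof.
move=> mF; rewrite (_ : (fun z => _) = (F \_ `[0, 1]) \o @cos_log R).
  exact: measurableT_comp (measurable_patch_unit mF) (@measurable_cos_log R).
by apply/funext => z; rewrite /= patch_cos_log.
Qed.

Definition profile_of (Phi : R -> R) (t : R) : R := Phi (ln (t ^- 2 - 1)).

Lemma profile_of_cos_log Phi z : profile_of Phi (cos_log z) = Phi z.
Proof.
by rewrite /profile_of sqr_cos_log expRN invrK expR_softplus addrAC subrr add0r expRK.
Qed.

Lemma measurable_profile_of Phi : measurable_fun setT Phi ->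
  measurable_fun (`[0, 1] : set R) (profile_of Phi).
Proof.
by move=> mPhi; apply: measurable_funTS; rewrite /profile_of; solve_measurable.
Qed.

Lemma powR_expR (x a : R) : powR (expR x) a = expR (a * x).
Proof. by rewrite mulrC expRM. Qed.

Lemma powR_softplus_weight (a s x p : R) :
  powR (softplus_weight a s x) p = softplus_weight (p * a) (p * s) x.
Proof. by rewrite powR_expR /softplus_weight; congr expR; ring. Qed.

Lemma powR_softplus_weight_div (q a s x : R) : q != 0 ->
  powR (softplus_weight (a / (2 * q)) (s / (2 * q)) x) q = softplus_weight (a / 2) (s / 2) x.
Proof.
move=> q0; have divE (y : R) : q * (y / (2 * q)) = y / 2 by field.
by rewrite powR_softplus_weight !divE.
Qed.

End RadialProfiles.

Section NormFormulas.
Context (R : realType) (k l : nat).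
Notation mu := (@lebesgue_measure R).
Notation n := (k.+1 + l.+1)%N.
Notation height x := (`|x 0 ord_max|).
Implicit Types (F : R -> R) (G : 'M[R]_(k.+2, n.+1)).

Lemma normS_radial : exists2 C : R, 0 < C & forall F (p a1 a2 : R),
  measurable_fun (`[0, 1] : set R) F ->
  normS p a1 a2 (fun x : 'rV[R]_n.+1 => F (height x)) =
  ((C%:E * \int[mu]_z
     (softplus_weight ((a1 + n%:R) / 2) ((n.+1%:R + a1 + a2) / 2) z *
      powR `|F (cos_log z)| p)%:E) `^ p^-1)%E.
Proof.
have [C C0 HC] := sph_int_zonal R (k + l.+1); exists C => // F p a1 a2 mF.
rewrite /normS; congr (_ `^ _)%E; have mF1 := measurable_patch_unit mF.
pose phi t : \bar R := (powR `|(F \_ `[0, 1]) t| p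
  * powR (Num.sqrt (1 - t ^+ 2)) a1 * powR t a2)%:E.
have mphi : measurable_fun setT phi by rewrite /phi; solve_measurable.
have phi0 t : (0 <= phi t)%E by rewrite lee_fin !mulr_ge0// powR_ge0.
transitivity (sph_int (fun x : 'rV[R]_n.+1 => phi `|vdot x (origin R n)|)).
  apply: eq_sph_int => x x1; have := norm_height_le1 x1; rewrite ler_norml => xb.
  have xI : x 0 ord_max \in `[-1, 1] by rewrite in_itv.
  rewrite /phi vdot_origin (patch_height F x1) /sphdist vdotC vdot_origin.
  by rewrite (sin_acos xb) (acosK xI) real_normK ?num_real.
rewrite (HC _ phi mphi phi0); congr (_ * _)%E; apply: eq_integral => z _.
rewrite vnormE sqnorm_origin sqrtr1 mul1r /phi patch_cos_log sin_cos_log.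
rewrite /cos_log !powR_expR -EFinM; congr (_%:E).
rewrite mulrCA [RHS]mulrC -!mulrA; congr (_ * _).
by rewrite -!expRD; congr expR; rewrite -[in RHS]natr1; field.
Qed.

Lemma xi_int_radial : exists2 C : R, 0 < C & forall F, measurable_fun (`[0, 1] : set R) F ->
  (forall t, 0 <= F t) -> exists T : R -> \bar R,
  [/\ measurable_fun setT T,
      forall G, \rank G = k.+2 ->
        xi_int G (fun x => (F (height x))%:E) = T (sqnorm_proj G (origin R n)) &
      forall v, T (expR (- softplus v)) =
        (C%:E * kernel_op (radon_kernel (k.+1%:R / 2)) (fun z => F (cos_log z)) v)%E].
Proof.
have [C C0 HC] := xi_int_zonal R k; exists C => // F mF F0.
have mF1 := measurable_patch_unit mF; have mc := @measurable_cos_log R.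
have F10 t : 0 <= (F \_ `[0, 1]) t by rewrite patchE; case: ifP.
have mw : measurable_fun setT (EFin \o softplus_weight (k.+1%:R / 2) (k.+2%:R / 2 : R)).
  by apply/measurable_EFinP; exact: measurable_softplus_weight.
pose integrand y x : \bar R := ((softplus_weight (k.+1%:R / 2) (k.+2%:R / 2) x)%:E *
  ((F \_ `[0, 1]) (Num.sqrt y * cos_log x))%:E)%E.
have mintegrand : measurable_fun setT (fun z : R * R => integrand z.1 z.2).
  apply: emeasurable_funM; first exact: (measurableT_comp mw measurable_snd).
  by apply/measurable_EFinP; apply: (measurableT_comp mF1); solve_measurable.
have integrand_ge0 y x : (0 <= integrand y x)%E.
  by rewrite mule_ge0 ?lee_fin// softplus_weight_ge0.
exists (fun y => C%:E * \int[mu]_x integrand y x)%E; split.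
- apply: emeasurable_funM; first exact: measurable_cst.
  exact: measurable_fun_integral_curry.
- move=> G rG; apply: etrans (HC _ G (fun t => ((F \_ `[0, 1]) t)%:E) rG _ _).
  + by apply: eq_xi_int => x x1; rewrite patch_height.
  + by solve_measurable.
  + by move=> t; rewrite lee_fin.
move=> v; congr (_ * _)%E; have mFc := measurable_comp_cos_log mF.
rewrite /kernel_op; under [RHS]eq_integral do rewrite EFinM.
rewrite -integral_radon_kernel//; first last.
- by move=> z; rewrite lee_fin.
- by solve_measurable.
have -> : k.+1%:R / 2 + 2^-1 = k.+2%:R / 2 :> R by rewrite -[in RHS]natr1; field.
by apply: eq_integral => x _; rewrite /integrand sqrt_expRN_softplus cos_logM patch_cos_log.
Qed.

Lemma normXi_radial : exists CX CT : R, [/\ 0 < CX, 0 < CT &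
  forall F (r b1 b2 : R), measurable_fun (`[0, 1] : set R) F ->
  normXi r b1 b2 (radon (k := k.+1) (fun x : 'rV[R]_n.+1 => F (height x))) =
  ((CX%:E * \int[mu]_x
     ((softplus_weight ((b1 + l.+1%:R) / 2) ((n.+1%:R + b1 + b2) / 2) x)%:E *
      `|CT%:E * kernel_op (radon_kernel (k.+1%:R / 2))
          (fun z => Num.max (F (cos_log z)) 0)%R x
        - CT%:E * kernel_op (radon_kernel (k.+1%:R / 2))
          (fun z => Num.max (- F (cos_log z)) 0)%R x| `^ r)) `^ r^-1)%E].
Proof.
have [CT CT0 HCT] := xi_int_radial; have [CX CX0 HCX] := Xi_int_zonal R k.+1 l.
exists CX, CT; split => // F r b1 b2 mF; rewrite /normXi; congr (_ `^ _)%E.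
have max0 (x : R) : 0 <= Num.max x 0 by rewrite le_max lexx orbT.
have [||Tp [mTp Tp_xi Tp_log]] := HCT (fun t => Num.max (F t) 0) => //.
  exact: measurable_maxr.
have [||Tn [mTn Tn_xi Tn_log]] := HCT (fun t => Num.max (- F t) 0) => //.
  by apply: measurable_maxr => //; exact: measurable_funN.
pose Psi y : \bar R := (`|Tp y - Tn y| `^ r *
  (powR (Num.sqrt (1 - y)) b1 * powR (Num.sqrt y) b2)%:E)%E.
rewrite (HCX _ Psi); last 3 first.
- by rewrite /Psi; solve_measurable.
- by move=> y; rewrite mule_ge0 ?poweR_ge0// lee_fin mulr_ge0 ?powR_ge0.
- move=> G rG proj0; have [/andP[_ proj1] dE] := @dist0E R k.+1 l.+1 G rG.
  have sI := sqrt_itv proj1.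
  have sb := sI; rewrite in_itv /= in sb.
  rewrite /radon Tp_xi// Tn_xi// dE (sin_acos sb) (acosK sI) /Psi sqr_sqrtr// ltW//.
congr (_ * _)%E; apply: eq_integral => x _; rewrite /Psi Tp_log Tn_log.
move: (_ `^ r)%E => A; rewrite muleCA [RHS]muleC; congr (_ * _)%E.
rewrite -EFinM sqrt_expRN_softplus -sqr_cos_log sin_cos_log /cos_log !powR_expR.
rewrite /softplus_weight addSn; move: n.+1%:R => N.
by rewrite -!expRD; congr (expR _)%:E; field.
Qed.

End NormFormulas.

Section RadonReduction.
Context (R : realType) (k l : nat) (p r a1 a2 b1 b2 : R).
Hypotheses (p0 : 0 < p) (r0 : 0 < r).
Notation mu := (@lebesgue_measure R).
Notation n := (k.+1 + l.+1)%N.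
Notation height x := (`|x 0 ord_max|).
Implicit Types F : R -> R.

Let profile_weight :=
  softplus_weight ((a1 + n%:R) / (2 * p)) ((n.+1%:R + a1 + a2) / (2 * p)).

Let target_weight :=
  softplus_weight ((b1 + l.+1%:R) / (2 * r)) ((n.+1%:R + b1 + b2) / (2 * r)).

Definition sphere_kernel : R -> R -> R := log_kernel (k.+1%:R / 2)
  ((b1 + l.+1%:R) / (2 * r)) (2^-1 - (a2 + 1) / (2 * p))
  ((k.+1%:R - ((a1 + n%:R) / p - (b1 + n%:R - k.+1%:R) / r)) / 2)
  (((b2 + k.+1%:R + 1) / r - (a2 + 1) / p) / 2).

Let pN0 : p != 0. Proof. by rewrite gt_eqF. Qed.

Let rN0 : r != 0. Proof. by rewrite gt_eqF. Qed.

Lemma sphere_kernelE v z :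
  sphere_kernel v z = target_weight v * radon_kernel (k.+1%:R / 2) v z / profile_weight z.
Proof.
have aE (kr lr : R) : (kr + lr + 1 + a1 + a2) / (2 * p) - (a1 + (kr + lr)) / (2 * p) =
    (a2 + 1) / (2 * p).
  by field; rewrite pN0.
have DE (kr lr : R) : kr / 2 + (b1 + lr) / (2 * r) - (a1 + (kr + lr)) / (2 * p) =
    (kr - ((a1 + (kr + lr)) / p - (b1 + (kr + lr) - kr) / r)) / 2.
  by field; rewrite pN0 rN0.
have EE (kr lr : R) : (kr + lr + 1 + b1 + b2) / (2 * r) - (b1 + lr) / (2 * r)
    - ((kr + lr + 1 + a1 + a2) / (2 * p) - (a1 + (kr + lr)) / (2 * p)) =
    ((b2 + kr + 1) / r - (a2 + 1) / p) / 2.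
  by field; rewrite pN0 rN0.
rewrite log_kernel_weight /sphere_kernel -[n.+1]addn1 !natrD !add0r DE EE.
by rewrite aE.
Qed.

Definition log_profile F z : R := profile_weight z * `|F (cos_log z)|.

Lemma log_profile_ge0 F z : 0 <= log_profile F z.
Proof. by rewrite mulr_ge0// softplus_weight_ge0. Qed.

Lemma measurable_log_profile F : measurable_fun (`[0, 1] : set R) F ->
  measurable_fun setT (log_profile F).
Proof.
move=> /measurable_comp_cos_log mF.
have mw : measurable_fun setT profile_weight by exact: measurable_softplus_weight.
by rewrite /log_profile; solve_measurable.
Qed.

Lemma kernel_op_log_profile F v : measurable_fun (`[0, 1] : set R) F ->
  kernel_op sphere_kernel (log_profile F) v =
  ((target_weight v)%:E *
   kernel_op (radon_kernel (k.+1%:R / 2)) (fun z => `|F (cos_log z)|)%R v)%E.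
Proof.
move=> /measurable_comp_cos_log mF.
have mK := measurable_kernel_section (@measurable_log_kernel R _ _ _ _ _).
rewrite /kernel_op -ge0_integralZl_EFin ?softplus_weight_ge0//.
- apply: eq_integral => z _; rewrite -EFinM sphere_kernelE /log_profile.
  by congr _%:E; field; rewrite gt_eqF// expR_gt0.
- by move=> z _; rewrite lee_fin mulr_ge0 ?log_kernel_ge0.
- apply/measurable_EFinP; apply: measurable_funM; first exact: mK.
  by solve_measurable.
Qed.

Lemma normS_log_profile : exists2 C : R, 0 < C &
  forall F, measurable_fun (`[0, 1] : set R) F ->
  normS p a1 a2 (fun x : 'rV[R]_n.+1 => F (height x)) =
  (C%:E * (\int[mu]_z (powR (log_profile F z) p)%:E) `^ p^-1)%E.
Proof.
have [C C0 HC] := normS_radial R k l; exists (powR C p^-1); first exact: powR_gt0.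
move=> F mF; rewrite HC// poweRM ?lee_fin ?(ltW C0)//; last first.
  by apply: integral_ge0 => z _; rewrite lee_fin mulr_ge0 ?softplus_weight_ge0 ?powR_ge0.
rewrite poweR_EFin; congr (_ * (_ `^ _))%E; apply: eq_integral => z _; congr (_%:E).
by rewrite /log_profile powRM ?softplus_weight_ge0// powR_softplus_weight_div.
Qed.

Lemma kernel_op_log_profile_norm (CX CT : R) F : 0 <= CX -> 0 <= CT ->
  measurable_fun (`[0, 1] : set R) F ->
  ((CX%:E * \int[mu]_x
     ((softplus_weight ((b1 + l.+1%:R) / 2) ((n.+1%:R + b1 + b2) / 2) x)%:E *
      (CT%:E * kernel_op (radon_kernel (k.+1%:R / 2)) (fun z => `|F (cos_log z)|)%R x) `^ r))
     `^ r^-1)%E =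
  ((powR CX r^-1 * CT)%:E *
   (\int[mu]_v (kernel_op sphere_kernel (log_profile F) v `^ r)) `^ r^-1)%E.
Proof.
move=> CX0 CT0 mF; set T := kernel_op (radon_kernel _) _.
have T0 x : (0 <= T x)%E by apply: kernel_op_ge0 => // v z; exact: log_kernel_ge0.
transitivity ((CX%:E * \int[mu]_x
    ((powR CT r)%:E * (kernel_op sphere_kernel (log_profile F) x `^ r))) `^ r^-1)%E.
  congr ((_ * _) `^ _)%E; apply: eq_integral => x _.
  rewrite kernel_op_log_profile// -/T !poweRM ?lee_fin ?softplus_weight_ge0//.
  by rewrite !poweR_EFin powR_softplus_weight_div// muleCA.
have mK : measurable_fun setT (kernel_op sphere_kernel (log_profile F)).
  apply: measurable_kernel_op => //; first by move=> v z; exact: log_kernel_ge0.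
  - exact: measurable_log_kernel.
  - exact: measurable_log_profile.
  - by move=> z; exact: log_profile_ge0.
rewrite ge0_integralZl_EFin ?powR_ge0//; last 2 first.
- by move=> v _; exact: poweR_ge0.
- by solve_measurable.
rewrite muleA -EFinM poweRM ?lee_fin ?mulr_ge0 ?powR_ge0//; last first.
  by apply: integral_ge0 => v _; exact: poweR_ge0.
by rewrite poweR_EFin powRM ?powR_ge0// -[powR (powR _ _) _]powRrM mulfV ?powRr1.
Qed.

Lemma normXi_log_profile : exists2 C : R, 0 < C &
  forall F, measurable_fun (`[0, 1] : set R) F ->
  let rhs := (C%:E * (\int[mu]_v
    (kernel_op sphere_kernel (log_profile F) v `^ r)) `^ r^-1)%E in
  let lhs := normXi r b1 b2 (radon (k := k.+1) (fun x : 'rV[R]_n.+1 => F (height x))) in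
  (lhs <= rhs)%E /\ ((forall z, 0 <= F (cos_log z)) -> lhs = rhs).
Proof.
have [CX [CT [CX0 CT0 HX]]] := normXi_radial R k l.
exists (powR CX r^-1 * CT); first by rewrite mulr_gt0// powR_gt0.
move=> F mF rhs lhs; have mFc := measurable_comp_cos_log mF.
rewrite /lhs /rhs HX// -(kernel_op_log_profile_norm (ltW CX0) (ltW CT0) mF).
split=> [|F0]; last first.
  congr ((_ * _) `^ _)%E; apply: eq_integral => x _; congr (_ * (_ `^ _))%E.
  by rewrite ge0_abse_kernel_op ?(ltW CT0)//; exact: log_kernel_ge0.
have w0 x := softplus_weight_ge0 ((b1 + l.+1%:R) / 2) ((n.+1%:R + b1 + b2) / 2) x.
apply: ge0_lee_poweR; first by rewrite invr_ge0 ltW.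
  rewrite mule_ge0 ?lee_fin ?(ltW CX0)//; apply: integral_ge0 => x _.
  by rewrite mule_ge0 ?lee_fin ?poweR_ge0.
apply: lee_wpmul2l; first by rewrite lee_fin ltW.
apply: ge0_le_integralT => x; first by rewrite mule_ge0 ?lee_fin ?poweR_ge0.
apply: lee_wpmul2l; first by rewrite lee_fin.
apply: ge0_lee_poweR; rewrite ?(ltW r0) ?abse_ge0//.
apply: le_abse_kernel_op (ltW CT0) mFc; first by move=> v z; exact: log_kernel_ge0.
exact: measurable_log_kernel.
Qed.

Lemma radon_ineq_lp_bounded :
  radon_ineq k.+1 n p r a1 a2 b1 b2 <-> lp_bounded sphere_kernel p r.
Proof.
have [CS CS0 HS] := normS_log_profile; have [CX CX0 HX] := normXi_log_profile.
split=> [[C HC]|[C HC]].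
  exists (CX^-1 * (C * CS)) => f mf f0 fp.
  pose F := profile_of (fun z => f z / profile_weight z).
  have FE z : F (cos_log z) = f z / profile_weight z by exact: profile_of_cos_log.
  have F0 z : 0 <= F (cos_log z) by rewrite FE divr_ge0 ?softplus_weight_ge0.
  have mw : measurable_fun setT profile_weight by exact: measurable_softplus_weight.
  have mF : measurable_fun (`[0, 1] : set R) F.
    by apply: measurable_profile_of; solve_measurable.
  have fE : log_profile F = f.
    by apply/funext => z; rewrite /log_profile ger0_norm// FE mulrC divfK// gt_eqF ?expR_gt0.
  have [_ /(_ F0) XE] := HX F mF; have /= := HC F mF; rewrite XE HS// fE => HCF.
  rewrite EFinM -muleA -lee_pdivrMl ?invr_gt0// invrK EFinM -muleA; apply: HCF.
  by rewrite lte_mul_pinfty ?lee_fin ?(ltW CS0)// poweR_lty.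
exists (CX * C / CS) => F mF f; rewrite /f HS// => Slty.
have [XE _] := HX F mF; apply: (le_trans XE); rewrite muleA -EFinM divfK ?gt_eqF//.
rewrite EFinM -muleA; apply: lee_wpmul2l; first by rewrite lee_fin ltW.
apply: HC; [exact: measurable_log_profile|by move=> z; exact: log_profile_ge0|].
have pV0 : p^-1 != 0 by rewrite invr_eq0.
apply: (lty_poweRy pV0); rewrite ltNge leye_eq; apply/negP => /eqP Iy.
by move: Slty; rewrite Iy gt0_muley ?lte_fin// ltxx.
Qed.

End RadonReduction.

(** * Integral operators on Lebesgue spaces of the line *)

Section LpBounds.
Context (R : realType).
Notation mu := (@lebesgue_measure R).
Implicit Types (K L : R -> R -> R) (f g w : R -> R) (C p r s : R).

Lemma powRVK (a x : R) : a != 0 -> 0 <= x -> powR (powR x a^-1) a = x.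
Proof. by move=> aN x0; rewrite -powRrM mulVf// powRr1. Qed.

Lemma ge0_ler_powR2r (a x y : R) : 0 <= a -> 0 <= x -> x <= y -> powR x a <= powR y a.
Proof. by move=> a0 x0 xy; rewrite ge0_ler_powR ?nnegrE// (le_trans x0). Qed.

Lemma ge0_integralD_EFin f g : measurable_fun setT f -> measurable_fun setT g ->
  (forall x, 0 <= f x) -> (forall x, 0 <= g x) ->
  (\int[mu]_x (f x + g x)%:E = \int[mu]_x (f x)%:E + \int[mu]_x (g x)%:E)%E.
Proof.
move=> mf mg f0 g0; rewrite -ge0_integralD//; first by move=> x _; rewrite lee_fin.
- exact/measurable_EFinP.
- by move=> x _; rewrite lee_fin.
- exact/measurable_EFinP.
Qed.

Lemma ge0_integral_lincomb (a b : R) f g : 0 <= a -> 0 <= b ->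
  measurable_fun setT f -> measurable_fun setT g ->
  (forall x, 0 <= f x) -> (forall x, 0 <= g x) ->
  (\int[mu]_x (a * f x + b * g x)%:E =
   a%:E * \int[mu]_x (f x)%:E + b%:E * \int[mu]_x (g x)%:E)%E.
Proof.
move=> a0 b0 mf mg f0 g0; have f0E x : setT x -> (0 <= (f x)%:E)%E by rewrite lee_fin.
have g0E x : setT x -> (0 <= (g x)%:E)%E by rewrite lee_fin.
rewrite -!ge0_integralZl_EFin//; [|exact/measurable_EFinP..].
rewrite ge0_integralD_EFin//; [by solve_measurable|by solve_measurable| |];
  by move=> x; rewrite mulr_ge0.
Qed.

(* Hoelder's inequality for the factors [f w^(1/s)] and [w^(1-1/s)]. *)
Lemma weighted_jensen f w (M s : R) : measurable_fun setT f ->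
  measurable_fun setT w -> (forall x, 0 <= f x) -> (forall x, 0 <= w x) ->
  0 <= M -> 1 <= s -> (\int[mu]_x (w x)%:E <= M%:E)%E ->
  ((\int[mu]_x (f x * w x)%:E) `^ s <=
   (powR M (s - 1))%:E * \int[mu]_x (powR (f x) s * w x)%:E)%E.
Proof.
move=> mf mw f0 w0 M0; rewrite le_eqVlt => /predU1P[<- _|s1 wM].
  rewrite poweRe1; last by apply: integral_ge0 => x _; rewrite lee_fin mulr_ge0.
  by rewrite subrr powRr0 mul1e; under [leRHS]eq_integral do rewrite powRr1//.
have s0 : 0 < s by exact: lt_trans s1.
have [sN sB0] : s != 0 /\ 0 < s - 1 by rewrite gt_eqF// subr_gt0.
pose q := s / (s - 1); have q0 : 0 < q by exact: divr_gt0.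
have conj : s^-1 + q^-1 = 1 by rewrite /q; field; rewrite sN gt_eqF.
pose u x := f x * powR (w x) s^-1; pose t x := powR (w x) q^-1.
have [u0 t0] : (forall x, 0 <= u x) /\ (forall x, 0 <= t x).
  by split=> x; rewrite ?mulr_ge0 ?powR_ge0.
have mu' : measurable_fun setT u by rewrite /u; solve_measurable.
have mt : measurable_fun setT t by rewrite /t; solve_measurable.
have utE : ('N[mu]_1[EFin \o (u \* t)%R] = \int[mu]_x (f x * w x)%:E)%E.
  rewrite Lnorm1; apply: eq_integral => x _; rewrite /= (ger0_norm (mulr_ge0 (u0 x) (t0 x))).
  by rewrite /u /t -mulrA -powRD ?conj ?oner_eq0// powRr1.
have uE : ('N[mu]_(s%:E)[EFin \o u] `^ s = \int[mu]_x (powR (f x) s * w x)%:E)%E.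
  rewrite poweR_Lnorm//; apply: eq_integral => x _; rewrite /= ger0_norm//.
  by rewrite powRM ?powR_ge0// powRVK.
have tE : ('N[mu]_(q%:E)[EFin \o t] `^ q = \int[mu]_x (w x)%:E)%E.
  rewrite poweR_Lnorm ?gt_eqF//; apply: eq_integral => x _.
  by rewrite /= ger0_norm// powRVK// gt_eqF.
have := hoelder mu mu' mt s0 q0 conj; rewrite utE => fw_le.
apply: (le_trans (ge0_lee_poweR (ltW s0) _ fw_le)).
  by apply: integral_ge0 => x _; rewrite lee_fin mulr_ge0.
rewrite poweRM ?Lnorm_ge0// uE muleC; apply: lee_wpmul2r.
  by apply: integral_ge0 => x _; rewrite lee_fin mulr_ge0 ?powR_ge0.
have sE : s = q * (s - 1) by rewrite /q; field; rewrite gt_eqF.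
rewrite [X in (_ `^ X <= _)%E]sE poweRrM tE -poweR_EFin.
apply: ge0_lee_poweR (ltW sB0) _ wM.
by apply: integral_ge0 => x _; rewrite lee_fin.
Qed.

Lemma lp_norm_kernel_opZ K g r c : 0 < r -> 0 <= c ->
  (forall v z, 0 <= K v z) -> measurable_fun setT (fun w : R * R => K w.1 w.2) ->
  measurable_fun setT g -> (forall z, 0 <= g z) ->
  ((\int[mu]_v (kernel_op K (fun z => c * g z)%R v `^ r)) `^ r^-1 =
   c%:E * (\int[mu]_v (kernel_op K g v `^ r)) `^ r^-1)%E.
Proof.
move=> r0 c0 K0 mK mg g0; have mKg := measurable_kernel_op K0 mK mg g0.
have Kg0 v : (0 <= kernel_op K g v)%E by exact: kernel_op_ge0.
have scaleE v : (kernel_op K (fun z => c * g z)%R v `^ r =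
    (powR c r)%:E * kernel_op K g v `^ r)%E.
  by rewrite kernel_opZ// poweRM ?lee_fin// poweR_EFin.
under eq_integral do rewrite scaleE.
rewrite ge0_integralZl_EFin ?powR_ge0//; last 2 first.
- by move=> v _; exact: poweR_ge0.
- by solve_measurable.
rewrite poweRM ?lee_fin ?powR_ge0//; last by apply: integral_ge0 => v _; exact: poweR_ge0.
by rewrite poweR_EFin powRAC powRVK// gt_eqF.
Qed.

Lemma lp_bounded_normalized K p r C : 0 < p -> 0 < r -> 0 < C ->
  (forall v z, 0 <= K v z) -> measurable_fun setT (fun w : R * R => K w.1 w.2) ->
  (forall f, measurable_fun setT f -> (forall z, 0 <= f z) ->
    (\int[mu]_z (powR (f z) p)%:E <= 1)%E ->
    (\int[mu]_v (kernel_op K f v `^ r) <= C%:E)%E) ->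
  lp_bounded K p r.
Proof.
move=> p0 r0 C0 K0 mK HC; exists (powR C r^-1) => f mf f0.
have pN : p != 0 by rewrite gt_eqF.
have C'0 : 0 < powR C r^-1 by exact: powR_gt0.
have : (0 <= \int[mu]_z (powR (f z) p)%:E)%E.
  by apply: integral_ge0 => z _; rewrite lee_fin powR_ge0.
case IE : (\int[mu]_z (powR (f z) p)%:E)%E => [N| |]//; rewrite lee_fin => N0 _.
rewrite poweR_EFin -EFinM; apply/lee_addgt0Pr => e e0.
pose c := powR N p^-1 + e / powR C r^-1.
have c0 : 0 < c by rewrite ltr_wpDl ?powR_ge0// divr_gt0.
have cE : powR C r^-1 * powR N p^-1 + e = c * powR C r^-1.
  by rewrite /c mulrDl divfK ?gt_eqF// mulrC.
have Ncp : N <= powR c p.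
  rewrite -[leLHS](powRVK pN N0); apply: ge0_ler_powR2r; rewrite ?powR_ge0 ?(ltW p0)//.
  by rewrite lerDl divr_ge0 ?ltW.
pose g z := c^-1 * f z; have g0 z : 0 <= g z by rewrite mulr_ge0 ?invr_ge0 ?(ltW c0).
have mg : measurable_fun setT g by rewrite /g; solve_measurable.
have fE : f = (fun z => c * g z) by apply/funext => z; rewrite /g mulVKf ?gt_eqF.
have g_le1 : (\int[mu]_z (powR (g z) p)%:E <= 1)%E.
  under eq_integral do rewrite powRM ?invr_ge0 ?(ltW c0)// EFinM.
  rewrite ge0_integralZl_EFin ?powR_ge0//; last 2 first.
  - by move=> z _; rewrite lee_fin powR_ge0.
  - by solve_measurable.
  rewrite IE -EFinM lee_fin -powR_inv1 ?(ltW c0)// powRAC.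
  by rewrite powR_inv1 ?powR_ge0// ler_pdivrMl ?mulr1 ?powR_gt0.
rewrite -EFinD cE EFinM fE lp_norm_kernel_opZ ?(ltW c0)//.
apply: lee_wpmul2l; first by rewrite lee_fin ltW.
rewrite -poweR_EFin; apply: ge0_lee_poweR; [by rewrite invr_ge0 ltW| |exact: HC].
by apply: integral_ge0 => v _; exact: poweR_ge0.
Qed.

Lemma lp_bounded_dominated K L p r B : 0 < p -> 0 < r -> 0 <= B ->
  (forall v z, 0 <= K v z <= B * L v z) -> (forall v z, 0 <= L v z) ->
  measurable_fun setT (fun w : R * R => L w.1 w.2) ->
  lp_bounded L p r -> lp_bounded K p r.
Proof.
move=> p0 r0 B0 KL L0 mL [C HC]; exists (B * C) => f mf f0 fp.
rewrite EFinM -muleA; apply: le_trans (lee_wpmul2l _ (HC f mf f0 fp)); last first.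
  by rewrite lee_fin.
rewrite -lp_norm_kernel_opZ//; have Kf0 v : (0 <= kernel_op K f v)%E.
  by apply: kernel_op_ge0 => // v' z; have /andP[] := KL v' z.
apply: ge0_lee_poweR; first by rewrite invr_ge0 ltW.
  by apply: integral_ge0 => v _; exact: poweR_ge0.
apply: ge0_le_integralT => v; first exact: poweR_ge0.
apply: ge0_lee_poweR => //; first exact: ltW.
apply: ge0_le_integralT => z; have /andP[Kvz KLvz] := KL v z.
  by rewrite lee_fin mulr_ge0.
by rewrite lee_fin mulrCA mulrA ler_wpM2r.
Qed.

Lemma integral_kernel_op_le K f r A M (q : R -> R -> \bar R) (h : R -> R) :
  0 <= A -> 0 <= M -> (forall v z, 0 <= q v z)%E ->
  measurable_fun setT (fun w : R * R => q w.1 w.2) ->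
  (forall z, 0 <= h z) -> measurable_fun setT h -> (\int[mu]_z (h z)%:E <= 1)%E ->
  (forall v, kernel_op K f v `^ r <= A%:E * \int[mu]_z q v z)%E ->
  (forall z, \int[mu]_v q v z <= M%:E * (h z)%:E)%E ->
  (\int[mu]_v (kernel_op K f v `^ r) <= (A * M)%:E)%E.
Proof.
move=> A0 M0 q0 mq h0 mh h1 Kq qh.
apply: (@le_trans _ _ (\int[mu]_v (A%:E * \int[mu]_z q v z))%E).
  by apply: ge0_le_integralT => v; first exact: poweR_ge0.
rewrite ge0_integralZl_EFin//; last 2 first.
- by move=> v _; exact: integral_ge0.
- exact: measurable_fun_integral_curry.
rewrite EFinM; apply: lee_wpmul2l; first by rewrite lee_fin.
rewrite fubini_tonelli_curry//.
apply: (@le_trans _ _ (\int[mu]_z (M%:E * (h z)%:E))%E).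
  by apply: ge0_le_integralT => z; first exact: integral_ge0.
rewrite ge0_integralZl_EFin//; last 2 first.
- by move=> z _; rewrite lee_fin.
- exact/measurable_EFinP.
by rewrite -[leRHS]mule1; apply: lee_wpmul2l; rewrite ?lee_fin.
Qed.

Lemma schur_test K p M : 1 <= p -> 0 < M ->
  (forall v z, 0 <= K v z) -> measurable_fun setT (fun w : R * R => K w.1 w.2) ->
  (forall v, \int[mu]_z (K v z)%:E <= M%:E)%E ->
  (forall z, \int[mu]_v (K v z)%:E <= M%:E)%E -> lp_bounded K p p.
Proof.
move=> p1 M0 K0 mK rows cols; have p0 : 0 < p by exact: lt_le_trans p1.
have pM0 : 0 < powR M (p - 1) by exact: powR_gt0.
apply: (@lp_bounded_normalized _ _ _ (powR M (p - 1) * M)) => //; first exact: mulr_gt0.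
move=> f mf f0 f1.
apply: (integral_kernel_op_le (q := fun v z => (powR (f z) p * K v z)%:E)
  (h := fun z => powR (f z) p)) => //; try exact: ltW.
- by move=> v z; rewrite lee_fin mulr_ge0 ?powR_ge0.
- by solve_measurable.
- by move=> z; exact: powR_ge0.
- by solve_measurable.
- move=> v; rewrite /kernel_op; under eq_integral do rewrite mulrC.
  exact: weighted_jensen mf (measurable_kernel_section mK v) f0 (K0 v) (ltW M0) p1 _.
move=> z; under eq_integral do rewrite EFinM.
rewrite ge0_integralZl_EFin ?powR_ge0//; last 2 first.
- by move=> v _; rewrite lee_fin.
- by apply/measurable_EFinP; exact: (measurableT_comp mK (pair2_measurable z)).
by rewrite muleC; apply: lee_wpmul2r; rewrite ?lee_fin ?powR_ge0.
Qed.

Lemma lp_bounded_convolution (g : R -> R) p : 1 <= p ->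
  measurable_fun setT g -> (forall t, 0 <= g t) -> (\int[mu]_t (g t)%:E < +oo)%E ->
  lp_bounded (fun v z => g (z - v)) p p.
Proof.
move=> p1 mg g0 glty; have mgE : measurable_fun setT (EFin \o g) by apply/measurable_EFinP.
have g0E t : (0 <= (EFin \o g) t)%E by rewrite lee_fin.
have Ig0 : (0 <= \int[mu]_t (g t)%:E)%E.
  by apply: integral_ge0 => t _; rewrite lee_fin.
pose M := fine (\int[mu]_t (g t)%:E) + 1.
have gM : (\int[mu]_t (g t)%:E <= M%:E)%E by rewrite EFinD fineK ?leeDl ?ge0_fin_numE.
apply: (@schur_test _ _ M) => //.
- by rewrite ltr_wpDl// fine_ge0.
- by solve_measurable.
- by move=> v; rewrite (ge0_integral_shift (- v) mgE g0E).
- by move=> z; rewrite (ge0_integral_reflect z mgE g0E).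
Qed.

Lemma lp_bounded_uniform_column K r M : 1 <= r -> 0 < M ->
  (forall v z, 0 <= K v z) -> measurable_fun setT (fun w : R * R => K w.1 w.2) ->
  (forall z, \int[mu]_v (powR (K v z) r)%:E <= M%:E)%E -> lp_bounded K 1 r.
Proof.
move=> r1 M0 K0 mK cols; have r0 : 0 < r by exact: lt_le_trans r1.
apply: (@lp_bounded_normalized _ _ _ M) => // f mf f0.
under eq_integral do rewrite powRr1//; move=> f1; rewrite -[M]mul1r.
apply: (integral_kernel_op_le (q := fun v z => (powR (K v z) r * f z)%:E) (h := f)) => //.
- exact: ltW.
- by move=> v z; rewrite lee_fin mulr_ge0 ?powR_ge0.
- by solve_measurable.
- move=> v; have mKv := measurable_kernel_section mK v.
  by have := weighted_jensen mKv mf (K0 v) f0 ler01 r1 f1; rewrite powR1.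
move=> z; under eq_integral do rewrite mulrC EFinM.
rewrite ge0_integralZl_EFin//; last 2 first.
- by move=> v _; rewrite lee_fin powR_ge0.
- have mKz : measurable_fun setT (fun v => K v z).
    exact: (measurableT_comp mK (pair2_measurable z)).
  by solve_measurable.
by rewrite muleC; apply: lee_wpmul2r; rewrite ?lee_fin.
Qed.

End LpBounds.

(** * The Hardy-Littlewood-Sobolev inequality *)

Section PowerKernels.
Context (R : realType).
Notation mu := (@lebesgue_measure R).
Implicit Types s d t : R.

Lemma gt0_powRE (x a : R) : 0 < x -> powR x a = expR (a * ln x).
Proof. by move=> x0; rewrite /powR gt_eqF. Qed.

Definition riesz s t : R := if 0 < t then powR t (s - 1) else 0.

Definition near_power s d t : R := if (0 < t) && (t <= d) then powR t (s - 1) else 0.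

Definition tail_power s d t : R := if d <= t then powR t (- s - 1) else 0.

Lemma riesz_ge0 s t : 0 <= riesz s t.
Proof. by rewrite /riesz; case: ifP => // _; exact: powR_ge0. Qed.

Lemma near_power_ge0 s d t : 0 <= near_power s d t.
Proof. by rewrite /near_power; case: ifP => // _; exact: powR_ge0. Qed.

Lemma tail_power_ge0 s d t : 0 <= tail_power s d t.
Proof. by rewrite /tail_power; case: ifP => // _; exact: powR_ge0. Qed.

Lemma measurable_riesz s : measurable_fun setT (riesz s).
Proof. by rewrite /riesz; solve_measurable. Qed.

Lemma measurable_near_power s d : measurable_fun setT (near_power s d).
Proof. by rewrite /near_power; solve_measurable. Qed.

Lemma measurable_tail_power s d : measurable_fun setT (tail_power s d).
Proof. by rewrite /tail_power; solve_measurable. Qed.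

Lemma integral_near_power s d : 0 < s -> 0 < d ->
  (\int[mu]_t (near_power s d t)%:E = (powR d s / s)%:E)%E.
Proof.
move=> s0 d0; pose g t : \bar R := (if t <= d then powR t (s - 1) else 0)%:E.
transitivity (\int[mu]_t (if (0 < t)%R then g t else 0))%E.
  by apply: eq_integral => t _; rewrite /near_power /g; case: (0 < t).
rewrite -ge0_integral_exp; last 2 first.
- by rewrite /g; solve_measurable.
- by move=> t; rewrite lee_fin; case: ifP => // _; exact: powR_ge0.
rewrite gt0_powRE// -integral_expR_le//; apply: eq_integral => x _.
rewrite /g -{1}(lnK d0) ler_expR; case: ifP => _; last by rewrite mule0.
by rewrite powR_expR -EFinM -expRD; congr (expR _)%:E; ring.
Qed.

Lemma integral_tail_power s d : 0 < s -> 0 < d ->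
  (\int[mu]_t (tail_power s d t)%:E = (powR d (- s) / s)%:E)%E.
Proof.
move=> s0 d0; pose g t : \bar R := (tail_power s d t)%:E.
transitivity (\int[mu]_t (if (0 < t)%R then g t else 0))%E.
  apply: eq_integral => t _; rewrite /g /tail_power.
  by case: (leP d t) => [/(lt_le_trans d0) ->|_]//; case: ifP.
rewrite -ge0_integral_exp; last 2 first.
- by apply/measurable_EFinP; exact: measurable_tail_power.
- by move=> t; rewrite lee_fin tail_power_ge0.
rewrite gt0_powRE// -integral_expR_ge//; apply: eq_integral => x _.
rewrite /g /tail_power -{1}(lnK d0) ler_expR; case: ifP => _; last by rewrite mule0.
by rewrite powR_expR -EFinM -expRD; congr (expR _)%:E; ring.
Qed.

End PowerKernels.

Lemma poweR_le_of_threshold (R : realType) (x y : \bar R) (M s : R) : 0 < M -> 1 <= s ->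
  (0 <= x)%E -> (0 <= y)%E ->
  (forall lam, 0 < lam -> (x <= (lam * M)%:E + (powR lam (1 - s))%:E * y)%E) ->
  (x `^ s <= (powR 2 s * powR M (s - 1))%:E * y)%E.
Proof.
move=> M0 s1 x0 y0 xle; have s0 : 0 < s by exact: lt_le_trans s1.
set C := _ * _; have C0 : 0 < C by rewrite mulr_gt0// powR_gt0.
case: y y0 xle => [y| |]// y0 xle; last by rewrite gt0_muley ?lte_fin// leey.
rewrite lee_fin in y0; rewrite -EFinM; apply/lee_addgt0Pr => e e0.
pose b := y + e / C; have b0 : 0 < b by rewrite ltr_wpDl// divr_gt0.
rewrite -EFinD (_ : C * y + e = C * b); last by rewrite mulrDr mulrCA divff ?gt_eqF ?mulr1.
(* The two terms of the bound agree when [lam^s = b / M]. *)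
have [lam lam0 lamE] : exists2 lam, 0 < lam & powR lam s = b / M.
  exists (powR (b / M) s^-1); first by rewrite powR_gt0 ?divr_gt0.
  by rewrite powRVK ?gt_eqF// divr_ge0 ?ltW.
have {}xle : (x <= (2 * (lam * M))%:E)%E.
  apply: (le_trans (xle lam lam0)); rewrite -EFinM -EFinD lee_fin.
  rewrite powRB; last by rewrite (gt_eqF lam0) implybT.
  rewrite powRr1 ?(ltW lam0)// lamE.
  have : lam / (b / M) * y <= lam * M.
    rewrite (_ : _ * y = lam * M * (y / b)); last by field; rewrite !gt_eqF.
    by rewrite ler_piMr ?mulr_ge0 ?ltW// ltr_pdivrMr// mul1r ltrDl divr_gt0.
  by lra.
apply: (le_trans (ge0_lee_poweR (ltW s0) x0 xle)).
rewrite poweR_EFin lee_fin !powRM ?mulr_ge0 ?(ltW lam0) ?(ltW M0)// lamE.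
rewrite -(mulr_powRB1 (ltW M0) s0) /C le_eqVlt; apply/orP; left; apply/eqP.
by field; rewrite gt_eqF.
Qed.

Section HardyLittlewoodSobolev.
Context (R : realType) (p r : R).
Hypotheses (p1 : 1 < p) (pr : p < r).
Notation mu := (@lebesgue_measure R).
Implicit Types (f : R -> R) (lam t v y z : R).

Let th := p^-1 - r^-1.

Let q := p / (p - 1).

Let p0 : 0 < p. Proof. exact: lt_trans p1. Qed.

Let r0 : 0 < r. Proof. exact: lt_trans pr. Qed.

Let r1 : 1 < r. Proof. exact: lt_trans pr. Qed.

Let pN0 : p != 0. Proof. by rewrite gt_eqF. Qed.

Let rN0 : r != 0. Proof. by rewrite gt_eqF. Qed.

Let pB1 : p - 1 != 0. Proof. by rewrite gt_eqF// subr_gt0. Qed.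

Let th0 : 0 < th. Proof. by rewrite subr_gt0 ltf_pV2. Qed.

Let q0 : 0 < q. Proof. by rewrite divr_gt0// subr_gt0. Qed.

(* Cutting the integral of [riesz (z - v) * f z] where [threshold (z - v) (f z)]
   crosses a level [lam] bounds it by [M lam + lam^(1 - r) Q v], [Q v] being the
   integral of [damped_riesz (z - v) (f z)]. Optimizing [lam] bounds its [r]-th
   power by a multiple of [Q v], which Tonelli integrates in [v]. *)
Definition threshold t y : R := Num.min (powR t (- r^-1)) (powR y (p / r)).

Definition damped_riesz t y : R := riesz th t * y * powR (threshold t y) (r - 1).

Lemma damped_riesz_ge0 t y : 0 <= y -> 0 <= damped_riesz t y.
Proof. by move=> y0; rewrite !mulr_ge0 ?riesz_ge0 ?powR_ge0. Qed.

Lemma measurable_damped_riesz : measurable_fun setT (fun w : R * R => damped_riesz w.1 w.2).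
Proof.
have mr := @measurable_riesz R th; rewrite /damped_riesz /threshold; solve_measurable.
Qed.

Lemma riesz_le_above_threshold lam t y : 0 < lam -> 0 <= y -> lam <= threshold t y ->
  riesz th t * y <= powR lam (1 - r) * damped_riesz t y.
Proof.
move=> lam0 y0 lam_le; rewrite /damped_riesz mulrCA ler_peMr ?mulr_ge0 ?riesz_ge0//.
rewrite -(opprB r) powRN mulrC ler_pdivlMr ?powR_gt0// mul1r.
by apply: ge0_ler_powR2r; rewrite ?subr_ge0 ?(ltW r1) ?(ltW lam0).
Qed.

Lemma riesz_le_tail lam t y : 0 < lam -> 0 <= y -> powR lam (- r) <= t ->
  riesz th t * y <=
  powR lam (1 - q) * tail_power (q / r) (powR lam (- r)) t + lam * powR y p.
Proof.
move=> lam0 y0 lam_le; have t0 : 0 < t by exact: lt_le_trans (powR_gt0 _ lam0) lam_le.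
rewrite /riesz /tail_power t0 lam_le; set x := powR t (th - 1).
have xE : powR lam (1 - q) * powR t (- (q / r) - 1) = lam * powR (x / lam) q.
  rewrite /x !(@gt0_powRE _ t)// !(@gt0_powRE _ lam)// -{2 3}(lnK lam0) -expRB powR_expR.
  by rewrite -!expRD; congr expR; rewrite /q /th; field; rewrite pN0 rN0 pB1.
rewrite xE -mulrDr -ler_pdivrMl// mulrA [lam^-1 * x]mulrC.
have conj : q^-1 + p^-1 = 1 by rewrite /q; field; rewrite pN0 pB1.
have x0 : 0 <= x / lam by rewrite divr_ge0 ?powR_ge0 ?ltW.
apply: (le_trans (conjugate_powR x0 y0 q0 p0 conj)).
apply: lerD; rewrite ler_pdivrMr// ler_peMr ?powR_ge0//; last exact: ltW.
by rewrite /q ler_pdivlMr ?subr_gt0// mul1r gerBl.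
Qed.

Lemma riesz_le_near lam t y : 0 < lam -> 0 <= y -> t <= powR lam (- r) ->
  threshold t y < lam ->
  riesz th t * y <= powR lam (r / p) * near_power th (powR lam (- r)) t.
Proof.
move=> lam0 y0 t_le; rewrite /riesz /near_power; case: ifPn => [t0|_ _]; last first.
  by rewrite mul0r mulr0.
rewrite t_le [powR t _ * y]mulrC => min_lt; rewrite ler_wpM2r ?powR_ge0//.
have y_le : powR y (p / r) <= lam.
  move: min_lt; rewrite /threshold gt_min => /orP[|/ltW//].
  have := ge0_ler_powR2r (_ : 0 <= r^-1) (ltW t0) t_le.
  rewrite -powRrM mulNr mulfV// powR_inv1 ?(ltW lam0)// invr_ge0 (ltW r0) => /(_ isT).
  by rewrite powRN -[lam in _ < lam]invrK ltf_pV2 ?posrE ?invr_gt0 ?powR_gt0// leNgt => /negP.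
rewrite -[leLHS](@powRVK _ (r / p)) ?mulf_neq0 ?invr_neq0// invf_div.
by apply: ge0_ler_powR2r; rewrite ?powR_ge0// divr_ge0 ?ltW.
Qed.

Lemma riesz_mul_le lam t y : 0 < lam -> 0 <= y ->
  riesz th t * y <=
  powR lam (1 - q) * tail_power (q / r) (powR lam (- r)) t + lam * powR y p
  + (powR lam (r / p) * near_power th (powR lam (- r)) t
     + powR lam (1 - r) * damped_riesz t y).
Proof.
move=> lam0 y0; have pow_ge0 a : 0 <= powR lam a by exact: powR_ge0.
have tail0 : 0 <= powR lam (1 - q) * tail_power (q / r) (powR lam (- r)) t.
  by rewrite mulr_ge0 ?tail_power_ge0.
have near0 : 0 <= powR lam (r / p) * near_power th (powR lam (- r)) t.
  by rewrite mulr_ge0 ?near_power_ge0.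
have yp0 : 0 <= lam * powR y p by rewrite mulr_ge0 ?powR_ge0 ?ltW.
have damped0 : 0 <= powR lam (1 - r) * damped_riesz t y by rewrite mulr_ge0 ?damped_riesz_ge0.
have [/(riesz_le_above_threshold lam0 y0)|min_lt] := leP lam (threshold t y); first by lra.
have [/(riesz_le_tail lam0 y0)|/ltW t_le] := leP (powR lam (- r)) t; first by lra.
by have := riesz_le_near lam0 y0 t_le min_lt; lra.
Qed.

Lemma damped_riesz_le d t y : 0 < d -> 0 < y ->
  damped_riesz t y <=
  y * tail_power (1 - p^-1) d t + powR y (1 + p / r * (r - 1)) * near_power th d t.
Proof.
move=> d0 y0; have rB1 : 0 <= r - 1 by rewrite subr_ge0 ltW.
have tail0 : 0 <= y * tail_power (1 - p^-1) d t by rewrite mulr_ge0 ?tail_power_ge0 ?ltW.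
have near0 : 0 <= powR y (1 + p / r * (r - 1)) * near_power th d t.
  by rewrite mulr_ge0 ?near_power_ge0 ?powR_ge0.
rewrite /damped_riesz /riesz; case: ifPn => t0; last by rewrite !mul0r addr_ge0.
have [d_le|/ltW t_le] := leP d t.
  apply: ler_wpDr => //; rewrite /tail_power d_le mulrAC mulrC ler_wpM2l ?(ltW y0)//.
  apply: (@le_trans _ _ (powR t (th - 1) * powR (powR t (- r^-1)) (r - 1))).
    rewrite ler_wpM2l ?powR_ge0// ge0_ler_powR2r// /threshold ?ge_min ?lexx//.
    by rewrite le_min !powR_ge0.
  rewrite !(@gt0_powRE _ t)// powR_expR -expRD ler_expR le_eqVlt; apply/orP; left.
  by apply/eqP; rewrite /th; field; rewrite pN0 rN0.
apply: ler_wpDl => //; rewrite /near_power t0 t_le -mulrA mulrC ler_wpM2r ?powR_ge0//.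
apply: (@le_trans _ _ (y * powR (powR y (p / r)) (r - 1))).
  rewrite ler_wpM2l ?(ltW y0)// ge0_ler_powR2r// /threshold ?ge_min ?lexx ?orbT//.
  by rewrite le_min !powR_ge0.
rewrite -powRrM -[X in X * _]powRr1 ?(ltW y0)// -powRD//.
by rewrite (gt_eqF y0) implybT.
Qed.

Lemma integral_damped_riesz_le y z : 0 <= y ->
  (\int[mu]_v (damped_riesz (z - v) y)%:E <=
   (th^-1 + (1 - p^-1)^-1)%:E * (powR y p)%:E)%E.
Proof.
rewrite le_eqVlt => /predU1P[<-|y0].
  rewrite integral0_eq; last by move=> v _; rewrite /damped_riesz mulr0 mul0r.
  rewrite -EFinM lee_fin mulr_ge0 ?powR_ge0// addr_ge0 ?invr_ge0 ?(ltW th0)//.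
  by rewrite subr_ge0 invf_le1 ?(ltW p1).
pose d := powR y (- p); have d0 : 0 < d by exact: powR_gt0.
pose c := powR y (1 + p / r * (r - 1)); have c0 : 0 <= c by exact: powR_ge0.
have mt := @measurable_tail_power R (1 - p^-1) d.
have mn := @measurable_near_power R th d.
pose bound t : \bar R := (y * tail_power (1 - p^-1) d t + c * near_power th d t)%:E.
have mbound : measurable_fun setT bound by rewrite /bound; solve_measurable.
have bound0 t : (0 <= bound t)%E.
  by rewrite lee_fin addr_ge0 ?mulr_ge0 ?tail_power_ge0 ?near_power_ge0 ?(ltW y0).
apply: (@le_trans _ _ (\int[mu]_v bound (z - v)%R)%E).
  apply: ge0_le_integralT => v; first by rewrite lee_fin damped_riesz_ge0 ?ltW.
  by rewrite lee_fin; exact: damped_riesz_le.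
rewrite ge0_integral_reflect// ge0_integral_lincomb ?(ltW y0)//; last 2 first.
- by move=> t; exact: tail_power_ge0.
- by move=> t; exact: near_power_ge0.
rewrite integral_tail_power ?subr_gt0 ?invf_lt1// integral_near_power//.
rewrite -!EFinM -EFinD lee_fin /d /c !(@gt0_powRE _ y)// !powR_expR.
rewrite -{1}(lnK y0) !mulrA -!expRD.
have -> : ln y + - (1 - p^-1) * - p * ln y = p * ln y by field; rewrite pN0.
have -> : (1 + p / r * (r - 1)) * ln y + th * - p * ln y = p * ln y.
  by rewrite /th; field; rewrite pN0 rN0.
by rewrite mulrDl addrC [_^-1 * _]mulrC [(1 - _)^-1 * _]mulrC.
Qed.

Lemma integral_tail_scaled lam v : 0 < lam ->
  ((powR lam (1 - q))%:E *
     \int[mu]_z (tail_power (q / r) (powR lam (- r)) (z - v))%:E = (lam * (r / q))%:E)%E.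
Proof.
move=> lam0; have qr0 : 0 < q / r by exact: divr_gt0.
rewrite (ge0_integral_shift (- v) (f := EFin \o tail_power (q / r) (powR lam (- r)))).
- rewrite integral_tail_power ?powR_gt0// -EFinM !(@gt0_powRE _ lam)// powR_expR.
  rewrite [expR _ * (_ / _)]mulrA -expRD -[in RHS](lnK lam0) -[r / q]invf_div.
  by congr (expR _ * _)%:E; field.
- by apply/measurable_EFinP; exact: measurable_tail_power.
- by move=> t; rewrite lee_fin tail_power_ge0.
Qed.

Lemma integral_near_scaled lam v : 0 < lam ->
  ((powR lam (r / p))%:E *
     \int[mu]_z (near_power th (powR lam (- r)) (z - v))%:E = (lam * th^-1)%:E)%E.
Proof.
move=> lam0.
rewrite (ge0_integral_shift (- v) (f := EFin \o near_power th (powR lam (- r)))).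
- rewrite integral_near_power ?powR_gt0// -EFinM !(@gt0_powRE _ lam)// powR_expR.
  rewrite [expR _ * (_ / _)]mulrA -expRD -[in RHS](lnK lam0); congr (expR _ * _)%:E.
  by rewrite /th; field; rewrite pN0 rN0.
- by apply/measurable_EFinP; exact: measurable_near_power.
- by move=> t; rewrite lee_fin near_power_ge0.
Qed.

Lemma riesz_op_le_threshold f v lam : measurable_fun setT f -> (forall z, 0 <= f z) ->
  (\int[mu]_z (powR (f z) p)%:E <= 1)%E -> 0 < lam ->
  (\int[mu]_z (riesz th (z - v) * f z)%:E <=
   (lam * (r / q + 1 + th^-1))%:E
   + (powR lam (1 - r))%:E * \int[mu]_z (damped_riesz (z - v) (f z))%:E)%E.
Proof.
move=> mf f0 f1 lam0; have pow_ge0 a : 0 <= powR lam a by exact: powR_ge0.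
pose d := powR lam (- r).
pose tail z := tail_power (q / r) d (z - v); pose near z := near_power th d (z - v).
pose damped z := damped_riesz (z - v) (f z).
have mtail : measurable_fun setT tail.
  by have mt := @measurable_tail_power R (q / r) d; rewrite /tail; solve_measurable.
have mnear : measurable_fun setT near.
  by have mn := @measurable_near_power R th d; rewrite /near; solve_measurable.
have mdamped : measurable_fun setT damped.
  by apply: (measurableT_comp2 measurable_damped_riesz); solve_measurable.
have tail0 z : 0 <= tail z by exact: tail_power_ge0.
have near0 z : 0 <= near z by exact: near_power_ge0.
have damped0 z : 0 <= damped z by exact: damped_riesz_ge0.
have fp0 z : 0 <= powR (f z) p by exact: powR_ge0.
apply: (@le_trans _ _ (\int[mu]_z ((powR lam (1 - q) * tail z + lam * powR (f z) p)%:E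
    + (powR lam (r / p) * near z + powR lam (1 - r) * damped z)%:E))%E).
  apply: ge0_le_integralT => z; first by rewrite lee_fin mulr_ge0 ?riesz_ge0.
  by rewrite -EFinD lee_fin; exact: riesz_mul_le.
rewrite ge0_integralD//; last 4 first.
- by move=> z _; rewrite lee_fin addr_ge0 ?mulr_ge0 ?(ltW lam0).
- by solve_measurable.
- by move=> z _; rewrite lee_fin; apply: addr_ge0; exact: mulr_ge0.
- by solve_measurable.
rewrite !ge0_integral_lincomb ?(ltW lam0)//; last by solve_measurable.
rewrite addeA; apply: leeD2r; rewrite integral_tail_scaled// integral_near_scaled//.
apply: (@le_trans _ _ ((lam * (r / q))%:E + lam%:E * 1 + (lam * th^-1)%:E)%E).
  by apply: leeD2r; apply: leeD2l; apply: lee_wpmul2l => //; rewrite lee_fin ltW.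
by rewrite mule1 -!EFinD !mulrDr mulr1.
Qed.

Theorem hardy_littlewood_sobolev :
  lp_bounded (fun v z => riesz (p^-1 - r^-1) (z - v)) p r.
Proof.
have mr := @measurable_riesz R th; have md := measurable_damped_riesz.
have p1V : 0 < 1 - p^-1 by rewrite subr_gt0 invf_lt1.
pose M := r / q + 1 + th^-1; have M0 : 0 < M by rewrite !addr_gt0 ?invr_gt0// divr_gt0.
pose A := powR 2 r * powR M (r - 1); have A0 : 0 < A by rewrite mulr_gt0 ?powR_gt0.
pose C := th^-1 + (1 - p^-1)^-1; have C0 : 0 < C by rewrite addr_gt0 ?invr_gt0.
apply: (@lp_bounded_normalized _ _ _ _ (A * C)) => //; first exact: mulr_gt0.
- by move=> v z; exact: riesz_ge0.
- by solve_measurable.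
move=> f mf f0 f1.
apply: (integral_kernel_op_le (q := fun v z => (damped_riesz (z - v) (f z))%:E)
  (h := fun z => powR (f z) p)) => //; try exact: ltW.
- by move=> v z; rewrite lee_fin damped_riesz_ge0.
- apply/measurable_EFinP.
  by apply: (measurableT_comp2 md); solve_measurable.
- by move=> z; exact: powR_ge0.
- by solve_measurable.
- move=> v; apply: poweR_le_of_threshold => //; first exact: ltW.
  + by apply: kernel_op_ge0 => // v' z; exact: riesz_ge0.
  + by apply: integral_ge0 => z _; rewrite lee_fin damped_riesz_ge0.
  + by move=> lam lam0; exact: riesz_op_le_threshold.
- by move=> z; exact: integral_damped_riesz_le.
Qed.

End HardyLittlewoodSobolev.

(** * Sufficiency *)

Section SingularFactor.
Context (R : realType).
Notation mu := (@lebesgue_measure R).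
Implicit Types (c q s t v z : R).

Lemma invD_le_onem_expRN t : 0 < t -> (1 + t^-1)^-1 <= 1 - expR (- t).
Proof.
move=> t0; have t1 : 0 < 1 + t by rewrite addr_gt0.
have -> : (1 + t^-1)^-1 = 1 - (1 + t)^-1.
  by field; rewrite !gt_eqF.
by rewrite lerD2l lerN2 expRN lef_pV2 ?posrE ?expR_gt0// expR_ge1Dx.
Qed.

Lemma expR_ln_onem_le ka s t : 0 <= s -> 1 - ka <= s -> 0 < t ->
  expR ((ka - 1) * ln (1 - expR (- t))) <= powR (1 + t^-1) s.
Proof.
move=> s0 kas t0; have t1 : 0 < 1 + t^-1 by rewrite addr_gt0 ?invr_gt0.
have et0 : 0 < 1 - expR (- t) by rewrite subr_gt0 expR_lt1 oppr_lt0.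
have ln_le0 : ln (1 - expR (- t)) <= 0 by apply: ln_le0; rewrite gerBl expR_ge0.
have lnN_le : - ln (1 - expR (- t)) <= ln (1 + t^-1).
  rewrite -lnV ?posrE// ler_ln ?posrE ?invr_gt0// -[leRHS]invrK.
  by rewrite lef_pV2 ?posrE ?invr_gt0// invD_le_onem_expRN.
rewrite gt0_powRE// ler_expR; set l := ln _ in ln_le0 lnN_le *.
have slack : 0 <= (s - (1 - ka)) * - l by apply: mulr_ge0; lra.
have gain : 0 <= s * (ln (1 + t^-1) + l) by apply: mulr_ge0; lra.
by lra.
Qed.

Lemma powR_1DV_le s t : 0 <= s <= 1 -> 0 < t ->
  powR (1 + t^-1) s <= 2 * (1 + near_power (1 - s) 1 t).
Proof.
move=> /andP[s0 s1] t0; have tV : 0 < t^-1 by rewrite invr_gt0.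
have pow2 : powR 2 s <= (2 : R) by rewrite ler1_powR// ler1n.
have n0 := near_power_ge0 (1 - s) 1 t.
have [t1|t1] := leP t 1.
  have : powR (1 + t^-1) s <= 2 * near_power (1 - s) 1 t.
    apply: (@le_trans _ _ (powR (2 * t^-1) s)).
      apply: ge0_ler_powR2r => //; first by rewrite addr_ge0// ltW.
      by rewrite mulr_natl mulr2n lerD2r invf_ge1.
    rewrite powRM// ?(ltW tV)// /near_power t0 t1/= -[t^-1]powR_inv1 ?(ltW t0)//.
    rewrite -powRrM (_ : -1 * s = 1 - s - 1); last by ring.
    by rewrite ler_wpM2r// powR_ge0.
  by lra.
have : powR (1 + t^-1) s <= 2.
  apply: le_trans pow2; apply: ge0_ler_powR2r => //; first by rewrite addr_ge0// ltW.
  by have : t^-1 <= 1 by [rewrite invf_le1// ltW]; lra.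
by lra.
Qed.

Definition decay c t : R := if 0 <= t then expR (- c * t) else 0.

Definition growth c t : R := if t <= 0 then expR (c * t) else 0.

Lemma decay_ge0 c t : 0 <= decay c t.
Proof. by rewrite /decay; case: ifP => // _; exact: expR_ge0. Qed.

Lemma growth_ge0 c t : 0 <= growth c t.
Proof. by rewrite /growth; case: ifP => // _; exact: expR_ge0. Qed.

Lemma expR_decay_le1 c t : 0 <= c -> 0 <= t -> expR (- c * t) <= 1.
Proof. by move=> c0 t0; rewrite expR_le1 mulNr oppr_le0 mulr_ge0. Qed.

Lemma decay_le1 c t : 0 <= c -> decay c t <= 1.
Proof. by move=> c0; rewrite /decay; case: ifPn => // t0; exact: expR_decay_le1. Qed.

Lemma growth_le1 c t : 0 <= c -> growth c t <= 1.
Proof. by move=> c0; rewrite /growth; case: ifPn => // t0; rewrite expR_le1 mulr_ge0_le0. Qed.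

Lemma measurable_decay c : measurable_fun setT (decay c).
Proof. by rewrite /decay; solve_measurable. Qed.

Lemma measurable_growth c : measurable_fun setT (growth c).
Proof. by rewrite /growth; solve_measurable. Qed.

Lemma integral_decay c : 0 < c -> (\int[mu]_t (decay c t)%:E = (c^-1)%:E)%E.
Proof. by move=> c0; rewrite integral_expR_ge// mulr0 expR0 mul1r. Qed.

Lemma integral_growth c : 0 < c -> (\int[mu]_t (growth c t)%:E = (c^-1)%:E)%E.
Proof. by move=> c0; rewrite integral_expR_le// mulr0 expR0 mul1r. Qed.

Definition edge_bound c v z : R := expR (- c * (z - v)) + decay c v + growth c v.

Definition edge_majorant c q v z : R :=
  (decay c (z - v) + 3 * near_power q 1 (z - v)) + (decay c v + growth c v).

Lemma edge_majorant_ge0 c q v z : 0 <= edge_majorant c q v z.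
Proof. by rewrite !addr_ge0 ?mulr_ge0 ?decay_ge0 ?growth_ge0 ?near_power_ge0. Qed.

Lemma measurable_edge_majorant c q z : measurable_fun setT (edge_majorant c q ^~ z).
Proof.
have [md mg] := (measurable_decay c, measurable_growth c).
by have mn := measurable_near_power q 1; rewrite /edge_majorant; solve_measurable.
Qed.

Lemma integral_edge_majorant c q z : 0 < c -> 0 < q ->
  (\int[mu]_v (edge_majorant c q v z)%:E = ((c^-1 + 3 / q) + (c^-1 + c^-1))%:E)%E.
Proof.
move=> c0 q0; have [md mg] := (measurable_decay c, measurable_growth c).
have mn := measurable_near_power q 1.
have [[d0 g0] n0] := (decay_ge0 c, growth_ge0 c, near_power_ge0 q 1).
pose conv t := decay c t + 3 * near_power q 1 t.
have conv0 t : 0 <= conv t by rewrite addr_ge0 ?mulr_ge0.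
have mconv : measurable_fun setT conv by rewrite /conv; solve_measurable.
rewrite (ge0_integralD_EFin (f := fun v => conv (z - v))) => [|||v|v]; last 4 first.
- by solve_measurable.
- by solve_measurable.
- by [].
- by rewrite addr_ge0.
rewrite (ge0_integral_reflect z (f := EFin \o conv)); last 2 first.
- exact/measurable_EFinP.
- by move=> t; rewrite lee_fin.
rewrite !ge0_integralD_EFin//; [|by solve_measurable|by move=> t; rewrite mulr_ge0].
under [X in (_ + X + _)%E]eq_integral do rewrite EFinM.
rewrite ge0_integralZl_EFin//; last 2 first.
- by move=> t _; rewrite lee_fin.
- exact/measurable_EFinP.
by rewrite integral_decay// integral_growth// integral_near_power// powR1 mul1r.
Qed.

End SingularFactor.

Section KernelBounds.
Context (R : realType).
Variables (ka b a D E s : R).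
Hypotheses (s0 : 0 <= s) (kas : 1 - ka <= s) (D0 : 0 <= D) (E0 : 0 <= E).
Notation K := (log_kernel ka b a D E).
Implicit Types (c v z : R).

Definition log_phase v z : R :=
  - b * (z - v) + D * (z - softplus z) + (b - a) * (softplus z - softplus v) - E * softplus v.

Lemma log_kernelE v z : v < z ->
  K v z = expR ((ka - 1) * ln (1 - expR (- (z - v)))) * expR (log_phase v z).
Proof.
by move=> vz; rewrite /log_kernel vz -expRD opprB /log_phase; congr expR; ring.
Qed.

Lemma log_kernel_le v z : v < z ->
  K v z <= powR (1 + (z - v)^-1) s * expR (log_phase v z).
Proof.
by move=> vz; rewrite log_kernelE// ler_wpM2r ?expR_ge0// expR_ln_onem_le// subr_gt0.
Qed.

Lemma log_phase_le c v z : c <= a -> c <= b -> v <= z -> log_phase v z <= - c * (z - v).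
Proof.
move=> ca cb vz; have mono := ler_softplus vz; have lip := softplusB_le vz.
have sz := softplus_gt z; have sv := softplus_gt0 v.
have D_slack : 0 <= D * (softplus z - z) by apply: mulr_ge0 => //; lra.
have E_slack : 0 <= E * softplus v by apply: mulr_ge0 => //; lra.
have b_slack : 0 <= (b - c) * (z - v - (softplus z - softplus v)) by apply: mulr_ge0; lra.
have a_slack : 0 <= (a - c) * (softplus z - softplus v) by apply: mulr_ge0; lra.
by rewrite /log_phase; lra.
Qed.

(* For [a = 0] there is no decay in [z - v] when both variables are positive;
   the factor [expR (- E * softplus v)] replaces it. *)
Lemma expR_log_phase_le c v z : a = 0 -> 0 <= c -> c <= E -> c <= b -> v <= z ->
  expR (log_phase v z) <= expR (b * ln 2) * edge_bound c v z.
Proof.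
move=> a0 c0 cE cb vz; have [[sz sv] sv0] := (softplus_gt z, softplus_gt v, softplus_gt0 v).
have D_slack : 0 <= D * (softplus z - z) by apply: mulr_ge0 => //; lra.
have b_slack : 0 <= b * softplus v by apply: mulr_ge0; lra.
have E_slack : 0 <= E * softplus v by apply: mulr_ge0; lra.
have [d0 g0] := (decay_ge0 c v, growth_ge0 c v).
have e0 := expR_ge0 (- c * (z - v)).
suff [x le_x x_edge] : exists2 x, log_phase v z <= b * ln 2 + x &
    expR x <= edge_bound c v z.
  apply: (@le_trans _ _ (expR (b * ln 2) * expR x)); last by rewrite ler_wpM2l ?expR_ge0.
  by rewrite -expRD ler_expR.
rewrite /log_phase a0 subr0; have [z0|z0] := leP z 0.
  exists (- c * (z - v)); last by rewrite /edge_bound; lra.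
  have sz0 := softplus_le0 z0.
  have ln2_slack : 0 <= b * (ln 2 - softplus z) by apply: mulr_ge0; lra.
  have c_slack : 0 <= (b - c) * (z - v) by apply: mulr_ge0; lra.
  by lra.
have sz0 := softplus_ge0 (ltW z0).
have ln2_slack : 0 <= b * (z + ln 2 - softplus z) by apply: mulr_ge0; lra.
have [v0|/ltW v0] := leP v 0.
  exists (c * v); last by rewrite /edge_bound /growth v0; lra.
  have c_slack : 0 <= (b - c) * - v by apply: mulr_ge0; lra.
  by lra.
exists (- c * v); last by rewrite /edge_bound /decay v0; lra.
have E_gap : 0 <= E * (softplus v - v) by apply: mulr_ge0 => //; lra.
have c_slack : 0 <= (E - c) * v by apply: mulr_ge0; lra.
have b_gap : 0 <= b * (softplus v - v) by apply: mulr_ge0; lra.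
by lra.
Qed.

Lemma log_kernel_eq0 v z : ~~ (v < z) -> K v z = 0.
Proof. by rewrite /log_kernel => /negbTE->. Qed.

Lemma log_kernel_convolution_le c v z : s <= 1 -> 0 <= c -> c <= a -> c <= b ->
  K v z <= 2 * (decay c (z - v) + near_power (1 - s) 1 (z - v)).
Proof.
move=> s1 c0 ca cb; have n0 := near_power_ge0 (1 - s) 1 (z - v).
have [vz|vz] := boolP (v < z); last first.
  by rewrite log_kernel_eq0// mulr_ge0// addr_ge0 ?decay_ge0.
have t0 : 0 < z - v by rewrite subr_gt0.
have e0 := expR_ge0 (- c * (z - v)); have e1 := expR_decay_le1 c0 (ltW t0).
apply: (le_trans (log_kernel_le vz)); rewrite /decay (ltW t0).
apply: (@le_trans _ _ (2 * (1 + near_power (1 - s) 1 (z - v)) * expR (- c * (z - v)))).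
  apply: ler_pM; rewrite ?powR_ge0 ?expR_ge0//; first by rewrite powR_1DV_le ?s0.
  by rewrite ler_expR log_phase_le// ltW.
by rewrite -mulrA ler_wpM2l// mulrDl mul1r lerD2l ler_piMr.
Qed.

Lemma log_kernel_riesz_le c th v z : 0 < c -> c <= a -> c <= b ->
  0 <= th -> s <= 1 - th -> K v z <= (1 + c^-1) * riesz th (z - v).
Proof.
move=> c0 ca cb th0 s_le; have cV : 0 < c^-1 by rewrite invr_gt0.
have [vz|vz] := boolP (v < z); last first.
  by rewrite log_kernel_eq0// mulr_ge0 ?riesz_ge0// addr_ge0// ltW.
apply: (le_trans (log_kernel_le vz)); have := log_phase_le ca cb (ltW vz).
rewrite /riesz subr_gt0 vz; set t := z - v => phase_le; have t0 : 0 < t by rewrite subr_gt0.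
have tV : 0 < t^-1 by rewrite invr_gt0.
have t1 : 0 < 1 + t by rewrite addr_gt0.
apply: (@le_trans _ _ (powR (1 + t^-1) (1 - th) * expR (- c * t))).
  by apply: ler_pM; rewrite ?powR_ge0 ?expR_ge0 ?ler_expR// ler_powR// lerDl ltW.
have -> : 1 + t^-1 = (1 + t) * t^-1 by field; rewrite gt_eqF.
rewrite powRM ?(ltW t1) ?(ltW tV)// mulrAC -[t^-1]powR_inv1 ?(ltW t0)// -powRrM mulN1r opprB.
rewrite ler_wpM2r ?powR_ge0//; apply: (@le_trans _ _ ((1 + t) * expR (- c * t))).
  by rewrite ler_wpM2r ?expR_ge0// ler1_powR ?gerBl// lerDl ltW.
rewrite mulNr expRN ler_pdivrMr ?expR_gt0//.
apply: (@le_trans _ _ ((1 + c^-1) * (1 + c * t))); last first.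
  by rewrite ler_wpM2l ?expR_ge1Dx// addr_ge0// ltW.
have -> : (1 + c^-1) * (1 + c * t) = 1 + t + c^-1 + c * t by field; rewrite gt_eqF.
by have := mulr_gt0 c0 t0; lra.
Qed.

Lemma lp_bounded_log_kernel_diag c p : 1 <= p -> s < 1 -> 0 < c -> c <= a -> c <= b ->
  lp_bounded K p p.
Proof.
move=> p1 s1 c0 ca cb; have p0 : 0 < p by exact: lt_le_trans p1.
have [md mn] := (@measurable_decay R c, @measurable_near_power R (1 - s) 1).
pose g t := decay c t + near_power (1 - s) 1 t.
have g0 t : 0 <= g t by rewrite addr_ge0 ?decay_ge0 ?near_power_ge0.
have mg : measurable_fun setT g by rewrite /g; solve_measurable.
apply: (lp_bounded_dominated (L := fun v z => g (z - v)) (B := 2)) => //.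
- by move=> v z; rewrite log_kernel_ge0/= log_kernel_convolution_le// ltW.
- by solve_measurable.
apply: lp_bounded_convolution => //; rewrite /g.
rewrite ge0_integralD_EFin//; last 2 first.
- by move=> t; exact: decay_ge0.
- by move=> t; exact: near_power_ge0.
by rewrite integral_decay// integral_near_power ?subr_gt0// -EFinD ltry.
Qed.

Lemma powR_edge_le c r M x v z : 1 <= r -> 0 < c -> 0 <= M -> s * r <= 1 -> v < z ->
  0 <= x -> x <= powR (1 + (z - v)^-1) s * (M * edge_bound c v z) ->
  powR x r <= powR M r * (powR 3 (r - 1) * 2) * edge_majorant c (1 - s * r) v z.
Proof.
move=> r1 c0 M0 sr1 vz x0 x_le; have r0 : 0 < r by exact: lt_le_trans r1.
have t0 : 0 < z - v by rewrite subr_gt0.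
have e1 := expR_decay_le1 (ltW c0) (ltW t0); have e0 := expR_ge0 (- c * (z - v)).
have [d0 d1] := (decay_ge0 c v, decay_le1 v (ltW c0)).
have [g0 g1] := (growth_ge0 c v, growth_le1 v (ltW c0)).
have n0 := near_power_ge0 (1 - s * r) 1 (z - v).
set S := edge_bound c v z in x_le *.
have [S0 S3] : 0 <= S /\ S <= 3 by rewrite /S /edge_bound; split; lra.
have S_le : powR S r <= powR 3 (r - 1) * S.
  by rewrite -(mulr_powRB1 S0 r0) mulrC ler_wpM2r// ge0_ler_powR2r ?subr_ge0.
apply: (le_trans (ge0_ler_powR2r (ltW r0) x0 x_le)).
rewrite !powRM ?powR_ge0 ?mulr_ge0// -[powR (powR _ s) r]powRrM.
apply: (@le_trans _ _ (2 * (1 + near_power (1 - s * r) 1 (z - v)) *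
    (powR M r * (powR 3 (r - 1) * S)))).
  apply: ler_pM; rewrite ?mulr_ge0 ?powR_ge0//.
    by rewrite powR_1DV_le// sr1 mulr_ge0// ltW.
  by rewrite ler_wpM2l ?powR_ge0.
rewrite (_ : 2 * _ * _ = powR M r * (powR 3 (r - 1) * 2) *
    ((1 + near_power (1 - s * r) 1 (z - v)) * S)); last by ring.
rewrite ler_wpM2l ?mulr_ge0 ?powR_ge0//.
have : 0 <= near_power (1 - s * r) 1 (z - v) * (3 - S) by rewrite mulr_ge0// subr_ge0.
by rewrite /edge_majorant {1}/decay (ltW t0) /S /edge_bound; lra.
Qed.

Lemma lp_bounded_log_kernel_edge c M r : 1 <= r -> 0 < c -> 0 < M -> s * r < 1 ->
  (forall v z, v < z -> K v z <= powR (1 + (z - v)^-1) s * (M * edge_bound c v z)) ->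
  lp_bounded K 1 r.
Proof.
move=> r1 c0 M0 sr1 K_le; have r0 : 0 < r by exact: lt_le_trans r1.
have sr0 : 0 < 1 - s * r by rewrite subr_gt0.
pose B := powR M r * (powR 3 (r - 1) * 2).
have B0 : 0 < B by rewrite !mulr_gt0 ?powR_gt0.
have cV : 0 < c^-1 by rewrite invr_gt0.
pose C := (c^-1 + 3 / (1 - s * r)) + (c^-1 + c^-1).
have C0 : 0 < C by rewrite !addr_gt0// divr_gt0.
apply: (@lp_bounded_uniform_column _ _ _ (B * C)) => //; first exact: mulr_gt0.
- by move=> v z; exact: log_kernel_ge0.
- exact: measurable_log_kernel.
move=> z; rewrite EFinM -(integral_edge_majorant z c0 sr0) -ge0_integralZl_EFin ?(ltW B0)//.
- apply: ge0_le_integralT => v; first by rewrite lee_fin powR_ge0.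
  rewrite -EFinM lee_fin; have [vz|vz] := boolP (v < z).
    by apply: powR_edge_le (K_le v z vz) => //; rewrite ?log_kernel_ge0 ?(ltW M0) ?(ltW sr1).
  by rewrite log_kernel_eq0// powR0 ?gt_eqF// mulr_ge0 ?edge_majorant_ge0 ?(ltW B0).
- by move=> v _; rewrite lee_fin edge_majorant_ge0.
- by apply/measurable_EFinP; exact: measurable_edge_majorant.
Qed.

Theorem lp_bounded_log_kernel p r : 1 <= p -> p <= r -> s < 1 ->
  (1 < p -> s <= 1 - (p^-1 - r^-1)) -> (p = 1 -> s * r < 1) ->
  0 < b -> 0 <= a -> (a = 0 -> p = 1 /\ 0 < E) -> lp_bounded K p r.
Proof.
move=> p1 pr s1 s_le sr_lt b0; have r1 : 1 <= r by exact: le_trans pr.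
rewrite le_eqVlt => /predU1P[a0 /(_ (esym a0))[pE E1]|a0 _].
  rewrite pE; apply: (@lp_bounded_log_kernel_edge (Num.min E b) (expR (b * ln 2))) => //.
  - by rewrite lt_min E1.
  - exact: expR_gt0.
  - exact: sr_lt.
  move=> v z vz; apply: (le_trans (log_kernel_le vz)); rewrite ler_wpM2l ?powR_ge0//.
  apply: expR_log_phase_le => //; last exact: ltW.
  - by rewrite le_min E0 ltW.
  - by rewrite ge_min lexx.
  - by rewrite ge_min lexx orbT.
have [c c0 [ca cb]] : exists2 c, 0 < c & c <= a /\ c <= b.
  by exists (Num.min a b); rewrite ?lt_min ?a0 ?b0// !ge_min !lexx orbT.
have [pE|pN] := eqVneq p 1.
  rewrite pE; apply: (@lp_bounded_log_kernel_edge c 1) => //; first exact: sr_lt.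
  move=> v z vz; apply: (le_trans (log_kernel_le vz)); rewrite mul1r ler_wpM2l ?powR_ge0//.
  apply: (@le_trans _ _ (expR (- c * (z - v)))); first by rewrite ler_expR log_phase_le// ltW.
  by rewrite /edge_bound -addrA lerDl addr_ge0 ?decay_ge0 ?growth_ge0.
have {}p1 : 1 < p by rewrite lt_neqAle eq_sym pN.
have [<-|rN] := eqVneq p r; first exact: (lp_bounded_log_kernel_diag (ltW p1) s1 c0).
have {}pr : p < r by rewrite lt_neqAle rN.
have [p0 r0] : 0 < p /\ 0 < r by split; lra.
have th0 : 0 < p^-1 - r^-1 by rewrite subr_gt0 ltf_pV2.
apply: (lp_bounded_dominated (B := 1 + c^-1) p0 r0 _ _ _ _ (hardy_littlewood_sobolev p1 pr)).
- by rewrite addr_ge0// invr_ge0 ltW.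
- by move=> v z; rewrite log_kernel_ge0/= log_kernel_riesz_le ?(ltW th0)// s_le.
- by move=> v z; exact: riesz_ge0.
- by have mr := @measurable_riesz R (p^-1 - r^-1); solve_measurable.
Qed.

End KernelBounds.

(** * Necessity *)

Section Tests.
Context (R : realType).
Variables (ka b a D E p r : R).
Hypotheses (p0 : 0 < p) (r0 : 0 < r).
Notation mu := (@lebesgue_measure R).
Notation K := (log_kernel ka b a D E).
Notation phase := (log_phase b a D E).
Implicit Types (c m t u v w x y z : R).

Lemma integral_cst_itv c u w : u <= w ->
  (\int[mu]_v (if u <= v <= w then c else 0)%:E = (c * (w - u))%:E)%E.
Proof.
move=> uw; transitivity (\int[mu]_(v in `[u, w]) (cst c%:E) v)%E.
  rewrite [RHS]integral_mkcond; apply: eq_integral => v _.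
  by rewrite patchE mem_setE in_itv /=; case: ifP.
rewrite integral_cst//= lebesgue_measure_itv /= lte_fin.
case: ltP => [_|wu]; first by rewrite -EFinB -EFinM.
by rewrite (_ : w = u) ?subrr ?mulr0 ?mule0//; apply/eqP; rewrite eq_le wu uw.
Qed.

(* Testing the inequality on the indicator function of [m, m + 1]. *)
Lemma lp_bounded_log_kernel_test : lp_bounded K p r -> exists B : R, forall m u w c,
  u <= w -> 0 <= c ->
  (forall v z, u <= v <= w -> m <= z <= m + 1 -> c <= K v z) ->
  (w - u) * powR c r <= B.
Proof.
move=> [C HC]; exists (powR `|C| r) => m u w c uw c0 K_ge.
pose f z : R := if m <= z <= m + 1 then 1 else 0.
have mf : measurable_fun setT f by rewrite /f; solve_measurable.
have f0 z : 0 <= f z by rewrite /f; case: ifP.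
have m1 : m <= m + 1 by rewrite lerDl.
have fp : (\int[mu]_z (powR (f z) p)%:E = 1)%E.
  transitivity (\int[mu]_z (f z)%:E)%E; last first.
    by rewrite integral_cst_itv// mul1r addrAC subrr add0r.
  by apply: eq_integral => z _; rewrite /f; case: ifP; rewrite ?powR1 ?powR0 ?gt_eqF.
have c_le v : u <= v <= w -> (c%:E <= kernel_op K f v)%E.
  move=> uvw; apply: (@le_trans _ _ (\int[mu]_z (if m <= z <= m + 1 then c else 0)%:E)%E).
    by rewrite integral_cst_itv// addrAC subrr add0r mulr1.
  apply: ge0_le_integralT => z; first by rewrite lee_fin; case: ifP.
  by rewrite lee_fin /f; case: ifP => mz; rewrite ?mulr1 ?mulr0// K_ge.
have := HC f mf f0; rewrite fp poweR1r mule1 => /(_ (ltry 1)) norm_le.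
have int0 : (0 <= \int[mu]_v (kernel_op K f v `^ r))%E.
  by apply: integral_ge0 => v _; exact: poweR_ge0.
have int_le : (\int[mu]_v (kernel_op K f v `^ r) <= (powR `|C| r)%:E)%E.
  rewrite -[leLHS]poweRe1// -[X in (_ `^ X)%E](mulVf (negbT (gt_eqF r0))) poweRrM -poweR_EFin.
  apply: ge0_lee_poweR; rewrite ?(ltW r0) ?poweR_ge0//.
  by apply: (le_trans norm_le); rewrite lee_fin ler_norm.
rewrite -lee_fin mulrC; apply: le_trans int_le; rewrite -integral_cst_itv//.
apply: ge0_le_integralT => v; first by rewrite lee_fin; case: ifP => // _; exact: powR_ge0.
case: ifPn => [uvw|_]; last exact: poweR_ge0.
by rewrite -poweR_EFin; apply: ge0_lee_poweR; rewrite ?(ltW r0) ?lee_fin ?c_le.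
Qed.

Definition singular_loss : R := `|ka - 1| * - ln (1 - expR (-1)).

Lemma log_kernel_ge x v z : v <= z - 1 -> x <= phase v z ->
  expR (x - singular_loss) <= K v z.
Proof.
move=> vz x_le; have vz1 : v < z by lra.
rewrite log_kernelE// -expRD ler_expR [leRHS]addrC; apply: lerD => //.
have e1 : 0 < 1 - expR (-1) :> R by rewrite subr_gt0 expR_lt1 oppr_lt0.
have e_le : expR (- (z - v)) <= expR (-1) by rewrite ler_expR; lra.
have ln_le0 : ln (1 - expR (- (z - v))) <= 0 by apply: ln_le0; rewrite gerBl expR_ge0.
have ln_ge : ln (1 - expR (-1)) <= ln (1 - expR (- (z - v))) by rewrite ler_ln ?posrE; lra.
rewrite /singular_loss mulrN opprK -[leRHS]opprK lerNr; apply: (le_trans (ler_norm _)).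
by rewrite normrN normrM -mulrN ler_wpM2l// ler0_norm// lerN2.
Qed.

Lemma lerNM_norm x y c : `|y| <= c -> - (`|x| * c) <= x * y.
Proof.
move=> yc; rewrite -[leRHS]opprK lerN2; apply: (le_trans (ler_norm _)).
by rewrite normrN normrM ler_wpM2l.
Qed.

Lemma log_phase_ge m v z : m - 2 <= v <= m - 1 -> m <= z <= m + 1 ->
  D * (m - softplus m) - E * softplus m
    - (`|b| * 3 + `|b - a| * 3 + `|D| * 1 + `|E| * 2) <= phase v z.
Proof.
move=> /andP[v_ge v_le] /andP[z_ge z_le]; have [vz vm] : v <= z /\ v <= m by split; lra.
have [mono_vz lip_vz] := (ler_softplus vz, softplusB_le vz).
have [mono_vm lip_vm] := (ler_softplus vm, softplusB_le vm).
have [mono_mz lip_mz] := (ler_softplus z_ge, softplusB_le z_ge).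
have b_term : - (`|b| * 3) <= b * - (z - v).
  by apply: lerNM_norm; rewrite normrN ger0_norm; lra.
have ba_term : - (`|b - a| * 3) <= (b - a) * (softplus z - softplus v).
  by apply: lerNM_norm; rewrite ger0_norm; lra.
have D_term : - (`|D| * 1) <= D * ((z - softplus z) - (m - softplus m)).
  by apply: lerNM_norm; rewrite ger0_norm; lra.
have E_term : - (`|E| * 2) <= E * (softplus m - softplus v).
  by apply: lerNM_norm; rewrite ger0_norm; lra.
by rewrite /log_phase; lra.
Qed.

Lemma lp_bounded_log_phase_bounded : lp_bounded K p r -> exists T : R, forall m,
  D * (m - softplus m) - E * softplus m <= T.
Proof.
move=> /lp_bounded_log_kernel_test[B HB].
exists (B / r + singular_loss + (`|b| * 3 + `|b - a| * 3 + `|D| * 1 + `|E| * 2)) => m.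
pose x := D * (m - softplus m) - E * softplus m
  - (`|b| * 3 + `|b - a| * 3 + `|D| * 1 + `|E| * 2).
have : ((m - 1) - (m - 2)) * powR (expR (x - singular_loss)) r <= B.
  apply: (HB m); [lra|exact: expR_ge0|] => v z v_itv z_itv.
  apply: log_kernel_ge; last exact: log_phase_ge.
  by move: v_itv z_itv => /andP[_ v_le] /andP[z_ge _]; lra.
rewrite (_ : m - 1 - (m - 2) = 1) ?mul1r; last by ring.
rewrite powR_expR => /(le_trans (expR_ge1Dx _)).
have rE : B = r * (B / r) by field; rewrite gt_eqF.
move=> le_B; have : r * (x - singular_loss) <= r * (B / r) by rewrite -rE; lra.
by rewrite ler_pM2l// /x; lra.
Qed.

Lemma lp_bounded_log_kernel_D_ge0 : lp_bounded K p r -> 0 <= D.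
Proof.
move=> /lp_bounded_log_phase_bounded[T HT]; rewrite leNgt; apply/negP => D0.
pose m := - `|(T + `|E| * ln 2 + 1) / - D|; have m0 : m <= 0 by rewrite oppr_le0.
have [sm_le sm_gt] := (softplus_le0 m0, softplus_gt0 m); have := HT m.
have D_term : 0 <= - D * softplus m by apply: mulr_ge0; lra.
have E_term : - (`|E| * ln 2) <= E * - softplus m.
  by apply: lerNM_norm; rewrite normrN ger0_norm; lra.
have : T + `|E| * ln 2 + 1 <= - D * - m.
  by rewrite opprK -ler_pdivrMl ?oppr_gt0// mulrC ler_norm.
by lra.
Qed.

Lemma lp_bounded_log_kernel_E_ge0 : lp_bounded K p r -> 0 <= E.
Proof.
move=> /lp_bounded_log_phase_bounded[T HT]; rewrite leNgt; apply/negP => E0.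
pose m := `|(T + `|D| * ln 2 + 1) / - E|; have m0 : 0 <= m by exact: normr_ge0.
have [sm_le sm_gt] := (softplus_ge0 m0, softplus_gt m); have := HT m.
have E_term : 0 <= - E * (softplus m - m) by apply: mulr_ge0; lra.
have D_term : - (`|D| * ln 2) <= D * (m - softplus m).
  by apply: lerNM_norm; rewrite ler0_norm; lra.
have : T + `|D| * ln 2 + 1 <= - E * m.
  by rewrite -ler_pdivrMl ?oppr_gt0// mulrC ler_norm.
by lra.
Qed.

Lemma not_le_unbounded_length (B c : R) :
  ~ (forall t, 0 <= t -> t * powR (expR c) r <= B).
Proof.
move=> le_B; have e0 : 0 < powR (expR c) r by rewrite powR_gt0// expR_gt0.
have := le_B ((`|B| + 1) / powR (expR c) r); rewrite divfK ?gt_eqF//.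
rewrite divr_ge0 ?addr_ge0 ?(ltW e0)// => /(_ isT).
by have := ler_norm B; lra.
Qed.

Lemma lp_bounded_log_kernel_b_gt0 : lp_bounded K p r -> 0 < b.
Proof.
move=> /lp_bounded_log_kernel_test[B HB]; rewrite ltNge; apply/negP => b0.
pose S := `|D| * ln 2 + (`|b - a| * (1 + ln 2) + `|E| * ln 2).
apply: (@not_le_unbounded_length B (- S - singular_loss)) => t t0.
have -> : t = (-1) - (-1 - t) by ring.
apply: (HB 0); [lra|exact: expR_ge0|] => v z /andP[_ v_le] /andP[z0 z1].
apply: log_kernel_ge; first by lra.
have [v0 vz] : v <= 0 /\ v <= z by split; lra.
have [[sv_le sv_gt] mono_vz] := (softplus_le0 v0, softplus_gt0 v, ler_softplus vz).
have [sz_le sz_gt] := (softplus_ge0 z0, softplus_gt z).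
have b_term : 0 <= - b * (z - v) by apply: mulr_ge0; lra.
have ba_term : - (`|b - a| * (1 + ln 2)) <= (b - a) * (softplus z - softplus v).
  by apply: lerNM_norm; rewrite ger0_norm; lra.
have D_term : - (`|D| * ln 2) <= D * (z - softplus z).
  by apply: lerNM_norm; rewrite ler0_norm; lra.
have E_term : - (`|E| * ln 2) <= E * - softplus v.
  by apply: lerNM_norm; rewrite normrN ger0_norm; lra.
by rewrite /S /log_phase; lra.
Qed.

Lemma lp_bounded_log_kernel_E_neq0 : lp_bounded K p r -> a = 0 -> E != 0.
Proof.
move=> /lp_bounded_log_kernel_test[B HB] a0; apply/eqP => E0.
pose S := `|D| * ln 2 + `|b| * ln 2.
apply: (@not_le_unbounded_length B (- S - singular_loss)) => t t0.
rewrite -[t]subr0; apply: (HB (t + 1)); [lra|exact: expR_ge0|].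
move=> v z /andP[v0 v_le] /andP[z_ge _]; apply: log_kernel_ge; first by lra.
have [z0 vz] : 0 <= z /\ v <= z by split; lra.
have [[sv_le sv_gt] lip_vz] := (softplus_ge0 v0, softplus_gt v, softplusB_le vz).
have [sz_le sz_gt] := (softplus_ge0 z0, softplus_gt z).
have D_term : - (`|D| * ln 2) <= D * (z - softplus z).
  by apply: lerNM_norm; rewrite ler0_norm; lra.
have b_term : - (`|b| * ln 2) <= b * - ((z - v) - (softplus z - softplus v)).
  by apply: lerNM_norm; rewrite normrN ger0_norm; lra.
by rewrite /S /log_phase a0 E0; lra.
Qed.

End Tests.

Lemma lp_bounded_log_kernelP (R : realType) (ka b a D E p r s : R) :
  1 <= p -> p <= r -> 0 <= s -> 1 - ka <= s -> s < 1 ->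
  (1 < p -> s <= 1 - (p^-1 - r^-1)) -> (p = 1 -> s * r < 1) ->
  0 <= a -> (a = 0 -> p = 1) ->
  lp_bounded (log_kernel ka b a D E) p r <->
  [/\ 0 < b, 0 <= D, 0 <= E & a = 0 -> 0 < E].
Proof.
move=> p1 pr s0 kas s1 s_le sr_lt a0 ap; have [p0 r0] : 0 < p /\ 0 < r by split; lra.
split=> [bnd|[b0 D0 E0 aE]].
  have E0 := lp_bounded_log_kernel_E_ge0 p0 r0 bnd; split=> //.
  - exact: lp_bounded_log_kernel_b_gt0 bnd.
  - exact: lp_bounded_log_kernel_D_ge0 bnd.
  - move=> az; rewrite lt_neqAle eq_sym E0 andbT.
    exact: lp_bounded_log_kernel_E_neq0 bnd az.
by apply: (lp_bounded_log_kernel s0 kas) => // az; rewrite ap ?aE.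
Qed.

Lemma radon_ineq_condN (R : realType) (k l : nat) (p r a1 a2 b1 b2 s : R) :
  1 <= p -> p <= r -> 1 + a2 <= p -> (0 < a2 -> 1 + a2 < p) ->
  0 <= s -> 1 - k.+1%:R / 2 <= s -> s < 1 ->
  (1 < p -> s <= 1 - (p^-1 - r^-1)) -> (p = 1 -> s * r < 1) ->
  radon_ineq k.+1 (k.+1 + l.+1) p r a1 a2 b1 b2 <->
  condN k.+1 (k.+1 + l.+1) p r a1 a2 b1 b2.
Proof.
move=> p1 pr pa a2_gt0 s0 ks s1 s_le sr_lt; have [p0 r0] : 0 < p /\ 0 < r by split; lra.
have aE : 2^-1 - (a2 + 1) / (2 * p) = (p - (1 + a2)) / (2 * p) by field; rewrite gt_eqF.
have a_ge0 : 0 <= 2^-1 - (a2 + 1) / (2 * p).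
  by rewrite aE divr_ge0 ?subr_ge0// mulr_ge0 ?ltW.
have a_eq0 : 2^-1 - (a2 + 1) / (2 * p) = 0 <-> p = 1 + a2.
  rewrite aE; split=> [/eqP|->]; last by rewrite subrr mul0r.
  by rewrite mulf_eq0 invr_eq0 (gt_eqF (mulr_gt0 (ltr0n R 2) p0)) orbF subr_eq0 => /eqP.
have p_eq1 : p = 1 + a2 -> p = 1.
  move=> pE; have : ~ 0 < a2 by move=> /a2_gt0; rewrite -pE ltxx.
  by move=> /negP; rewrite -leNgt; lra.
apply: (iff_trans (radon_ineq_lp_bounded _ _ _ _ _ _ p0 r0)).
apply: (iff_trans (lp_bounded_log_kernelP _ _ _ p1 pr s0 ks s1 s_le sr_lt a_ge0 _)).
  by move=> /a_eq0/p_eq1.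
rewrite /condN natrD; move: (k.+1%:R : R) (l.+1%:R : R) => kr lr.
rewrite !pmulr_lgt0 ?invr_gt0 ?mulr_gt0// !pmulr_lge0 ?invr_gt0// !subr_ge0 subr_gt0.
have -> : (kr - (kr + lr) < b1) = (0 < b1 + lr) by rewrite opprD addNKr -subr_gt0 opprK.
by split=> -[? ? ? edge]; split=> // /a_eq0; exact: edge.
Qed.

Theorem theorem4p8 (R : realType) (n k : nat) (a1 a2 b1 b2 p r : R) :
  (2 <= n)%N -> (1 <= k)%N -> (k <= n.-1)%N ->
  1 <= p -> 1 + a2 <= p -> (0 < a2 -> 1 + a2 < p) -> p <= r ->
  ((2 <= k)%N -> (radon_ineq k n p r a1 a2 b1 b2 <-> condN k n p r a1 a2 b1 b2))
  /\
  (k = 1%N ->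
     (1 < p -> p^-1 - r^-1 <= 2^-1) -> (p = 1 -> r < 2) ->
     (radon_ineq k n p r a1 a2 b1 b2 <-> condN k n p r a1 a2 b1 b2)).
Proof.
move=> n2 k1 kn p1 pa a2_gt0 pr.
have [p0 r0] : 0 < p /\ 0 < r by split; lra.
have [k' kE] : exists k', k = k'.+1 by exists k.-1; rewrite prednK.
have [l nE] : exists l, n = (k + l.+1)%N.
  exists (n - k).-1; rewrite prednK ?subnKC//; first by rewrite (leq_trans kn)// leq_pred.
  by rewrite subn_gt0 (leq_ltn_trans kn)// prednK// (leq_trans _ n2).
rewrite nE kE; split=> [k2|[k0] pr_le r_lt].
  apply: (@radon_ineq_condN _ _ _ _ _ _ _ _ _ 0) => //; last by rewrite mul0r.
  - have : 2 <= k'.+1%:R :> R by rewrite ler_nat.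
    by lra.
  - have : p^-1 <= 1 by rewrite invf_le1.
    by have : 0 < r^-1 by [rewrite invr_gt0]; lra.
rewrite k0; apply: (@radon_ineq_condN _ _ _ _ _ _ _ _ _ 2^-1) => //; [lra|lra| |].
- by move=> /pr_le; lra.
- by move=> /r_lt; lra.
Qed.
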